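(* Let $f:[0,\infty)\to\mathbb{R}$ be non-constant, nonincreasing and convex, and consider the optimal stopping problem $$\sup_{0\le\tau\le T}\mathrm{E}[f(M_T^\lambda-B_\tau^\lambda)].$$ (i) If $\lambda<0$, the rule $\tau\equiv0$ is the unique optimal rule. (ii) If $\lambda>0$, the rule $\tau\equiv T$ is the unique optimal rule. (iii) If $\lambda=0$, any stopping time $\tau$ satisfying $$\mathrm{P}(B_\tau^\lambda=M_\tau^\lambda\ \text{or}\ \tau=T)=1\qquad( * )$$ is optimal. (In particular, the rules $\tau\equiv 0$ and $\tau\equiv T$ are optimal.) If, furthermore, $f$ is not linear, then all optimal rules satisfy $( * )$.
   Context: Here $T>0$ is a fixed time horizon, $\lambda$ is a real parameter, $(B_t)_{t\ge0}$ is a standard Brownian motion, $B_t^\lambda:=B_t+\lambda t$ is Brownian motion with drift $\lambda$, and $M_t^\lambda:=\max\{B_s^\lambda:0\le s\le t\}$. The supremum is over all stopping times $\tau\le T$ with respect to the natural filtration of $(B_t)_{t\ge0}$; a stopping time (rule) is optimal if it attains the supremum. Uniqueness of stopping times is understood up to almost sure equality. ''Linear'' means of the form $f(x)=a+bx$ on $[0,\infty)$ with real constants $a,b$.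
   Formalization: In (i) and (ii) f is also assumed non-constant on (0,∞), and in the last claim of (iii) ''not linear'' means not linear on (0,∞); otherwise a jump of f at 0 (e.g. f(0)=1, f=0 on (0,∞)) makes every rule optimal and the claims false. *)

(* Defs.v *)
From HB Require Import structures.
From mathcomp Require Import all_boot all_order all_algebra.
From mathcomp Require Import all_classical all_reals all_analysis.

Set Implicit Arguments.
Unset Strict Implicit.
Unset Printing Implicit Defensive.

Import Order.TTheory GRing.Theory Num.Theory.
Import numFieldNormedType.Exports.

Local Open Scope classical_set_scope.
Local Open Scope ring_scope.

(* Processes are indexed by all of R, but only their values at times t >= 0
   are ever used. *)

(* The uncompleted filtration F_t = sigma(X_s : 0 <= s <= t). *)
Definition natural_filtration (R : realType) (Omega : Type)
    (X : R -> Omega -> R) (t : R) : set (set Omega) :=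
  <<s \bigcup_(s in `[0, t]) preimage_set_system setT (X s) measurable >>.

Definition stopping_time (R : realType) (Omega : Type)
    (F : R -> set (set Omega)) (tau : Omega -> R) : Prop :=
  (forall w, 0 <= tau w) /\ (forall t : R, 0 <= t -> F t [set w | tau w <= t]).

(* The second parameter of normal_prob is the standard deviation. *)
Definition brownian_motion (R : realType) (d : measure_display)
    (Omega : measurableType d) (P : probability Omega R)
    (B : R -> {RV P >-> R}) : Prop :=
  [/\ {ae P, forall w, B 0 w = 0},
      forall w, {within `[0, +oo[, continuous (fun t : R => B t w)},
      forall s t : R, 0 <= s -> s < t -> forall C : set R, measurable C ->
        P ((B t \- B s) @^-1` C) = normal_prob 0 (Num.sqrt (t - s)) C &
      forall s t : R, 0 <= s -> s < t ->
        forall (A : set Omega) (C : set R),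
          natural_filtration (fun u => B u) s A -> measurable C ->
          P (A `&` (B t \- B s) @^-1` C) =
            (P A * P ((B t \- B s)%R @^-1` C))%E].

Definition drifted (R : realType) (Omega : Type) (X : R -> Omega -> R)
    (lam : R) (t : R) (w : Omega) : R := X t w + lam * t.

(* For paths that are continuous on [0, t] the supremum is a maximum. *)
Definition running_max (R : realType) (Omega : Type) (X : R -> Omega -> R)
    (t : R) (w : Omega) : R := sup [set X s w | s in `[0, t]].

(* A convex nonincreasing f on [0, +oo[ may jump at 0, and f 0 does not affect
   the payoff because P(M_T = B_tau) = 0; hence uniqueness can only depend on
   f being nonconstant, or not linear, on the open half-line. *)
Definition nonconstant_on (R : realType) (D : set R) (f : R -> R) : Prop :=
  exists x y : R, [/\ D x, D y & f x <> f y].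

Definition linear_on (R : realType) (D : set R) (f : R -> R) : Prop :=
  exists a b : R, forall x, D x -> f x = a + b * x.

Section optimal_stopping.
Context (R : realType) (d : measure_display) (Omega : measurableType d).
Context (P : probability Omega R) (B : R -> {RV P >-> R}).
Context (lam T : R) (f : R -> R).

Definition stopping_rule (tau : Omega -> R) : Prop :=
  stopping_time (natural_filtration (fun t => B t)) tau /\
  (forall w, tau w <= T).

Definition payoff (tau : Omega -> R) : \bar R :=
  ('E_P[fun w => f (running_max (drifted (fun t => B t) lam) T w
                    - drifted (fun t => B t) lam (tau w) w)])%E.

Definition optimal_rule (tau : Omega -> R) : Prop :=
  stopping_rule tau /\ payoff tau = ereal_sup (payoff @` stopping_rule).

Definition unique_optimal_rule (tau : Omega -> R) : Prop :=
  optimal_rule tau /\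
  (forall sigma, optimal_rule sigma -> {ae P, forall w, sigma w = tau w}).

Definition stops_at_max_or_end (tau : Omega -> R) : Prop :=
  P [set w | drifted (fun t => B t) lam (tau w) w
               = running_max (drifted (fun t => B t) lam) (tau w) w
             \/ tau w = T] = 1%E.

End optimal_stopping.

(* Main.v *)
(* Fix the drift [mu = |lam|] and write [Z k t = B t + k t]. Given the past up to
   [t], by time reversal the final lag [max_[t,T] Z mu - Z mu T] has the law of the
   running maximum [max_[t,T] Z (-mu) - Z (-mu) t]. Let [x] be the lag of [Z lam] at
   [t]. A tangent inequality for the convex payoff [h] at [x] turns this equality in
   law into: stopping at [t] is on average no better than continuing to [T] with
   drift [mu] after [t]. Approximating a stopping rule from above by rules with
   finitely many values, every rule [tau] earns at most the expected payoff of the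
   final lag of [Z mu]; this is attained by [T] when [lam = mu] and, by time
   reversal at [t = 0], by [0] when [lam = - mu].
   The bound is strict when, with positive probability after [tau], the path stays
   in a narrow tube around a line along which the tangent inequality is strict; such
   tubes have conditional probability bounded below. When [lam < 0], the bound itself
   improves: on [tau > t] the drift [mu] is needed only after [t], and keeping the
   drift [lam] before [t] makes the final lag strictly larger.
   Finally, with payoff [max 0 (1 - y / e)] and [e] tending to [0], the bound shows
   that no rule stops at the overall maximum with positive probability, so the value
   of [f] at [0] is irrelevant. *)
Require Import Defs.
From HB Require Import structures.
From mathcomp Require Import all_boot all_order all_algebra.
From mathcomp Require Import all_classical all_reals all_analysis.
From mathcomp Require Import measurable_realfun ring lra.

Set Implicit Arguments.
Unset Strict Implicit.
Unset Printing Implicit Defensive.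

Import Order.TTheory GRing.Theory Num.Theory.
Import numFieldNormedType.Exports.

Local Open Scope classical_set_scope.
Local Open Scope ring_scope.

(** * Maxima of continuous paths over segments and dyadic grids *)

Section path_maximum.
Context {R : realType}.
Implicit Types (g : R -> R) (a b c u v : R).

(** Time reversal is proved without any formula for the law of a Brownian maximum. On a grid both
    functionals iterate y -> max 0 (y + increment), with the increments taken in opposite orders;
    independent increments of equal law make the order irrelevant, and dyadic refinement gives the
    continuous statement. The current lag enters the payoffs of stopping and of continuing through a
    maximum, so the two laws cannot be compared under the payoff itself. Prolonging the payoff
    linearly to the left of the lag gives a function whose two expectations agree and whose
    pointwise difference is at most the actual gain from continuing. Strict gains must survive the
    limit of discretised rules. They are stated as lower bounds rho * P(A) with rho independent of
    the time t and the past event A; this requires a margin before T and bounded lags, and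
    exhaustion removes both restrictions. The competitor in the bound is any variable Q below all
    continued gaps from the rule onwards, a freedom used for lam < 0. Payoffs grow at most linearly,
    so an integrable path range dominates them; it comes from second moments along the same
    recursion. *)

Variant path_continuous g : Prop :=
  PathContinuous of {within `[0, +oo[, continuous g}.

Definition seg_max g a b : R := sup [set g s | s in `[a, b]].

Lemma path_continuous_eps g u (e : R) : path_continuous g -> 0 <= u -> 0 < e ->
  exists2 dl : R, 0 < dl & forall v, 0 <= v -> `|v - u| < dl -> `|g v - g u| < e.
Proof.
move=> [cg] u0 e0; move/subspace_continuousP : cg => /(_ u) /=.
rewrite in_itv/= u0 => /(_ isT)/cvgrPdist_lt/(_ _ e0).
rewrite near_withinE near_nbhs => /nbhs_ballP[dl /= dl0 H].
exists dl => // v v0 vu; rewrite distrC; apply: H; last by rewrite /= in_itv/= v0.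
by rewrite /ball/= distrC.
Qed.

Lemma path_continuousD g1 g2 : path_continuous g1 -> path_continuous g2 ->
  path_continuous (g1 \+ g2).
Proof. by move=> [c1] [c2]; split=> x; apply: cvgD; [exact: c1|exact: c2]. Qed.

Lemma path_continuousN g : path_continuous g -> path_continuous (\- g).
Proof. by move=> [c1]; split=> x; apply: cvgN; exact: c1. Qed.

Lemma path_continuousZ (k : R) : path_continuous ( *%R k).
Proof. by split; apply: continuous_subspaceT => x; exact: mulrl_continuous. Qed.

Lemma seg_max_attained g a b : path_continuous g -> 0 <= a -> a <= b ->
  exists c, [/\ a <= c, c <= b, g c = seg_max g a b &
    forall u, a <= u -> u <= b -> g u <= seg_max g a b].
Proof.
move=> cg a0 ab.
have [|c] := @EVT_max R g a b ab.
  case: cg => cg; apply: continuous_subspaceW cg => x /=; rewrite !in_itv/= => /andP[ax _].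
  by rewrite (le_trans a0).
rewrite in_itv/= => /andP[ac cb] H.
have E : g c = seg_max g a b.
  apply/eqP; rewrite eq_le; apply/andP; split.
    apply: ub_le_sup; last by exists c => //=; rewrite in_itv/= ac.
    by exists (g c) => _ [x xab <-]; exact: H.
  apply: ge_sup; first by exists (g c), c => //=; rewrite in_itv/= ac.
  by move=> _ [x xab <-]; exact: H.
by exists c; split => // u au ub; rewrite -E; apply: H; rewrite in_itv/= au.
Qed.

Lemma seg_max_ub g a b u : path_continuous g -> 0 <= a -> a <= u -> u <= b ->
  g u <= seg_max g a b.
Proof.
move=> cg a0 au ub.
by have [c [_ _ _]] := seg_max_attained cg a0 (le_trans au ub); exact.
Qed.

Lemma seg_max_le g a b c : path_continuous g -> 0 <= a -> a <= b ->
  (forall u, a <= u -> u <= b -> g u <= c) -> seg_max g a b <= c.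
Proof.
by move=> cg a0 ab H; have [x [ax xb <- _]] := seg_max_attained cg a0 ab; exact: H.
Qed.

Lemma seg_max_split g a u b : path_continuous g -> 0 <= a -> a <= u -> u <= b ->
  seg_max g a b = Num.max (seg_max g a u) (seg_max g u b).
Proof.
move=> cg a0 au ub; have u0 : 0 <= u by lra.
apply/eqP; rewrite eq_le; apply/andP; split.
  apply: seg_max_le => //; first lra.
  move=> x ax xb; rewrite le_max.
  have [xu|/ltW ux] := leP x u; first by rewrite seg_max_ub.
  by rewrite (seg_max_ub cg u0 ux xb) orbT.
rewrite ge_max; apply/andP; split; apply: seg_max_le => // x ax xb;
  apply: seg_max_ub => //; lra.
Qed.

Lemma seg_max_le_sub g a b a' b' : path_continuous g -> 0 <= a -> a <= a' ->
  a' <= b' -> b' <= b -> seg_max g a' b' <= seg_max g a b.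
Proof.
move=> cg a0 aa ab bb; apply: seg_max_le => //; first lra.
by move=> u au ub; apply: seg_max_ub => //; lra.
Qed.

(** One-sided on purpose: stopping times are approximated from above, so only times just after [u]
    matter. *)
Lemma seg_max_near g u (e : R) : path_continuous g -> 0 <= u -> 0 < e ->
  exists2 dl : R, 0 < dl &
    forall v, u <= v -> v < u + dl -> seg_max g u v <= g u + e /\ `|g v - g u| <= e.
Proof.
move=> cg u0 e0; have [dl dl0 H] := path_continuous_eps cg u0 e0.
exists dl => // v uv vd; split; last first.
  by apply/ltW/H; [lra|rewrite ger0_norm; lra].
apply: seg_max_le => // x ux xv.
have /H : 0 <= x by lra.
rewrite ger0_norm; last lra.
have xd : x - u < dl by lra.
by move=> /(_ xd); rewrite ltr_norml; lra.
Qed.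

Lemma cvg_path g u (un : nat -> R) : path_continuous g -> 0 <= u ->
  (forall n, u <= un n) -> un @ \oo --> u -> (g \o un) @ \oo --> g u.
Proof.
move=> cg u0 uun unu; apply/cvgrPdist_le => e e0.
have [dl dl0 H] := seg_max_near cg u0 e0.
move/cvgrPdist_lt : unu => /(_ _ dl0); apply: filterS => n /= nd.
have [] // := H (un n); last by rewrite distrC.
by move: nd; have := uun n; rewrite ltr_norml; lra.
Qed.

Lemma cvg_seg_maxl g u (un : nat -> R) : path_continuous g -> 0 <= u ->
  (forall n, u <= un n) -> un @ \oo --> u ->
  seg_max g 0 (un n) @[n --> \oo] --> seg_max g 0 u.
Proof.
move=> cg u0 uun unu; apply/cvgrPdist_le => e e0.
have [dl dl0 H] := seg_max_near cg u0 e0.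
move/cvgrPdist_lt : unu => /(_ _ dl0); apply: filterS => n /= nd.
have [|H1 _] := H (un n) (uun n).
  by move: nd; have := uun n; rewrite ltr_norml; lra.
rewrite (seg_max_split cg _ u0 (uun n))//.
have := seg_max_ub cg (lexx 0) u0 (lexx u).
have := uun n.
by case: (leP (seg_max g 0 u) (seg_max g u (un n))) => ? ? ?;
  rewrite ler_norml; lra.
Qed.

Lemma cvg_seg_maxr g u b (un : nat -> R) : path_continuous g -> 0 <= u ->
  (forall n, u <= un n) -> (forall n, un n <= b) -> un @ \oo --> u ->
  seg_max g (un n) b @[n --> \oo] --> seg_max g u b.
Proof.
move=> cg u0 uun unb unu; apply/cvgrPdist_le => e e0.
have e20 : 0 < e / 2 by lra.
have [dl dl0 H] := seg_max_near cg u0 e20.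
move/cvgrPdist_lt : unu => /(_ _ dl0); apply: filterS => n /= nd.
have [|H1 H2] := H (un n) (uun n).
  by move: nd; have := uun n; rewrite ltr_norml; lra.
rewrite (seg_max_split cg u0 (uun n) (unb n)).
have un0 : 0 <= un n by rewrite (le_trans u0).
have := seg_max_ub cg un0 (lexx _) (unb n).
move: H2; case: (leP (seg_max g u (un n)) (seg_max g (un n) b)) => ?;
  rewrite !ler_norml => ?; lra.
Qed.

Definition dyadic a b (m k : nat) : R := a + k%:R * ((b - a) / 2 ^+ m).

Lemma dyadic_in a b m k : a <= b -> (k <= 2 ^ m)%N ->
  a <= dyadic a b m k <= b.
Proof.
move=> ab km; have ba : 0 <= b - a by lra.
rewrite /dyadic lerDl mulr_ge0 ?divr_ge0 ?exprn_ge0//=.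
rewrite -lerBrDl mulrCA ler_piMr// ler_pdivrMr ?exprn_gt0// mul1r.
by rewrite -natrX ler_nat.
Qed.

Lemma dyadic_end a b m : dyadic a b m (2 ^ m) = b.
Proof.
by rewrite /dyadic natrX mulrCA divff ?expf_neq0// mulr1; lra.
Qed.

Lemma dyadic_dense a b u (e : R) : a <= u -> u <= b -> 0 < e ->
  exists m k, (k <= 2 ^ m)%N /\ `|dyadic a b m k - u| < e.
Proof.
move=> au ub e0.
have [ab|ba] := ltP a b; last first.
  exists 0%N, 0%N; split => //; rewrite /dyadic mul0r addr0.
  by have -> : u = a; [lra|rewrite subrr normr0].
have ba0 : 0 < b - a by lra.
(* Since [m < 2 ^ m], this depth already makes the mesh smaller than [e]. *)
set m := (Num.trunc ((b - a) / e)).+1.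
have H : (b - a) / 2 ^+ m < e.
  rewrite ltr_pdivrMr ?exprn_gt0// mulrC -ltr_pdivrMr//.
  apply: lt_le_trans (truncnS_gt _) _.
  by rewrite -natrX ler_nat ltnW// ltn_expl.
have h0 : 0 < (b - a) / 2 ^+ m by rewrite divr_gt0 ?exprn_gt0.
set h := (b - a) / 2 ^+ m in H h0 *.
have uh0 : 0 <= (u - a) / h by rewrite divr_ge0 ?(ltW h0)//; lra.
set k := Num.trunc ((u - a) / h).
have /andP[k1 k2] := truncn_itv uh0; rewrite -/k in k1 k2.
exists m, k; split.
  rewrite -(ler_nat R) natrX (le_trans k1)// ler_pdivrMr// /h mulrCA divff ?expf_neq0//.
  lra.
rewrite /dyadic -/h; move: k1 k2; rewrite ler_pdivlMr// ltr_pdivrMr// => k1 k2.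
have := k2; rewrite -natr1 mulrDl => k3.
by rewrite ltr_norml; lra.
Qed.

(** By continuity the dyadic points decide the maximum, so its sublevel events are countable
    intersections of grid events. Measurability and the passage of laws from grids to segments both
    rest on this form. *)
Lemma seg_max_dyadicP g a b c : path_continuous g -> 0 <= a -> a <= b ->
  (seg_max g a b <= c) <->
  (forall m k, (k <= 2 ^ m)%N -> g (dyadic a b m k) <= c).
Proof.
move=> cg a0 ab; split=> [H m k km|H].
  by have /andP[? ?] := dyadic_in ab km; apply: le_trans H; exact: seg_max_ub.
apply: seg_max_le => // u au ub; apply/ler_addgt0Pr => e e0.
have u0 : 0 <= u by lra.
have [dl dl0 Hd] := path_continuous_eps cg u0 e0.
have [m [k [km]]] := dyadic_dense au ub dl0.
have /andP[d1 d2] := dyadic_in ab km.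
move=> /(Hd _ (le_trans a0 d1)); rewrite ltr_norml.
by have := H _ _ km; lra.
Qed.

Lemma dyadicS a b m k : dyadic a b m.+1 (k.*2) = dyadic a b m k.
Proof.
rewrite /dyadic exprS -muln2 natrM; congr (_ + _).
by field; rewrite expf_neq0.
Qed.

End path_maximum.

(** * Convex nonincreasing payoffs: right slopes and tangents *)

Section convex_decreasing.
Context {R : realType}.
Implicit Types (h : R -> R) (x y z a b p m : R).

(** [regularize] extends a payoff by a constant to the negative axis, which destroys convexity
    across 0; hence the chord inequality only between positive points, while continuity and
    monotonicity are global. *)
Definition convex_payoff h := [/\ continuous h, nonincreasing_fun h &
  forall x y z, 0 < x -> x < y -> y < z ->
    (h y - h x) * (z - y) <= (h z - h y) * (y - x)].

(* The right derivative of [h], set to [0] outside of the open half-line. *)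
Definition rslope h x : R :=
  if 0 < x then inf [set (h y - h x) / (y - x) | y in `]x, +oo[] else 0.

Section fixed.
Variable h : R -> R.
Hypothesis hh : convex_payoff h.

Let hni : forall x y, x <= y -> h y <= h x.
Proof. by case: hh => _ H _ x y xy; exact: H. Qed.

Lemma chord_le x y z : 0 < x -> x < y -> y < z ->
  (h y - h x) / (y - x) <= (h z - h y) / (z - y).
Proof.
case: hh => _ _ H x0 xy yz.
rewrite ler_pdivrMr; last lra.
by rewrite mulrAC ler_pdivlMr; [exact: H|lra].
Qed.

Let slopes x := [set (h y - h x) / (y - x) | y in `]x, +oo[].

Let slopes0 x : slopes x !=set0.
Proof. by exists ((h (x + 1) - h x) / (x + 1 - x)), (x + 1) => //=; rewrite in_itv/=; lra. Qed.

Let slopes_lb x : 0 < x -> has_lbound (slopes x).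
Proof.
move=> x0; exists ((h x - h (x / 2)) / (x - x / 2)) => _ [y /= + <-].
rewrite in_itv/= andbT => xy; apply: chord_le => //; lra.
Qed.

Lemma rslope_le_chord x y : 0 < x -> x < y -> rslope h x <= (h y - h x) / (y - x).
Proof.
move=> x0 xy; rewrite /rslope x0; apply: ge_inf; first exact: slopes_lb.
by exists y => //=; rewrite in_itv/= xy.
Qed.

Lemma chord_le_rslope x y : 0 < x -> x < y -> (h y - h x) / (y - x) <= rslope h y.
Proof.
move=> x0 xy; rewrite /rslope (lt_trans x0 xy); apply: lb_le_inf; first exact: slopes0.
by move=> _ [z /= + <-]; rewrite in_itv/= andbT => yz; exact: chord_le.
Qed.

Lemma rslope_nondecreasing x y : 0 < x -> x <= y -> rslope h x <= rslope h y.
Proof.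
rewrite le_eqVlt => x0 /orP[/eqP->//|xy].
exact: le_trans (rslope_le_chord x0 xy) (chord_le_rslope x0 xy).
Qed.

Lemma rslope_le0 x : rslope h x <= 0.
Proof.
have [x0|x0] := ltP 0 x; last by rewrite /rslope ltNge x0.
have x1 : x < x + 1 by lra.
apply: le_trans (rslope_le_chord x0 x1) _.
by rewrite pmulr_lle0 ?invr_gt0; [rewrite subr_le0; apply: hni; lra|lra].
Qed.

Lemma tangent_le x y : 0 < x -> 0 <= y -> h x + rslope h x * (y - x) <= h y.
Proof.
move=> x0 y0.
have pos z : 0 < z -> h x + rslope h x * (z - x) <= h z.
  move=> z0; have [xz|zx|->] := ltgtP x z; last by rewrite subrr mulr0 addr0.
  - have := rslope_le_chord x0 xz; rewrite ler_pdivlMr; lra.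
  - have := chord_le_rslope z0 zx; rewrite ler_pdivrMr; last lra.
    by rewrite !mulrBr; lra.
move: y0; rewrite le_eqVlt => /orP[/eqP<-|]; last exact: pos.
apply/ler_addgt0Pr => e e0.
have [c0|c0] := eqVneq (rslope h x) 0.
  have := pos x x0; have := hni (ltW x0); rewrite c0; lra.
have c1 : 0 < - rslope h x.
  by rewrite oppr_gt0 lt_neqAle c0 rslope_le0.
(* At this point the tangent is lower than at 0 by exactly [e], and [h 0] is at least the value of
   [h] there. *)
have ec : 0 < e / - rslope h x by rewrite divr_gt0.
have := pos _ ec; have := hni (ltW ec).
have -> : rslope h x * (e / - rslope h x - x) = - e - rslope h x * x by field.
by rewrite mulrBr; lra.
Qed.

Lemma rslope_increment x y z : 0 < x -> x <= y -> y <= z ->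
  h y + rslope h x * (z - y) <= h z.
Proof.
move=> x0 xy yz; have y0 : 0 < y by lra.
apply: le_trans (tangent_le y0 _); last lra.
by rewrite lerD2l ler_wpM2r ?rslope_nondecreasing; lra.
Qed.

(* Comparing payoffs with [h] linearised to the left of the current lag [x] costs
   nothing on average: [lag] and [fwd_seg] of the future have the same law, and
   only nonnegative corrections remain. *)
Definition tangent_ext x m : R := if x <= m then h m else h x + rslope h x * (m - x).

Lemma tangent_ext_le0 x m : 0 <= x -> 0 <= m -> tangent_ext x m <= h 0.
Proof.
move=> x0 m0; rewrite /tangent_ext; case: (leP x m) => [xm|mx]; first exact: hni.
have x1 : 0 < x by lra.
exact: le_trans (tangent_le x1 m0) (hni m0).
Qed.

Lemma tangent_ext_ge x m : h (Num.max x m) <= tangent_ext x m.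
Proof.
rewrite /tangent_ext; case: (leP x m) => // mx.
rewrite lerDl; have := rslope_le0 x; nra.
Qed.

(** Read [x] as the current lag, [a] and [b] as the future maxima for the larger and the smaller
    drift, [D] as the final increment. If [x <= a], the tangent inequality at [a - D] and
    [tangent_ext_ge] at [b] suffice. If [a < x], stopping yields [h x], and by convexity raising the
    final lag from [a - D] to [x - D] costs no more than the slope at [x] predicts. *)
Lemma tangent_ext_exchange x a b D : 0 <= x -> 0 <= b -> b <= a -> D <= a ->
  tangent_ext x (a - D) - tangent_ext x b <= h (Num.max x a - D) - h (Num.max x b).
Proof.
move=> x0 b0 ba Da.
have [xa|ax] := leP x a.
  have H : tangent_ext x (a - D) <= h (a - D).
    rewrite /tangent_ext; case: (leP x (a - D)) => // xD.
    by apply: tangent_le; lra.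
  by have := tangent_ext_ge x b; lra.
have x1 : 0 < x by lra.
have cx := rslope_le0 x.
have -> : Num.max x b = x by apply/max_idPl; lra.
rewrite {2}/tangent_ext (leNgt x b) (le_lt_trans ba ax)/=.
have [xD|Dx] := leP x (a - D).
  rewrite /tangent_ext xD.
  have aD : a - D <= x - D by lra.
  have := rslope_increment x1 xD aD; nra.
rewrite /tangent_ext (leNgt x) Dx/=.
have D0 : 0 <= x - D by lra.
have := tangent_le x1 D0; nra.
Qed.

(** Strictness from a fall of the path: the final lag moves from [a - D] to [x - D], both at least
    [q], where the slopes of [h] exceed the tangent slope at [x] by at least [rslope h q - m]. *)
Lemma tangent_ext_exchange_convex_right x a D q m dl : 0 < q -> 0 <= a ->
  rslope h x <= m -> m <= rslope h q -> 0 < dl -> dl <= x - a ->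
  x <= - D -> q <= - D ->
  tangent_ext x (a - D) - tangent_ext x a + (rslope h q - m) * dl <=
  h (Num.max x a - D) - h (Num.max x a).
Proof.
move=> q0 a0 cx mq dl0 dlx xD qD.
have -> : Num.max x a = x by apply/max_idPl; lra.
rewrite /tangent_ext (_ : x <= a - D); last lra.
rewrite (leNgt x a) (_ : a < x)/=; last lra.
have qa : q <= a - D by lra.
have aD : a - D <= x - D by lra.
have := rslope_increment q0 qa aD; nra.
Qed.

(** Strictness from a rise of the path: the final lag [a - D] is at most [p / 2], and there the
    tangent at [p] lies above the tangent at [x] by at least the difference of slopes times
    [p / 2]. *)
Lemma tangent_ext_exchange_convex_left x a b D p m : 0 < p -> p < x ->
  rslope h p <= m -> m <= rslope h x -> x <= a -> D <= a -> a - D <= p / 2 ->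
  tangent_ext x (a - D) - tangent_ext x b + (m - rslope h p) * (p / 2) <=
  h (Num.max x a - D) - h (Num.max x b).
Proof.
move=> p0 px cp cx xa Da aD.
have -> : Num.max x a = a by apply/max_idPr.
have H := tangent_ext_ge x b.
have x0 : 0 < x by lra.
rewrite {1}/tangent_ext (leNgt x (a - D)) (_ : a - D < x)/=; last lra.
have aD0 : 0 <= a - D by lra.
have := tangent_le p0 aD0.
have := tangent_le x0 (ltW p0).
nra.
Qed.

(** On [0, p] the slope of [tangent_ext x] is at most half of [rslope h p]: left of [x] it is
    [rslope h x], right of [x] it is a slope of [h] before [p]. It serves the case of positive
    drift, where the two future maxima [b] and [a] differ. *)
Lemma tangent_ext_gap x a b a' p : 0 <= x -> 0 < p ->
  x <= p \/ rslope h x <= rslope h p / 2 ->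
  0 <= b -> b <= a' -> a' <= p -> a' <= a ->
  - rslope h p / 2 * (a' - b) <= tangent_ext x b - tangent_ext x a.
Proof.
move=> x0 p0 xp b0 ba ap aa.
have c0 := rslope_le0.
have cp := c0 p.
have mono : tangent_ext x a <= tangent_ext x a'.
  rewrite /tangent_ext; case: (leP x a) => xa; case: (leP x a') => xa'.
  - exact: hni.
  - have := hni xa; have := c0 x; nra.
  - lra.
  - have := c0 x; nra.
suff H : - rslope h p / 2 * (a' - b) <= tangent_ext x b - tangent_ext x a' by lra.
rewrite /tangent_ext; case: (leP x b) => xb.
  rewrite (le_trans xb ba).
  move: ba; rewrite le_eqVlt => /orP[/eqP->|ba]; first lra.
  have a0 : 0 < a' by lra.
  have := tangent_le a0 b0; have := rslope_nondecreasing a0 ap; nra.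
have x1 : 0 < x by lra.
have cxp : x <= p -> rslope h x <= rslope h p by move=> ?; exact: rslope_nondecreasing.
have cx : rslope h x <= rslope h p / 2.
  by case: xp => // /cxp; lra.
case: (leP x a') => xa; last by nra.
have a0 : 0 < a' by lra.
have := tangent_le a0 x0; have := rslope_nondecreasing a0 ap; nra.
Qed.

(** Bounded above by [h 0] and below by the tangent at 1. *)
Lemma payoff_linear_growth : exists2 C : R, 0 < C &
  forall y, 0 <= y -> `|h y| <= C * (1 + y).
Proof.
exists (`|h 0| + `|h 1| - rslope h 1 + 1).
  have := rslope_le0 1; have := normr_ge0 (h 0); have := normr_ge0 (h 1); lra.
move=> y y0; have := tangent_le (@ltr01 R) y0; have := hni y0.
have := rslope_le0 1; have := ler_norm (h 0); have := ler_norm (- h 1).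
have := normr_ge0 (h 0); have := normr_ge0 (h 1).
rewrite normrN ler_norml => h1 h2 h3 h4 h5 h6 h7; apply/andP; split; nra.
Qed.

Lemma measurable_payoff : measurable_fun setT h.
Proof. by apply: continuous_measurable_fun; case: hh. Qed.

Lemma measurable_rslope : measurable_fun setT (rslope h).
Proof.
(* [rslope] is monotone only on the open half-line. Exponentiating puts the default value below all
   others, so [k] is monotone on the whole line, and [ln] recovers [rslope] because [ln 0 = 0]. *)
pose k x := if 0 < x then expR (rslope h x) else 0.
have -> : rslope h = @ln R \o k.
  apply/funext => x; rewrite /k /=; case: ifPn => x0; first by rewrite expRK.
  by rewrite ln0// /rslope (negbTE x0).
apply: measurableT_comp; first exact: measurable_ln.
apply: nondecreasing_measurable => // x y xy; rewrite /k.
case: ifPn => x0; last by case: ifPn => // _; exact: expR_ge0.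
by rewrite (lt_le_trans x0 xy) ler_expR rslope_nondecreasing.
Qed.

Lemma measurable_tangent_ext :
  measurable_fun setT (fun q : R * R => tangent_ext q.1 q.2).
Proof.
apply: measurable_fun_ifT.
- by apply: measurable_fun_ler; [exact: measurable_fst|exact: measurable_snd].
- by apply: (measurableT_comp measurable_payoff); exact: measurable_snd.
- apply: measurable_funD.
    by apply: (measurableT_comp measurable_payoff); exact: measurable_fst.
  apply: measurable_funM.
    by apply: (measurableT_comp measurable_rslope); exact: measurable_fst.
  by apply: measurable_funB; [exact: measurable_snd|exact: measurable_fst].
Qed.

Lemma rslope_lt0_exists : nonconstant_on `]0, +oo[ h ->
  exists2 p, 0 < p & rslope h p < 0.
Proof.
move=> [x [y []]]; rewrite /= !in_itv/= !andbT => x0 y0 xy.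
wlog lt_xy : x y x0 y0 xy / x < y.
  move=> H; have [xy'|yx|E] := ltgtP x y; first exact: (H x y).
    by apply: (H y x) => //; exact/nesym.
  by case: xy; rewrite E.
exists x => //; apply: le_lt_trans (rslope_le_chord x0 lt_xy) _.
rewrite pmulr_llt0 ?invr_gt0 ?subr_gt0// subr_lt0 lt_neqAle (hni (ltW lt_xy)) andbT.
by apply/eqP; exact/nesym.
Qed.

Lemma rslope_lt_exists : ~ linear_on `]0, +oo[ h ->
  exists p q, [/\ 0 < p, p < q & rslope h p < rslope h q].
Proof.
move=> nl; apply: contrapT => H; apply: nl.
have cst x y : 0 < x -> 0 < y -> rslope h x = rslope h y.
  have le u v : 0 < u -> u < v -> rslope h u = rslope h v.
    move=> u0 uv; apply/eqP; rewrite eq_le rslope_nondecreasing//=; last exact: ltW.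
    by rewrite leNgt; apply/negP => c; apply: H; exists u, v.
  move=> x0 y0; have [xy|yx|->//] := ltgtP x y; first exact: le.
  by rewrite (le y x).
exists (h 1 - rslope h 1), (rslope h 1) => x; rewrite /= in_itv/= andbT => x0.
have := tangent_le (@ltr01 R) (ltW x0); have := tangent_le x0 (@ler01 R).
by rewrite (cst x 1)//; lra.
Qed.

End fixed.
End convex_decreasing.

(** * Removing a jump of the payoff at 0 *)

Section continuous_version.
Context {R : realType}.
Variable f : R -> R.
Hypothesis f_noninc : {in `[0, +oo[ &, nonincreasing_fun f}.
Hypothesis f_convex : convex_function (`[0, +oo[ : set R^o) f.

(** The supremum over positive arguments is the right limit of [f] at 0, as [f] is nonincreasing. *)
Definition regularize (y : R) : R :=
  if 0 < y then f y else sup [set f z | z in `]0, +oo[].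

Lemma regularize_pos y : 0 < y -> regularize y = f y.
Proof. by rewrite /regularize => ->. Qed.

Let f_ni x y : 0 <= x -> x <= y -> f y <= f x.
Proof.
by move=> x0 xy; apply: f_noninc => //; rewrite in_itv/= andbT//; exact: le_trans xy.
Qed.

Lemma convex_chord x y z : 0 <= x -> x < y -> y < z ->
  (f y - f x) * (z - y) <= (f z - f y) * (y - x).
Proof.
move=> x0 xy yz.
have zx : 0 < z - x by lra.
have t0 : 0 <= (z - y) / (z - x) by rewrite divr_ge0; lra.
have t1 : (z - y) / (z - x) <= 1 by rewrite ler_pdivrMr; lra.
have := f_convex (Itv01 t0 t1) (x := x) (y := z).
rewrite !inE/= !in_itv/= !andbT => /(_ x0); have z0 : 0 <= z by lra.
move=> /(_ z0).
rewrite /conv/=/=.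
have -> : (z - y) / (z - x) *: (x : R^o) + (1 - (z - y) / (z - x)) *: (z : R^o) = y.
  by rewrite /GRing.scale/=; field; lra.
rewrite -[X in _ <= X -> _]/((z - y) / (z - x) * f x + (1 - (z - y) / (z - x)) * f z) => H.
rewrite -subr_ge0; rewrite -subr_ge0 in H.
have := mulr_ge0 (ltW zx) H.
by congr (0 <= _); field; lra.
Qed.

Let S := sup [set f z | z in `]0, +oo[].

Let S_ub z : 0 < z -> f z <= S.
Proof.
move=> z0; apply: ub_le_sup; last by exists z => //=; rewrite in_itv/= z0.
by exists (f 0) => _ [x /= + <-]; rewrite in_itv/= andbT => x0; apply: f_ni => //; exact: ltW.
Qed.

Let regularize_ni : nonincreasing_fun regularize.
Proof.
move=> x y xy; rewrite /regularize; case: (ltP 0 x) => x0.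
  by rewrite (lt_le_trans x0 xy); apply: f_ni => //; exact: ltW.
by case: (ltP 0 y) => y0; [exact: S_ub|].
Qed.

Let continuous_regularize : continuous regularize.
Proof.
move=> u; apply/cvgrPdist_le => e e0; apply/nbhs_ballP => /=.
have [u0|u0] := leP u 0.
  have [_ [z /= + <-] zS] : exists2 w, [set f z | z in `]0, +oo[] w & S - e < w.
    apply: sup_adherent => //; split; first by exists (f 1), 1 => //=; rewrite in_itv/= ltr01.
    by exists (f 0) => _ [x /= + <-]; rewrite in_itv/= andbT => x0; apply: f_ni => //; exact: ltW.
  rewrite in_itv/= andbT => z0.
  exists (z - u); first by rewrite /=; lra.
  move=> v; rewrite /ball/= => vu.
  have -> : regularize u = S by rewrite /regularize ltNge u0.
  have vz : v <= z by move: vu; rewrite ltr_norml; lra.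
  have H1 := regularize_ni vz; rewrite {1}/regularize z0 in H1.
  have H2 : regularize v <= S.
    by rewrite /regularize; case: ifPn => // v0; exact: S_ub.
  by rewrite ger0_norm; lra.
(* Minus the slope of the chord over [u / 4, u / 2]: by convexity [f] falls no faster than this to
   the right of [u / 2], which gives a local Lipschitz bound. *)
pose s := (f (u / 4) - f (u / 2)) / (u / 4).
have s0 : 0 <= s by apply: divr_ge0; [rewrite subr_ge0; apply: f_ni; lra|lra].
have lip x y : u / 2 < x -> x < y -> f x - f y <= s * (y - x).
  move=> ux xy.
  have u4 : 0 <= u / 4 by lra.
  have u42 : u / 4 < u / 2 by lra.
  have ux0 : 0 < x - u / 2 by lra.
  have xy0 : 0 < y - x by lra.
  have E : f (u / 4) - f (u / 2) = s * (u / 4) by rewrite /s; field; lra.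
  have H1 := convex_chord u4 u42 ux.
  have u2 : 0 <= u / 2 by lra.
  have H2 := convex_chord u2 ux xy.
  have H3 : - s * (x - u / 2) <= f x - f (u / 2).
    rewrite -(ler_pM2r (_ : 0 < u / 4)); last lra.
    have -> : - s * (x - u / 2) * (u / 4) = - (s * (u / 4)) * (x - u / 2) by ring.
    by rewrite -E; lra.
  rewrite -(ler_pM2r ux0).
  nra.
exists (Num.min (u / 2) (e / (s + 1))).
  by rewrite /= lt_min !divr_gt0//; lra.
move=> v; rewrite /ball/= lt_min => /andP[v1 v2].
have v0 : u / 2 < v by move: v1; rewrite ltr_norml; lra.
rewrite /regularize u0 (_ : 0 < v); last lra.
have e1 : `|u - v| * (s + 1) < e by rewrite -ltr_pdivlMr//; lra.
have [uv|vu|<-] := ltgtP u v; last by rewrite subrr normr0 ltW.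
  have uv' : u / 2 < u by lra.
  have := lip _ _ uv' uv; have := f_ni (ltW u0) (ltW uv).
  move: e1; rewrite ltr0_norm; last lra.
  by move=> ? ? ?; rewrite ger0_norm; nra.
have v00 : 0 <= v by lra.
have := lip _ _ v0 vu; have := f_ni v00 (ltW vu).
move: e1; rewrite gtr0_norm; last lra.
by move=> ? ? ?; rewrite ler0_norm; nra.
Qed.

Lemma convex_payoff_regularize : convex_payoff regularize.
Proof.
split => // x y z x0 xy yz.
by rewrite !regularize_pos; [apply: convex_chord => //; exact: ltW|lra..].
Qed.

Lemma nonconstant_regularize : nonconstant_on `]0, +oo[ f ->
  nonconstant_on `]0, +oo[ regularize.
Proof.
move=> [x [y [x0 y0 xy]]]; exists x, y; split => //.
by move: x0 y0; rewrite /= !in_itv/= !andbT => x0 y0; rewrite !regularize_pos.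
Qed.

Lemma linear_regularize : linear_on `]0, +oo[ regularize -> linear_on `]0, +oo[ f.
Proof.
move=> [a [b H]]; exists a, b => x x0; rewrite -H//.
by move: x0; rewrite /= in_itv/= andbT => x0; rewrite regularize_pos.
Qed.

End continuous_version.

(** * The cutoff payoff *)

Section cutoff.
Context {R : realType}.

(** On the nonnegative half-line it lies between the indicators of 0 and of [0, e]. *)
Definition cutoff (e y : R) : R := Num.max 0 (1 - y / e).

Lemma convex_payoff_cutoff (e : R) : 0 < e -> convex_payoff (cutoff e).
Proof.
move=> e0; split.
- move=> y; apply: (@continuous_max R R (cst 0) (fun y => 1 - y / e) y).
    exact: cvg_cst.
  apply: (@cvgB _ R^o); first exact: cvg_cst.
  by apply: cvgM; [exact: cvg_id|exact: cvg_cst].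
- move=> x y xy; rewrite /cutoff; apply: le_max2 => //.
  by rewrite lerD2l lerN2 ler_pM2r ?invr_gt0.
- move=> x y z x0 xy yz; rewrite /cutoff.
  have i0 : 0 < e^-1 by rewrite invr_gt0.
  have [h1 h2] : y * e^-1 - x * e^-1 >= 0 /\ z * e^-1 - y * e^-1 >= 0.
    by rewrite -!mulrBl; split; rewrite mulr_ge0; lra.
  case: (leP 0 (1 - x / e)) => hx; case: (leP 0 (1 - y / e)) => hy;
    case: (leP 0 (1 - z / e)) => hz; nra.
Qed.

Lemma cutoff_ge0 (e y : R) : 0 <= cutoff e y.
Proof. by rewrite /cutoff le_max lexx. Qed.

Lemma cutoff_le1 (e y : R) : 0 < e -> 0 <= y -> cutoff e y <= 1.
Proof. by move=> e0 y0; rewrite /cutoff ge_max ler01 gerBl divr_ge0// ltW. Qed.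

Lemma cutoff0 (e : R) : cutoff e 0 = 1.
Proof. by rewrite /cutoff mul0r subr0; apply/max_idPr. Qed.

Lemma cutoff_out (e y : R) : 0 < e -> e <= y -> cutoff e y = 0.
Proof.
by move=> e0 ey; apply/max_idPl; rewrite subr_le0 ler_pdivlMr// mul1r.
Qed.

End cutoff.

(** * Real-valued probabilities and equality of joint laws *)

Section real_probability.
Context {R : realType} {d : measure_display} {Omega : measurableType d}.
Variable P : probability Omega R.

Definition pr (A : set Omega) : R := fine (P A).

Lemma prE A : measurable A -> P A = (pr A)%:E.
Proof. by move=> mA; rewrite /pr fineK// fin_num_measure. Qed.

Lemma pr_ge0 A : 0 <= pr A. Proof. exact: fine_ge0. Qed.

Lemma pr_setT : pr setT = 1. Proof. by rewrite /pr probability_setT. Qed.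

Lemma pr_mono A B : measurable A -> measurable B -> A `<=` B -> pr A <= pr B.
Proof.
move=> mA mB AB; rewrite -lee_fin -!prE//; apply: le_measure => //; rewrite ?inE//.
Qed.

Lemma pr_le1 A : measurable A -> pr A <= 1.
Proof. by move=> mA; rewrite -pr_setT; apply: pr_mono. Qed.

Lemma pr_setU A B : measurable A -> measurable B -> A `&` B = set0 ->
  pr (A `|` B) = pr A + pr B.
Proof.
move=> mA mB AB; apply: EFin_inj; rewrite EFinD -!prE//; last exact: measurableU.
exact: measureU.
Qed.

Lemma pr_setID A B : measurable A -> measurable B ->
  pr A = pr (A `&` B) + pr (A `&` ~` B).
Proof.
move=> mA mB; rewrite -pr_setU; last first.
- by rewrite setIACA setICr setI0.
- by apply: measurableI => //; exact: measurableC.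
- exact: measurableI.
- by rewrite -setIUr setUv setIT.
Qed.

Lemma pr_setU_le A B : measurable A -> measurable B -> pr (A `|` B) <= pr A + pr B.
Proof.
move=> mA mB; rewrite -lee_fin EFinD -!prE//; last exact: measurableU.
exact: measureU2.
Qed.

Lemma pr_setC A : measurable A -> pr (~` A) = 1 - pr A.
Proof.
move=> mA; have := pr_setID measurableT mA.
by rewrite !setTI pr_setT; lra.
Qed.

(** Continuity from below, applied to the part of [G] that lies in all [Gn n] from index [m] on; the
    events [Gn] need not be monotone. *)
Lemma pr_eventually (G : set Omega) (Gn : nat -> set Omega) (e : R) :
  measurable G -> (forall n, measurable (Gn n)) ->
  (forall w, G w -> exists m, forall n, (m <= n)%N -> Gn n w) -> 0 < e ->
  exists m, forall n, (m <= n)%N -> pr G - e < pr (Gn n).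
Proof.
move=> mG mGn ev e0.
pose H m := G `&` \bigcap_(n in [set n | (m <= n)%N]) Gn n.
have mH m : measurable (H m).
  by apply: measurableI => //; apply: bigcap_measurableType => // n _.
have UH : \bigcup_m H m = G.
  apply/seteqP; split=> [w [m _ []]//|w Gw].
  by have [m Hm] := ev w Gw; exists m => //; split => // n /= mn; exact: Hm.
have ndH : nondecreasing_seq H.
  move=> m n mn; apply/subsetPset => w [Gw Hw]; split => // k /= nk.
  by apply: Hw => /=; exact: leq_trans nk.
have : P \o H @ \oo --> P G.
  by rewrite -UH; apply: nondecreasing_cvg_mu => //; rewrite UH.
have -> : P \o H = EFin \o (pr \o H) by apply/funext => m /=; rewrite prE.
rewrite prE// => /fine_cvgP[_] /= /cvgrPdist_lt/(_ _ e0)[m _ Hm].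
exists m => n mn.
have := Hm n mn; rewrite /= ltr_norml => /andP[_].
have : pr (H n) <= pr (Gn n).
  by apply: pr_mono => // w [_]; apply => /=.
by lra.
Qed.

Lemma measurable_pre (f : Omega -> R) (C : set R) : measurable_fun setT f ->
  measurable C -> measurable (f @^-1` C).
Proof. by move=> mf mC; rewrite -[X in measurable X]setTI; exact: mf. Qed.

(** Finite measures on the plane that agree on rectangles agree everywhere. The event [A] and the
    factor [k], typically its probability, let one statement carry independence of the past. *)
Lemma pair_law (A : set Omega) (k : R) (U1 V1 U2 V2 : Omega -> R) :
  measurable A -> 0 <= k ->
  measurable_fun setT U1 -> measurable_fun setT V1 ->
  measurable_fun setT U2 -> measurable_fun setT V2 ->
  (forall C C', measurable C -> measurable C' ->
    pr (A `&` U1 @^-1` C `&` V1 @^-1` C') = k * pr (U2 @^-1` C `&` V2 @^-1` C')) ->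
  forall S : set (R * R), measurable S ->
    pr (A `&` (fun w => (U1 w, V1 w)) @^-1` S) =
    k * pr ((fun w => (U2 w, V2 w)) @^-1` S).
Proof.
move=> mA k0 mU1 mV1 mU2 mV2 H S mS.
pose W1 w := (U1 w, V1 w); pose W2 w := (U2 w, V2 w).
have mW1 : measurable_fun setT W1 by exact: measurable_fun_pair.
have mW2 : measurable_fun setT W2 by exact: measurable_fun_pair.
have m1 S' : measurable S' -> measurable (W1 @^-1` S').
  by move=> mS'; rewrite -[X in measurable X]setTI; exact: mW1.
have m2 S' : measurable S' -> measurable (W2 @^-1` S').
  by move=> mS'; rewrite -[X in measurable X]setTI; exact: mW2.
pose nu1 : {measure set (R * R) -> \bar R} :=
  measure_function_pushforward__canonical__measure_function_Measure (mrestr P mA) mW1.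
pose nu2 : {measure set (R * R) -> \bar R} := mscale (NngNum k0)
  (measure_function_pushforward__canonical__measure_function_Measure P mW2).
have E1 S' : measurable S' -> nu1 S' = (pr (A `&` W1 @^-1` S'))%:E.
  move=> mS'; rewrite -prE; last by apply: measurableI => //; exact: m1.
  by rewrite /nu1/= /pushforward/= /mrestr setIC.
have E2 S' : measurable S' -> nu2 S' = (k * pr (W2 @^-1` S'))%:E.
  move=> mS'; rewrite EFinM -prE; last exact: m2.
  by rewrite /nu2/= /mscale/=.
apply: EFin_inj; rewrite -E1// -E2//.
apply: (@measure_unique _ _ _ [set C `*` C' | C in measurable & C' in measurable]
  (fun=> setT)) => //.
- exact: measurable_prod_measurableType.
- move=> _ _ [C mC [C' mC' <-]] [D mD [D' mD' <-]].
  exists (C `&` D); first exact: measurableI.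
  exists (C' `&` D'); first exact: measurableI.
  by rewrite setXI.
- by move=> _; exists setT => //; exists setT => //; rewrite setXTT.
- by rewrite bigcup_const.
- move=> _ [C mC [C' mC' <-]].
  rewrite E1; last exact: measurableX.
  rewrite E2; last exact: measurableX.
  congr EFin; have := H _ _ mC mC'; rewrite -setIA.
  by rewrite /W1 /W2 /preimage/= => <-.
- by move=> _; rewrite E1// ltry.
Qed.

Lemma pair_law_comp (A : set Omega) (k : R) (U1 V1 U2 V2 : Omega -> R)
    (phi : R * R -> R) :
  measurable A -> 0 <= k ->
  measurable_fun setT U1 -> measurable_fun setT V1 ->
  measurable_fun setT U2 -> measurable_fun setT V2 ->
  measurable_fun setT phi ->
  (forall C C', measurable C -> measurable C' ->
    pr (A `&` U1 @^-1` C `&` V1 @^-1` C') = k * pr (U2 @^-1` C `&` V2 @^-1` C')) ->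
  forall C, measurable C ->
    pr (A `&` (fun w => phi (U1 w, V1 w)) @^-1` C) =
    k * pr ((fun w => phi (U2 w, V2 w)) @^-1` C).
Proof.
move=> mA k0 mU1 mV1 mU2 mV2 mphi H C mC.
apply: (pair_law mA k0 mU1 mV1 mU2 mV2 H (S := phi @^-1` C)).
by rewrite -[X in measurable X]setTI; exact: mphi.
Qed.

Lemma pair_law_integral (U V1 V2 : Omega -> R) (F : R * R -> \bar R) :
  measurable_fun setT U -> measurable_fun setT V1 -> measurable_fun setT V2 ->
  measurable_fun setT F -> (forall q, (0 <= F q)%E) ->
  (forall C C', measurable C -> measurable C' ->
    pr (U @^-1` C `&` V1 @^-1` C') = pr (U @^-1` C `&` V2 @^-1` C')) ->
  (\int[P]_w F (U w, V1 w) = \int[P]_w F (U w, V2 w))%E.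
Proof.
move=> mU mV1 mV2 mF F0 H.
pose W1 w := (U w, V1 w); pose W2 w := (U w, V2 w).
have mW1 : measurable_fun setT W1 by exact: measurable_fun_pair.
have mW2 : measurable_fun setT W2 by exact: measurable_fun_pair.
have m1 S' : measurable S' -> measurable (W1 @^-1` S').
  by move=> mS'; rewrite -[X in measurable X]setTI; exact: mW1.
have m2 S' : measurable S' -> measurable (W2 @^-1` S').
  by move=> mS'; rewrite -[X in measurable X]setTI; exact: mW2.
pose nu1 : {measure set (R * R) -> \bar R} :=
  measure_function_pushforward__canonical__measure_function_Measure P mW1.
pose nu2 : {measure set (R * R) -> \bar R} :=
  measure_function_pushforward__canonical__measure_function_Measure P mW2.
transitivity (\int[nu1]_q F q)%E.
  by rewrite /nu1/= ge0_integral_pushforward// => q _.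
transitivity (\int[nu2]_q F q)%E; last first.
  by rewrite /nu2/= ge0_integral_pushforward// => q _.
apply: eq_measure_integral => S mS _.
rewrite /nu1 /nu2/= /pushforward !prE; [|exact: m2|exact: m1].
congr EFin.
have := @pair_law setT 1 U V1 U V2 measurableT ler01 mU mV1 mU mV2.
rewrite /W1 /W2 => /(_ _ S mS); rewrite setTI mul1r; apply.
by move=> C C' mC mC'; rewrite setTI mul1r; exact: H.
Qed.

End real_probability.

(** * Normal laws: symmetry, small intervals, second moment *)

Section normal_facts.
Context {R : realType}.
Variable s : R.
Hypothesis s0 : 0 < s.
Local Notation mu := (@lebesgue_measure R).
Local Notation nu := (normal_prob 0 s).

Let s_neq0 : s != 0. Proof. by rewrite gt_eqF. Qed.

Lemma normal_pdfN x : normal_pdf 0 s (- x) = normal_pdf 0 s x.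
Proof. by rewrite normal_pdfE// /normal_fun !subr0 sqrrN. Qed.

Let mpdf (D : set R) : measurable_fun D (EFin \o normal_pdf 0 s).
Proof. by apply/measurable_funTS/measurable_EFinP; exact: measurable_normal_pdf. Qed.

Lemma normal_probN (C : set R) : measurable C ->
  nu (-%R @^-1` C) = nu C.
Proof.
move=> mC; rewrite /normal_prob.
transitivity (\int[pushforward mu (-%R : _ -> measurableTypeR R)]_(x in C)
    (normal_pdf 0 s x)%:E)%E.
  rewrite ge0_integral_pushforward//=.
  - by apply: eq_integral => x _ /=; rewrite normal_pdfN.
  - exact: mpdf.
  - by move=> x _; rewrite lee_fin normal_pdf_ge0.
by apply: eq_measure_integral => //= A mA _; exact: lebesgue_measureN.
Qed.

Lemma normal_prob_half : (2^-1%:E <= nu `[0%R, +oo[%classic)%E.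
Proof.
have E : (nu (-%R @^-1` `[0%R, +oo[%classic) = nu `[0%R, +oo[%classic)%E.
  exact: normal_probN.
have H : (1 <= nu `[0%R, +oo[%classic + nu `[0%R, +oo[%classic)%E.
  rewrite -{2}E -(probability_setT nu).
  have -> : [set: R] = `[0%R, +oo[%classic `|` -%R @^-1` `[0%R, +oo[%classic.
    apply/seteqP; split => // x _.
    have [x0|x0] := leP 0 x; [left|right]; rewrite /= in_itv/= ?x0// andbT; lra.
  apply: measureU2 => //.
  by rewrite -[X in measurable X]setTI; exact: oppr_measurable.
have fin : nu `[0%R, +oo[%classic \is a fin_num by exact: fin_num_measure.
move: H; rewrite -(fineK fin) -EFinD !lee_fin; lra.
Qed.

(** The density is at most [1 / s], because [2 * pi] is at least 1. *)
Lemma normal_prob_near0 (r : R) : 0 <= r -> (nu `[0%R, r[%classic <= (r / s)%:E)%E.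
Proof.
move=> r0; rewrite /normal_prob.
apply: (@le_trans _ _ (\int[mu]_(x in `[0%R, r[) (s^-1)%:E)%E).
  apply: ge0_le_integral => //=.
  - by move=> x _; rewrite lee_fin normal_pdf_ge0.
  - exact: mpdf.
  - move=> x _; rewrite lee_fin.
    apply: le_trans (normal_pdf_ub _ _ s_neq0) _.
    rewrite /normal_peak lef_pV2 ?posrE ?sqrtr_gt0//; last first.
      by rewrite mulrn_wgt0// mulr_gt0 ?pi_gt0// exprn_gt0.
    rewrite -{1}(ger0_norm (ltW s0)) -sqrtr_sqr ler_sqrt; last first.
      by rewrite mulrn_wge0// mulr_ge0 ?pi_ge0// sqr_ge0.
    rewrite -mulrnAr ler_peMr ?sqr_ge0//.
    have := @pi_ge2 R; rewrite -mulr_natr; lra.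
rewrite integral_cst//= lebesgue_measure_itv/= lte_fin.
case: ifPn => r1; first by rewrite -EFinB subr0 -EFinM mulrC lee_fin.
by rewrite mule0 lee_fin divr_ge0// ltW.
Qed.

(** The change of variables goes through the Radon-Nikodym derivative, which agrees with the density
    almost everywhere since both have the same integrals over measurable sets. *)
Lemma ge0_integral_normal_prob (g : R -> \bar R) : measurable_fun setT g ->
  (forall x, (0 <= g x)%E) ->
  (\int[nu]_x g x = \int[mu]_x (g x * (normal_pdf 0 s x)%:E))%E.
Proof.
move=> mg g0.
have dom := @normal_prob_dominates R 0 s.
rewrite -(Radon_Nikodym_SigmaFinite.change_of_variables dom)//.
apply: ae_eq_integral => //.
- apply: emeasurable_funM => //.
  exact: measurable_int (Radon_Nikodym_SigmaFinite.f_integrable dom).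
- by apply: emeasurable_funM => //; exact: mpdf.
- apply: ae_eqe_mul2l => /=.
  apply: integral_ae_eq => //=.
  + exact: Radon_Nikodym_SigmaFinite.f_integrable.
  + exact: mpdf.
  + move=> E _ mE.
    by rewrite -(Radon_Nikodym_SigmaFinite.f_integral dom).
Qed.

Lemma normal_second_moment : (\int[nu]_x (x ^+ 2)%:E < +oo)%E.
Proof.
rewrite ge0_integral_normal_prob; last 2 first.
- by apply/measurable_EFinP; exact: exprn_measurable.
- by move=> x; rewrite lee_fin sqr_ge0.
(* Doubling the variance absorbs the square: with [z = x ^+ 2 / (4 * s ^+ 2)] the old exponential is
   [expR (- z) ^+ 2] and [z * expR (- z) <= 1], so [K] times the wider density dominates. *)
pose s' := Num.sqrt 2 * s.
have s'0 : 0 < s' by rewrite mulr_gt0// sqrtr_gt0.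
have s'n : s' != 0 by rewrite gt_eqF.
have s'2 : s' ^+ 2 = 2 * s ^+ 2 by rewrite exprMn sqr_sqrtr.
pose K := 4 * s ^+ 2 * normal_peak s / normal_peak s'.
have pk := normal_peak_gt0 s_neq0.
have pk' := normal_peak_gt0 s'n.
have K0 : 0 <= K by rewrite !mulr_ge0 ?invr_ge0 ?sqr_ge0// ltW.
apply: (@le_lt_trans _ _ (\int[mu]_x (K%:E * (normal_pdf 0 s' x)%:E))%E); last first.
  rewrite ge0_integralZl//.
  - by rewrite integral_normal_pdf mule1 ltry.
  - by apply/measurable_EFinP; exact: measurable_normal_pdf.
  - by move=> x _; rewrite lee_fin normal_pdf_ge0.
apply: ge0_le_integral => //.
- by move=> x _; rewrite -EFinM lee_fin mulr_ge0 ?sqr_ge0 ?normal_pdf_ge0.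
- apply: emeasurable_funM; last exact: mpdf.
  by apply/measurable_EFinP; exact: exprn_measurable.
- apply: emeasurable_funM => //.
  by apply/measurable_EFinP; exact: measurable_normal_pdf.
move=> x _; rewrite -!EFinM lee_fin !normal_pdfE// /normal_fun !subr0.
rewrite [leRHS]mulrA /K divfK ?gt_eqF// s'2.
pose z := x ^+ 2 / (4 * s ^+ 2).
have -> : - x ^+ 2 / (s ^+ 2 *+ 2) = - z - z by rewrite /z; field.
have -> : - x ^+ 2 / (2 * s ^+ 2 *+ 2) = - z by rewrite /z; field.
have xz : x ^+ 2 = 4 * s ^+ 2 * z by rewrite /z; field.
rewrite xz expRD.
have ez := expR_ge1Dx z.
have e1 : expR (- z) * expR z = 1 by rewrite -expRD addNr expR0.
have e0 := expR_gt0 (- z).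
have z1 : z * expR (- z) <= 1 by nra.
have -> : 4 * s ^+ 2 * z * (normal_peak s * (expR (- z) * expR (- z))) =
  4 * s ^+ 2 * normal_peak s * expR (- z) * (z * expR (- z)) by ring.
by rewrite ler_piMr// !mulr_ge0 ?sqr_ge0// ltW.
Qed.

End normal_facts.

(** * The natural filtration and adapted variables *)

Section filtration.
Context {R : realType} {d : measure_display} {Omega : measurableType d}.
Variable X : R -> Omega -> R.
Hypothesis mX : forall t, measurable_fun setT (X t).
Local Notation F := (natural_filtration X).

Definition generators (t : R) : set (set Omega) :=
  \bigcup_(s in `[0, t]) preimage_set_system setT (X s) measurable.

Definition adapted (t : R) (g : Omega -> R) : Prop :=
  measurable_fun setT (g : g_sigma_algebraType (generators t) -> R).

Lemma filtration_measurable t A : F t A -> measurable A.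
Proof.
apply: smallest_sub; first exact: sigma_algebra_measurable.
by move=> _ [s _ [C mC <-]]; exact: mX.
Qed.

Lemma filtration_mono s t A : s <= t -> F s A -> F t A.
Proof.
move=> st; apply: smallest_sub; first exact: smallest_sigma_algebra.
move=> B [u + BX]; rewrite /= in_itv/= => /andP[u0 us].
apply: sub_gen_smallest; exists u => //.
by rewrite /= in_itv/= u0 (le_trans us st).
Qed.

Lemma filtrationT t : F t setT.
Proof. exact: (@measurableT _ (g_sigma_algebraType (generators t))). Qed.

Lemma filtrationI t A B : F t A -> F t B -> F t (A `&` B).
Proof. exact: (@measurableI _ (g_sigma_algebraType (generators t))). Qed.

Lemma filtrationC t A : F t A -> F t (~` A).
Proof. exact: (@measurableC _ (g_sigma_algebraType (generators t))). Qed.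

Lemma adapted_preimage t g C : adapted t g -> measurable C -> F t (g @^-1` C).
Proof. by move=> ag mC; rewrite -[_ @^-1` _]setTI; exact: ag. Qed.

Lemma adapted_mono s t g : s <= t -> adapted s g -> adapted t g.
Proof. by move=> st ag _ C mC; apply: (filtration_mono st); exact: ag. Qed.

Lemma adapted_measurable t g : adapted t g -> measurable_fun setT g.
Proof. by move=> ag _ C mC; apply: (@filtration_measurable t); exact: ag. Qed.

Lemma adapted_coord s t : 0 <= s -> s <= t -> adapted t (X s).
Proof.
move=> s0 st _ C mC; apply: sub_gen_smallest; exists s.
  by rewrite /= in_itv/= s0.
by exists C.
Qed.

End filtration.

(** * Measurability of path maxima *)

Section max_measurable.
Context {R : realType} {d : measure_display} {T : measurableType d}.
Variable Z : R -> T -> R.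
Hypothesis cZ : forall w, path_continuous (Z ^~ w).

Lemma measurable_le_fun (g : T -> R) :
  (forall c, measurable [set w | g w <= c]) -> measurable_fun setT g.
Proof.
move=> H; apply: (measurability _ (RGenOInfty.measurableE R)) => _ [_ [x ->] <-].
rewrite setTI.
have -> : g @^-1` `]x, +oo[%classic = ~` [set w | g w <= x].
  apply/seteqP; split => w /=; rewrite in_itv/= andbT ltNge => /negP//.
exact: measurableC.
Qed.

Lemma measurable_seg_max (a b : R) : 0 <= a -> a <= b ->
  (forall u, a <= u -> u <= b -> measurable_fun setT (Z u)) ->
  measurable_fun setT (fun w => seg_max (Z ^~ w) a b).
Proof.
move=> a0 ab mZ; apply: measurable_le_fun => c.
have -> : [set w | seg_max (Z ^~ w) a b <= c] =
    \bigcap_m \bigcap_(k in [set k | (k <= 2 ^ m)%N])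
      [set w | Z (dyadic a b m k) w <= c].
  apply/seteqP; split => w /=.
    by move=> /(seg_max_dyadicP _ (cZ w) a0 ab) H m _ k /= km; exact: H.
  by move=> H; apply/(seg_max_dyadicP _ (cZ w) a0 ab) => m k km; exact: H.
apply: bigcapT_measurable => m; apply: bigcap_measurableType => // k /= km.
have /andP[d1 d2] := dyadic_in ab km.
have := mZ _ d1 d2 measurableT `]-oo, c]%classic (measurable_itv _).
by rewrite setTI.
Qed.

End max_measurable.

(** * Grid walks and discrete time reversal *)

Section increments.
Context {R : realType} {d : measure_display} {Omega : measurableType d}.
Variable P : probability Omega R.
Variable X : R -> Omega -> R.
Hypothesis mX : forall t, measurable_fun setT (X t).
Local Notation F := (natural_filtration X).
Local Notation pr := (pr P).

(** For positive [h], the normal law with mean [kappa * h] and variance [h]. *)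
Definition step_law (kappa h : R) (C : set R) : R :=
  fine (normal_prob 0 (Num.sqrt h) [set y | C (y + kappa * h)]).

(* [Z] has continuous paths and is, relative to the filtration of [X], a
   Brownian motion with drift [kappa] up to its starting value. *)
Record drifted_bm (kappa : R) (Z : R -> Omega -> R) : Prop := DriftedBM {
  bm_adapted : forall s t, 0 <= s -> s <= t -> adapted X t (Z s) ;
  bm_continuous : forall w, path_continuous (Z ^~ w) ;
  bm_step : forall t h A C, 0 <= t -> 0 < h -> F t A -> measurable C ->
    pr (A `&` [set w | C (Z (t + h) w - Z t w)]) = pr A * step_law kappa h C }.

Section walk.
Variables (kappa : R) (Z : R -> Omega -> R).
Hypothesis hZ : drifted_bm kappa Z.

(* Maximum over the grid [t], [t + h], .. , [t + n h] of the increment from [t]. *)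
Fixpoint fwd_max (h : R) (n : nat) (t : R) (w : Omega) : R :=
  if n is m.+1 then
    Num.max 0 (fwd_max h m (t + h) w + (Z (t + h) w - Z t w))
  else 0.

(* Maximum over the same grid of the increment up to [t + n h]; the recursion
   is Lindley's. *)
Fixpoint bwd_max (h : R) (n : nat) (t : R) (w : Omega) : R :=
  if n is m.+1 then
    Num.max 0 (bwd_max h m t w + (Z (t + m%:R * h + h) w - Z (t + m%:R * h) w))
  else 0.

Lemma adapted_fwd_max h n t : 0 <= t -> 0 <= h ->
  adapted X (t + n%:R * h) (fwd_max h n t).
Proof.
move=> + h0; elim: n t => [|n IH] t t0; first exact: measurable_cst.
have nh : 0 <= n%:R * h by rewrite mulr_ge0.
have E : t + n.+1%:R * h = t + h + n%:R * h by rewrite -natr1; ring.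
rewrite E; apply: measurable_maxr; first exact: measurable_cst.
apply: measurable_funD; first by apply: IH; lra.
by apply: measurable_funB; apply: (bm_adapted hZ); lra.
Qed.

Lemma adapted_bwd_max h n t : 0 <= t -> 0 <= h ->
  adapted X (t + n%:R * h) (bwd_max h n t).
Proof.
move=> t0 h0; elim: n => [|n IH]; first exact: measurable_cst.
have nh : 0 <= n%:R * h by rewrite mulr_ge0.
have E : t + n.+1%:R * h = t + n%:R * h + h by rewrite -natr1; ring.
rewrite E; apply: measurable_maxr; first exact: measurable_cst.
apply: measurable_funD; first by apply: adapted_mono IH; lra.
by apply: measurable_funB; apply: (bm_adapted hZ); lra.
Qed.

(** Connects the recursion, which determines the law, with the grid points, which determine the
    limit. *)
Lemma fwd_max_le h n t w c :
  (fwd_max h n t w <= c) = [forall k : 'I_n.+1, Z (t + k%:R * h) w - Z t w <= c].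
Proof.
elim: n t c => [|n IH] t c /=.
  apply/idP/forallP => [c0 k|/(_ ord0)]; last by rewrite mul0r addr0 subrr.
  by rewrite (ord1 k) mul0r addr0 subrr.
rewrite ge_max -lerBrDr IH; apply/andP/forallP => [[c0 /forallP H] k|H].
  case: (unliftP ord0 k) => [j|] ->; last by rewrite mul0r addr0 subrr.
  have := H j; rewrite lift0 -natr1.
  have -> : t + h + j%:R * h = t + (j%:R + 1) * h by ring.
  lra.
split; first by have := H ord0; rewrite mul0r addr0 subrr.
apply/forallP => j; have := H (lift ord0 j); rewrite lift0 -natr1.
have -> : t + h + j%:R * h = t + (j%:R + 1) * h by ring.
lra.
Qed.

Lemma bwd_max_le h n t w c : (bwd_max h n t w <= c) =
  [forall k : 'I_n.+1, Z (t + n%:R * h) w - Z (t + k%:R * h) w <= c].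
Proof.
elim: n c => [|n IH] c /=.
  apply/idP/forallP => [c0 k|/(_ ord0)]; last by rewrite mul0r addr0 subrr.
  by rewrite (ord1 k) mul0r addr0 subrr.
have E : t + n.+1%:R * h = t + n%:R * h + h by rewrite -natr1; ring.
rewrite ge_max -lerBrDr IH E; apply/andP/forallP => [[c0 /forallP H] k|H].
  case: (unliftP ord_max k) => [j|] ->; last by rewrite E subrr.
  have := H j; rewrite lift_max; lra.
split; first by have := H ord_max; rewrite E subrr.
apply/forallP => j; have := H (lift ord_max j); rewrite lift_max; lra.
Qed.

End walk.

Let lindley : R * R -> R := fun q => Num.max 0 (q.1 + q.2).

Let mlindley : measurable_fun setT lindley.
Proof.
apply: measurable_maxr; first exact: measurable_cst.
by apply: measurable_funD; [exact: measurable_fst|exact: measurable_snd].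
Qed.

Let mincr kappa Z : drifted_bm kappa Z -> forall s t, 0 <= s -> 0 <= t ->
  measurable_fun setT (fun w => Z s w - Z t w).
Proof.
move=> hZ s t s0 t0; apply: measurable_funB.
  exact: (adapted_measurable mX (bm_adapted hZ s0 (lexx s))).
exact: (adapted_measurable mX (bm_adapted hZ t0 (lexx t))).
Qed.

(* Stated with respect to the law at time [0] of a possibly different process,
   so that the law depends on [kappa], [h] and [n] only. *)
Lemma bwd_max_law kappa Z Z0 h n t A C :
  drifted_bm kappa Z -> drifted_bm kappa Z0 -> 0 <= t -> 0 < h -> F t A ->
  measurable C ->
  pr (A `&` bwd_max Z h n t @^-1` C) = pr A * pr (bwd_max Z0 h n 0 @^-1` C).
Proof.
move=> hZ hZ0 t0 h0 FA; have mA := filtration_measurable mX FA.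
elim: n C => [|n IH] C mC.
  rewrite !preimage_cst; case: ifP => _; first by rewrite setIT pr_setT mulr1.
  by rewrite setI0 /pr measure0/= mulr0.
have nh : 0 <= n%:R * h by rewrite mulr_ge0// ltW.
have aL := @adapted_bwd_max _ _ hZ h n t t0 (ltW h0).
have aL0 := @adapted_bwd_max _ _ hZ0 h n 0 (lexx 0) (ltW h0).
apply: (@pair_law_comp _ _ _ P A (pr A) (bwd_max Z h n t)
  (fun w => Z (t + n%:R * h + h) w - Z (t + n%:R * h) w) (bwd_max Z0 h n 0)
  (fun w => Z0 (0 + n%:R * h + h) w - Z0 (0 + n%:R * h) w) lindley) => //.
- exact: pr_ge0.
- exact: adapted_measurable aL.
- by apply: (mincr hZ); lra.
- exact: adapted_measurable aL0.
- by apply: (mincr hZ0); lra.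
move=> D D' mD mD'.
rewrite (bm_step hZ _ h0 _ mD'); last 2 first.
- lra.
- apply: filtrationI; last exact: adapted_preimage aL mD.
  by apply: filtration_mono FA; lra.
rewrite (bm_step hZ0 _ h0 _ mD'); last 2 first.
- lra.
- exact: adapted_preimage aL0 mD.
by rewrite IH// mulrA.
Qed.

(** Time reversal for the walk. The forward recursion splits off the first increment, and the
    remaining maximum is independent of the past at [t + h], which contains that increment. The
    backward recursion splits off the last increment, independent of the maximum before it. Both
    pairs have the same product law and enter the same map [lindley]. *)
Lemma fwd_max_law kappa Z Z0 h n t A C :
  drifted_bm kappa Z -> drifted_bm kappa Z0 -> 0 <= t -> 0 < h -> F t A ->
  measurable C ->
  pr (A `&` fwd_max Z h n t @^-1` C) = pr A * pr (bwd_max Z0 h n 0 @^-1` C).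
Proof.
move=> hZ hZ0 + h0; elim: n t A C => [|n IH] t A C t0 FA mC.
  rewrite !preimage_cst; case: ifP => _; first by rewrite setIT pr_setT mulr1.
  by rewrite setI0 /pr measure0/= mulr0.
have mA := filtration_measurable mX FA.
have nh : 0 <= n%:R * h by rewrite mulr_ge0// ltW.
have th : 0 <= t + h by lra.
have aM := @adapted_fwd_max _ _ hZ h n (t + h) th (ltW h0).
have aL0 := @adapted_bwd_max _ _ hZ0 h n 0 (lexx 0) (ltW h0).
apply: (@pair_law_comp _ _ _ P A (pr A) (fwd_max Z h n (t + h))
  (fun w => Z (t + h) w - Z t w) (bwd_max Z0 h n 0)
  (fun w => Z0 (0 + n%:R * h + h) w - Z0 (0 + n%:R * h) w) lindley) => //.
- exact: pr_ge0.
- exact: adapted_measurable aM.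
- by apply: (mincr hZ); lra.
- exact: adapted_measurable aL0.
- by apply: (mincr hZ0); lra.
move=> D D' mD mD'.
(* The event on the first increment joins the past at [t + h], to which the induction hypothesis
   applies. *)
rewrite setIAC IH//; last first.
  apply: filtrationI; first by apply: filtration_mono FA; lra.
  apply: (@adapted_preimage _ _ _ _ _ (fun w => Z (t + h) w - Z t w) D') => //.
  by apply: measurable_funB; apply: (bm_adapted hZ); lra.
rewrite (bm_step hZ t0 h0 FA mD').
rewrite (bm_step hZ0 _ h0 _ mD'); last 2 first.
- lra.
- exact: adapted_preimage aL0 mD.
by ring.
Qed.

End increments.

(** * From grids to segments: time reversal in continuous time *)

Section max_law.
Context {R : realType} {d : measure_display} {Omega : measurableType d}.
Variable P : probability Omega R.
Variable X : R -> Omega -> R.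
Hypothesis mX : forall t, measurable_fun setT (X t).
Local Notation F := (natural_filtration X).
Local Notation pr := (pr P).
Local Notation drifted_bm := (drifted_bm P X).

Lemma pr_decreasing (A : set Omega) (G : nat -> set Omega) :
  measurable A -> (forall n, measurable (G n)) ->
  (forall m n, (m <= n)%N -> G n `<=` G m) ->
  pr (A `&` G n) @[n --> \oo] --> pr (A `&` \bigcap_n G n).
Proof.
move=> mA mG nG; have mI : measurable (\bigcap_n G n) by exact: bigcapT_measurable.
apply/cvgrPdist_lt => e e0.
have [||||m Hm] := @pr_eventually _ _ _ P (~` (A `&` \bigcap_n G n))
  (fun n => ~` (A `&` G n)) e; rewrite //.
- by apply/measurableC/measurableI.
- by move=> n; apply/measurableC/measurableI.
- move=> w nw; apply: contrapT => H; apply: nw; split.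
    apply: contrapT => nA; apply: H; exists 0%N => n _ [].
    by move=> /nA.
  move=> n _; apply: contrapT => nG'; apply: H; exists n => k nk [_ Gk].
  by apply: nG'; exact: nG nk _ Gk.
exists m => // n /= /Hm; rewrite !pr_setC//; [|exact: measurableI..] => H.
have le : pr (A `&` \bigcap_n G n) <= pr (A `&` G n).
  apply: pr_mono; [exact: measurableI|exact: measurableI|].
  by apply: setIS => w; exact.
by rewrite distrC ger0_norm; lra.
Qed.

Lemma cdf_unique (A : set Omega) (U V : Omega -> R) :
  measurable A -> measurable_fun setT U -> measurable_fun setT V ->
  (forall c, pr (A `&` [set w | U w <= c]) = pr A * pr [set w | V w <= c]) ->
  forall C, measurable C -> pr (A `&` U @^-1` C) = pr A * pr (V @^-1` C).
Proof.
move=> mA mU mV H C mC.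
have mW1 := measurable_pre mU; have mW2 := measurable_pre mV.
pose nu1 : {measure set R -> \bar R} :=
  measure_function_pushforward__canonical__measure_function_Measure (mrestr P mA) mU.
pose nu2 : {measure set R -> \bar R} := mscale (NngNum (pr_ge0 P A))
  (measure_function_pushforward__canonical__measure_function_Measure P mV).
have E1 S' : measurable S' -> nu1 S' = (pr (A `&` U @^-1` S'))%:E.
  move=> mS'; rewrite -prE; last by apply: measurableI => //; exact: mW1.
  by rewrite /nu1/= /pushforward/= /mrestr setIC.
have E2 S' : measurable S' -> nu2 S' = (pr A * pr (V @^-1` S'))%:E.
  move=> mS'; rewrite EFinM -(prE P (mW2 _ mS')).
  by rewrite /nu2/= /mscale/=.
apply: EFin_inj; rewrite -E1// -E2//.
apply: (@measure_unique _ R _ (@RGenOInfty.G R) (fun k : nat => `](- k%:R)%R, +oo[%classic)) => //.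
- exact: RGenOInfty.measurableE.
- move=> _ _ [x ->] [y ->]; exists (Num.max x y).
  by apply/seteqP; split => z /=; rewrite !in_itv/= !andbT gt_max;
    [move=> [-> ->]|move=> /andP[]].
- by move=> k; exists (- k%:R).
- apply/seteqP; split => // x _; exists (Num.trunc `|x|).+1 => //=.
  rewrite in_itv/= andbT; have := truncnS_gt `|x|; have := ler_norm (- x).
  by rewrite normrN; lra.
- move=> _ [x ->]; rewrite E1 ?E2//; congr EFin.
  have mx1 : measurable [set w | U w <= x].
    by apply: (@measurable_pre _ _ _ U `]-oo, x]%classic).
  have mx2 : measurable [set w | V w <= x].
    by apply: (@measurable_pre _ _ _ V `]-oo, x]%classic).
  have C1 : U @^-1` `]x, +oo[%classic = ~` [set w | U w <= x].
    by apply/seteqP; split => w /=; rewrite in_itv/= andbT ltNge => /negP.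
  have C2 : V @^-1` `]x, +oo[%classic = ~` [set w | V w <= x].
    by apply/seteqP; split => w /=; rewrite in_itv/= andbT ltNge => /negP.
  rewrite C1 C2 pr_setC//; have := H x; have := pr_setID P mA mx1.
  lra.
- by move=> k; rewrite E1 ?ltry.
Qed.

Definition fwd_seg (Z : R -> Omega -> R) (s t : R) (w : Omega) : R :=
  seg_max (Z ^~ w) s t - Z s w.

(** The height of the endpoint above the minimum of the path, the minimum being written through the
    maximum of [- Z]. For the process [- Z] it is the lag of [Z] behind its maximum. *)
Definition bwd_seg (Z : R -> Omega -> R) (s t : R) (w : Omega) : R :=
  seg_max (fun u => - Z u w) s t + Z t w.

Section fixed_process.
Variables (kappa : R) (Z : R -> Omega -> R).
Hypothesis hZ : drifted_bm kappa Z.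

Lemma cZN w : path_continuous (fun u => - Z u w).
Proof. by apply: (@path_continuousN _ (Z ^~ w)); exact: (bm_continuous hZ). Qed.

Lemma adapted_seg_max s t : 0 <= s -> s <= t ->
  adapted X t (fun w => seg_max (Z ^~ w) s t).
Proof.
move=> s0 st; apply: measurable_seg_max => //; first exact: (bm_continuous hZ).
by move=> u su ut; apply: (bm_adapted hZ) => //; lra.
Qed.

Lemma adapted_seg_maxN s t : 0 <= s -> s <= t ->
  adapted X t (fun w => seg_max (fun u => - Z u w) s t).
Proof.
move=> s0 st.
apply: (@measurable_seg_max _ _ (g_sigma_algebraType (generators X t))
  (fun u w => - Z u w)) => //; first exact: cZN.
by move=> u su ut; apply: measurable_funN; apply: (bm_adapted hZ) => //; lra.
Qed.

Lemma adapted_fwd_seg s t : 0 <= s -> s <= t -> adapted X t (fwd_seg Z s t).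
Proof.
move=> s0 st; apply: measurable_funB; first exact: adapted_seg_max.
exact: (bm_adapted hZ).
Qed.

Lemma adapted_bwd_seg s t : 0 <= s -> s <= t -> adapted X t (bwd_seg Z s t).
Proof.
move=> s0 st; apply: measurable_funD; first exact: adapted_seg_maxN.
by apply: (bm_adapted hZ) => //; lra.
Qed.

Let grid (s t : R) (m k : nat) : s + k%:R * ((t - s) / 2 ^+ m) = dyadic s t m k.
Proof. by []. Qed.

Lemma fwd_segE s t c : 0 <= s -> s <= t -> [set w | fwd_seg Z s t w <= c] =
  \bigcap_m [set w | fwd_max Z ((t - s) / 2 ^+ m) (2 ^ m) s w <= c].
Proof.
move=> s0 st; apply/seteqP; split => w /=.
  rewrite /fwd_seg lerBlDr => /(seg_max_dyadicP _ (bm_continuous hZ w) s0 st) H m _ /=.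
  rewrite fwd_max_le; apply/forallP => k; rewrite grid lerBlDr; apply: H.
  by rewrite -ltnS ltn_ord.
move=> H; rewrite /fwd_seg lerBlDr.
apply/(seg_max_dyadicP _ (bm_continuous hZ w) s0 st) => m k km.
have := H m Logic.I; rewrite /= fwd_max_le => /forallP /(_ (Ordinal (km : (k < (2 ^ m).+1)%N))).
by rewrite grid lerBlDr.
Qed.

Lemma bwd_segE s t c : 0 <= s -> s <= t -> [set w | bwd_seg Z s t w <= c] =
  \bigcap_m [set w | bwd_max Z ((t - s) / 2 ^+ m) (2 ^ m) s w <= c].
Proof.
move=> s0 st; apply/seteqP; split => w /=.
  rewrite /bwd_seg -lerBrDr => /(seg_max_dyadicP _ (cZN w) s0 st) H m _ /=.
  rewrite bwd_max_le; apply/forallP => k; rewrite !grid dyadic_end.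
  have := H m k; rewrite -ltnS ltn_ord => /(_ isT); lra.
move=> H; rewrite /bwd_seg -lerBrDr.
apply/(seg_max_dyadicP _ (cZN w) s0 st) => m k km.
have := H m Logic.I; rewrite /= bwd_max_le => /forallP /(_ (Ordinal (km : (k < (2 ^ m).+1)%N))).
by rewrite !grid dyadic_end; lra.
Qed.

(** Halving the mesh keeps the old grid points, so the events in [fwd_segE] decrease and their
    probabilities converge. *)
Lemma fwd_max_refine s t w c m n : s <= t -> (m <= n)%N ->
  fwd_max Z ((t - s) / 2 ^+ n) (2 ^ n) s w <= c ->
  fwd_max Z ((t - s) / 2 ^+ m) (2 ^ m) s w <= c.
Proof.
move=> st; elim: n => [|n IH]; first by rewrite leqn0 => /eqP->.
rewrite leq_eqVlt => /orP[/eqP->//|]; rewrite ltnS => mn H; apply: IH mn _.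
move: H; rewrite !fwd_max_le => /forallP H; apply/forallP => k.
have k2 : (k.*2 < (2 ^ n.+1).+1)%N.
  by rewrite ltnS expnS mul2n leq_double -ltnS ltn_ord.
by have := H (Ordinal k2); rewrite !grid dyadicS.
Qed.

Lemma bwd_max_refine s t w c m n : s <= t -> (m <= n)%N ->
  bwd_max Z ((t - s) / 2 ^+ n) (2 ^ n) s w <= c ->
  bwd_max Z ((t - s) / 2 ^+ m) (2 ^ m) s w <= c.
Proof.
move=> st; elim: n => [|n IH]; first by rewrite leqn0 => /eqP->.
rewrite leq_eqVlt => /orP[/eqP->//|]; rewrite ltnS => mn H; apply: IH mn _.
move: H; rewrite !bwd_max_le => /forallP H; apply/forallP => k.
have k2 : (k.*2 < (2 ^ n.+1).+1)%N.
  by rewrite ltnS expnS mul2n leq_double -ltnS ltn_ord.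
by have := H (Ordinal k2); rewrite !grid dyadicS !dyadic_end.
Qed.

End fixed_process.

Let mle (f : Omega -> R) c : measurable_fun setT f -> measurable [set w | f w <= c].
Proof. by move=> mf; apply: (measurable_pre (C := `]-oo, c]%classic) mf). Qed.

(** Shared by the forward and the backward functional: grid sublevel events decrease to those of the
    segment, and a distribution function determines a law. The past event [A] is carried along, so
    independence passes to the limit too. *)
Lemma seg_law_of_grid kappa (U : R -> nat -> Omega -> R) (V : Omega -> R) Z0 s t A C :
  drifted_bm kappa Z0 -> 0 <= s -> s < t -> F s A -> measurable C ->
  measurable_fun setT V -> (forall h n, 0 < h -> measurable_fun setT (U h n)) ->
  (forall c, [set w | V w <= c] =
    \bigcap_m [set w | U ((t - s) / 2 ^+ m) (2 ^ m)%N w <= c]) ->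
  (forall w c m n, (m <= n)%N ->
    U ((t - s) / 2 ^+ n) (2 ^ n)%N w <= c -> U ((t - s) / 2 ^+ m) (2 ^ m)%N w <= c) ->
  (forall h n C, 0 < h -> measurable C ->
    pr (A `&` U h n @^-1` C) = pr A * pr (bwd_max Z0 h n 0 @^-1` C)) ->
  pr (A `&` V @^-1` C) = pr A * pr (bwd_seg Z0 0 (t - s) @^-1` C).
Proof.
move=> hZ0 s0 st FA mC mV mU EV refine law.
have mA := filtration_measurable mX FA.
have ts0 : 0 <= t - s by lra.
have mB : measurable_fun setT (bwd_seg Z0 0 (t - s)).
  exact: (adapted_measurable mX (adapted_bwd_seg hZ0 (lexx 0) ts0)).
apply: cdf_unique => // c.
pose h m := (t - s) / 2 ^+ m.
have h0 m : 0 < h m by rewrite divr_gt0 ?exprn_gt0//; lra.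
pose G m := [set w | U (h m) (2 ^ m)%N w <= c].
pose G0 m := [set w | bwd_max Z0 (h m) (2 ^ m)%N 0 w <= c].
have mL m : measurable_fun setT (bwd_max Z0 (h m) (2 ^ m)%N 0).
  by apply: (adapted_measurable mX); apply: (adapted_bwd_max hZ0) => //; exact: ltW.
have cG : pr (A `&` G n) @[n --> \oo] --> pr (A `&` [set w | V w <= c]).
  rewrite EV; apply: pr_decreasing => //; first by move=> n; apply: mle; exact: mU.
  by move=> m n mn w; exact: refine.
have cG0 : pr (setT `&` G0 n) @[n --> \oo] --> pr [set w | bwd_seg Z0 0 (t - s) w <= c].
  rewrite -[X in pr X]setTI (bwd_segE hZ0 c (lexx 0) ts0) subr0.
  apply: pr_decreasing => //; first by move=> n; exact: mle.
  move=> m n mn w; rewrite /G0 /h -(subr0 (t - s)).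
  exact: bwd_max_refine ts0 mn.
have E : (fun n => pr (A `&` G n)) = (fun n => pr A * pr (setT `&` G0 n)).
  apply/funext => n; rewrite setTI.
  exact: (law (h n) (2 ^ n)%N `]-oo, c]%classic (h0 n)).
rewrite E in cG.
have cG1 : pr A * pr (setT `&` G0 n) @[n --> \oo] -->
    pr A * pr [set w | bwd_seg Z0 0 (t - s) w <= c].
  by apply: cvgM => //; exact: cvg_cst.
exact: (cvg_unique _ cG cG1).
Qed.

Lemma fwd_seg_law kappa Z Z0 s t A C :
  drifted_bm kappa Z -> drifted_bm kappa Z0 -> 0 <= s -> s < t -> F s A ->
  measurable C ->
  pr (A `&` fwd_seg Z s t @^-1` C) = pr A * pr (bwd_seg Z0 0 (t - s) @^-1` C).
Proof.
move=> hZ hZ0 s0 st FA mC.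
apply: (@seg_law_of_grid kappa (fun h n => fwd_max Z h n s)) => //.
- exact: (adapted_measurable mX (adapted_fwd_seg hZ s0 (ltW st))).
- by move=> h n h0; apply: (adapted_measurable mX); apply: (adapted_fwd_max hZ) => //; exact: ltW.
- by move=> c; exact: (fwd_segE hZ c s0 (ltW st)).
- by move=> w c m n; apply: fwd_max_refine; exact: ltW.
- by move=> h n D h0 mD; exact: (fwd_max_law mX n hZ hZ0).
Qed.

Lemma bwd_seg_law kappa Z Z0 s t A C :
  drifted_bm kappa Z -> drifted_bm kappa Z0 -> 0 <= s -> s < t -> F s A ->
  measurable C ->
  pr (A `&` bwd_seg Z s t @^-1` C) = pr A * pr (bwd_seg Z0 0 (t - s) @^-1` C).
Proof.
move=> hZ hZ0 s0 st FA mC.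
apply: (@seg_law_of_grid kappa (fun h n => bwd_max Z h n s)) => //.
- exact: (adapted_measurable mX (adapted_bwd_seg hZ s0 (ltW st))).
- by move=> h n h0; apply: (adapted_measurable mX); apply: (adapted_bwd_max hZ) => //; exact: ltW.
- by move=> c; exact: (bwd_segE hZ c s0 (ltW st)).
- by move=> w c m n; apply: bwd_max_refine; exact: ltW.
- by move=> h n D h0 mD; exact: (bwd_max_law mX n hZ hZ0).
Qed.

End max_law.

(** * Brownian motion with drift and integrability of its range *)

Section brownian.
Context {R : realType} {d : measure_display} {Omega : measurableType d}.
Variable P : probability Omega R.
Variable B : R -> {RV P >-> R}.
Hypothesis HB : brownian_motion B.
Local Notation X := (fun t : R => (B t : Omega -> R)).
Local Notation F := (natural_filtration X).
Local Notation pr := (pr P).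
Local Notation drifted_bm := (drifted_bm P X).
Local Notation step_law := (@step_law R).
Local Notation Z kappa := (drifted X kappa).

Lemma measurable_B t : measurable_fun setT (X t).
Proof. exact: measurable_funPT. Qed.
Local Notation mB := measurable_B.

Lemma B_step t h A (C : set R) : 0 <= t -> 0 < h -> F t A -> measurable C ->
  pr (A `&` (fun w => B (t + h) w - B t w) @^-1` C) =
  pr A * fine (normal_prob 0 (Num.sqrt h) C).
Proof.
move=> t0 h0 FA mC; case: HB => _ _ law ind.
have th : t < t + h by lra.
have e : t + h - t = h by lra.
have mA := filtration_measurable mB FA.
have mD : measurable_fun setT (fun w => B (t + h) w - B t w).
  by apply: measurable_funB; exact: mB.
apply: EFin_inj; rewrite -prE; last by apply: measurableI => //; exact: measurable_pre.
have /= -> := ind _ _ t0 th A C FA mC.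
rewrite (law _ _ t0 th C mC) e (prE P mA) EFinM; congr (_ * _)%E.
by rewrite fineK// fin_num_measure.
Qed.

Lemma measurable_shift (k : R) (C : set R) : measurable C ->
  measurable [set y | C (y + k)].
Proof.
move=> mC; rewrite -[X in measurable X]setTI.
by apply: (measurable_funD (f := id) (g := cst k)) => //.
Qed.

Lemma drifted_bm_fwd kappa : drifted_bm kappa (Z kappa).
Proof.
split.
- move=> s t s0 st; apply: measurable_funD; last exact: measurable_cst.
  exact: adapted_coord.
- move=> w; apply: path_continuousD; last exact: path_continuousZ.
  by split; case: HB => _ + _ _; exact.
- move=> t h A C t0 h0 FA mC; rewrite -(B_step t0 h0 FA (measurable_shift (kappa * h) mC)).
  congr (pr (A `&` _)); apply/seteqP; split => w /=; rewrite /drifted;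
  by congr (C _); ring.
Qed.

Lemma step_lawN kappa h (C : set R) : 0 < h -> measurable C ->
  step_law kappa h [set y | C (- y)] = step_law (- kappa) h C.
Proof.
move=> h0 mC; have sh0 : 0 < Num.sqrt h by rewrite sqrtr_gt0.
rewrite /step_law -(normal_probN sh0 (measurable_shift (- kappa * h) mC)).
congr (fine (normal_prob _ _ _)); apply/seteqP; split => y /=;
by congr (C _); ring.
Qed.

Lemma drifted_bmN kappa Z0 : drifted_bm kappa Z0 ->
  drifted_bm (- kappa) (fun t w => - Z0 t w).
Proof.
move=> hZ; split.
- by move=> s t s0 st; apply: measurable_funN; exact: bm_adapted hZ _ _ _ _.
- by move=> w; exact: (cZN hZ).
- move=> t h A C t0 h0 FA mC; rewrite -step_lawN//.
  rewrite -(bm_step hZ t0 h0 FA); last first.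
    by rewrite -[X in measurable X]setTI; exact: oppr_measurable.
  by congr (pr (A `&` _)); apply/seteqP; split => w /=; congr (C _); ring.
Qed.

Local Notation W := (Z 0).
Let hW : drifted_bm 0 W := drifted_bm_fwd 0.

Let m2 (f : Omega -> R) : \bar R := (\int[P]_w (f w ^+ 2)%:E)%E.

Let m2_ge0 f : (0 <= m2 f)%E.
Proof. by apply: integral_ge0 => w _; rewrite lee_fin sqr_ge0. Qed.

Let double_inj (a b : \bar R) : (0 <= a)%E -> (0 <= b)%E -> (a + a = b + b)%E -> a = b.
Proof.
case: a => [r| |]//; case: b => [s| |]// _ _; rewrite -!EFinD => -[rs].
by congr EFin; lra.
Qed.

Let mW s : 0 <= s -> measurable_fun setT (W s).
Proof. by move=> s0; apply: (adapted_measurable mB (bm_adapted hW s0 (lexx s))). Qed.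

(* By symmetry of the increment [V], (U, V) and (U, - V) have the same law; the
   parallelogram identity then gives E (U + V)^2 = E U^2 + E V^2. *)
Lemma second_moment_step (U : Omega -> R) s h : 0 <= s -> 0 < h -> adapted X s U ->
  m2 (fun w => U w + (W (s + h) w - W s w)) =
  (m2 U + m2 (fun w => (W (s + h)%R w - W s w)%R))%E.
Proof.
move=> s0 h0 aU; have mU := adapted_measurable mB aU.
have mV : measurable_fun setT (fun w => W (s + h) w - W s w).
  by apply: measurable_funB; apply: mW; lra.
set V := (fun w => W (s + h) w - W s w) in mV *.
have msq (f : Omega -> R) : measurable_fun setT f ->
    measurable_fun setT (fun w => (f w ^+ 2)%:E).
  by move=> mf; apply/measurable_EFinP; exact: measurable_funX.
have mNV : measurable_fun setT (fun w => - V w) by exact: measurable_funN.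
have E : m2 (fun w => U w + V w) = m2 (fun w => U w + - V w).
  apply: (@pair_law_integral _ _ _ P U V (fun w => - V w)
    (fun q => ((q.1 + q.2) ^+ 2)%:E)) => //.
  - apply/measurable_EFinP/measurable_funX.
    by apply: measurable_funD; [exact: measurable_fst|exact: measurable_snd].
  - by move=> q; rewrite lee_fin sqr_ge0.
  - move=> C C' mC mC'; have FA := adapted_preimage aU mC.
    rewrite (bm_step hW s0 h0 FA mC').
    have mN : measurable [set y | C' (- y)].
      by rewrite -[X in measurable X]setTI; exact: oppr_measurable.
    have := bm_step hW s0 h0 FA mN; rewrite step_lawN// oppr0 => <- //.
apply: double_inj => //; first by apply: adde_ge0.
rewrite {2}E /m2 -ge0_integralD//; last 4 first.
- by move=> w _; rewrite lee_fin sqr_ge0.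
- by apply: msq; exact: measurable_funD.
- by move=> w _; rewrite lee_fin sqr_ge0.
- by apply: msq; exact: measurable_funD.
rewrite -ge0_integralD//; last 4 first.
- by move=> w _; rewrite lee_fin sqr_ge0.
- exact: msq.
- by move=> w _; rewrite lee_fin sqr_ge0.
- exact: msq.
rewrite -ge0_integralD//; last 4 first.
- by move=> w _; rewrite -EFinD lee_fin addr_ge0// sqr_ge0.
- by apply: emeasurable_funD; exact: msq.
- by move=> w _; rewrite -EFinD lee_fin addr_ge0// sqr_ge0.
- by apply: emeasurable_funD; exact: msq.
apply: eq_integral => w _; rewrite -!EFinD; congr EFin.
by rewrite /V; ring.
Qed.

Lemma m2_increment s t : 0 <= s -> s < t -> (m2 (fun w => (W t w - W s w)%R) < +oo)%E.
Proof.
move=> s0 st; have ts0 : 0 < t - s by lra.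
have s20 : 0 < Num.sqrt (t - s) by rewrite sqrtr_gt0.
have mV : measurable_fun setT ((fun w => W t w - W s w) : _ -> measurableTypeR R).
  by apply: measurable_funB; apply: mW; lra.
pose nu : {measure set (measurableTypeR R) -> \bar R} :=
  measure_function_pushforward__canonical__measure_function_Measure P mV.
have -> : m2 (fun w => W t w - W s w) = (\int[nu]_x (x ^+ 2)%:E)%E.
  rewrite /nu/= ge0_integral_pushforward//=.
  - by apply/measurable_EFinP; exact: exprn_measurable.
  - by move=> q _; rewrite lee_fin sqr_ge0.
suff -> : (\int[nu]_x (x ^+ 2)%:E =
    \int[normal_prob 0 (Num.sqrt (t - s))]_x (x ^+ 2)%:E)%E.
  exact: normal_second_moment.
apply: eq_measure_integral => C mC _.
rewrite /nu/= /pushforward prE; last exact: measurable_pre.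
have := B_step s0 ts0 (@filtrationT _ _ _ X s) mC.
rewrite setTI pr_setT mul1r => E.
rewrite -[RHS]fineK ?fin_num_measure// -E; congr ((pr _)%:E).
by apply/seteqP; split => w /=; rewrite /drifted; congr (C _);
  rewrite (_ : s + (t - s) = t); lra.
Qed.

(** A maximal inequality by induction: the positive part does not increase the square, and by
    [second_moment_step] a further increment adds the same second moment to both sides. *)
Lemma bwd_max_second_moment h n : 0 < h ->
  (m2 (bwd_max W h n 0) <= m2 (fun w => (W (n%:R * h) w - W 0 w)%R))%E.
Proof.
move=> h0; elim: n => [|n IH].
  rewrite mul0r /m2; apply: ge0_le_integral => //.
  - by move=> w _; rewrite lee_fin sqr_ge0.
  - by apply/measurable_EFinP; apply: measurable_funX; exact: measurable_cst.
  - by apply/measurable_EFinP; apply: measurable_funX;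
    apply: (@measurable_funB _ _ _ _ (W 0) (W 0)); exact: mW.
  - by move=> w _; rewrite lee_fin expr0n sqr_ge0.
have nh0 : 0 <= n%:R * h by rewrite mulr_ge0// ltW.
have aL := @adapted_bwd_max _ _ _ P X _ _ hW h n 0 (lexx 0) (ltW h0).
rewrite add0r in aL.
have mL := adapted_measurable mB aL.
have E1 : m2 (fun w => W (n.+1%:R * h) w - W 0 w) =
    (m2 (fun w => (W (n%:R * h) w - W 0 w)%R) +
     m2 (fun w => (W (n%:R * h + h) w - W (n%:R * h) w)%R))%E.
  rewrite -second_moment_step//; last first.
    by apply: measurable_funB; apply: (bm_adapted hW).
  apply: eq_integral => w _; congr ((_ ^+ 2)%:E).
  by rewrite -natr1 mulrDl mul1r; ring.
rewrite E1; apply: (@le_trans _ _ (m2 (bwd_max W h n 0) +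
  m2 (fun w => (W (n%:R * h + h) w - W (n%:R * h) w)%R))%E); last first.
  by rewrite leeD2r.
rewrite -second_moment_step// /m2; apply: ge0_le_integral => //.
- by move=> w _; rewrite lee_fin sqr_ge0.
- apply/measurable_EFinP; apply: measurable_funX.
  exact: (adapted_measurable mB
    (@adapted_bwd_max _ _ _ P X _ _ hW h n.+1 0 (lexx 0) (ltW h0))).
- apply/measurable_EFinP; apply: measurable_funX; apply: measurable_funD => //.
  by apply: measurable_funB; apply: mW; lra.
- move=> w _ /=; rewrite lee_fin add0r.
  set x := (bwd_max _ _ _ _ _ + _).
  by case: (leP 0 x) => // _; rewrite expr0n sqr_ge0.
Qed.

(** Monotone convergence along the nested grids: the grid bound, the second moment of [W T - W 0],
    does not depend on the mesh. *)
Lemma bwd_seg_second_moment T : 0 < T -> (m2 (bwd_seg W 0 T) < +oo)%E.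
Proof.
move=> T0; have T0' := ltW T0.
pose h m := T / 2 ^+ m.
have h0 m : 0 < h m by rewrite divr_gt0 ?exprn_gt0.
pose L m := bwd_max W (h m) (2 ^ m) 0.
have LE c : [set w | bwd_seg W 0 T w <= c] = \bigcap_m [set w | L m w <= c].
  by rewrite (bwd_segE hW c (lexx 0) T0') subr0.
have L_le m w : L m w <= bwd_seg W 0 T w.
  have : (\bigcap_m [set w' | L m w' <= bwd_seg W 0 T w]) w.
    by rewrite -LE; exact: lexx.
  by move/(_ m Logic.I).
have L_nd m n w : (m <= n)%N -> L m w <= L n w.
  move=> mn; rewrite /L /h -(subr0 T).
  by apply: bwd_max_refine mn _ => //; rewrite ?subr0.
have L0 m w : 0 <= L m w.
  by rewrite /L; case: (2 ^ m)%N => [//|k /=]; rewrite le_max lexx.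
have L_cvg w : L m w @[m --> \oo] --> bwd_seg W 0 T w.
  apply/cvgrPdist_lt => e e0.
  have [m Hm] : exists m, bwd_seg W 0 T w - e < L m w.
    apply: contrapT => H.
    have : (\bigcap_m [set w' | L m w' <= bwd_seg W 0 T w - e]) w.
      move=> m _ /=; rewrite leNgt; apply/negP => c; apply: H.
      by exists m.
    by rewrite -LE /=; lra.
  exists m => // n /= mn; have := L_nd _ _ w mn; have := L_le n w => ? ?.
  by rewrite ger0_norm; lra.
have mL m : measurable_fun setT (fun w => (L m w ^+ 2)%:E).
  apply/measurable_EFinP; apply: measurable_funX.
  by apply: (adapted_measurable mB); apply: (adapted_bwd_max hW) => //; exact: ltW.
have E : m2 (bwd_seg W 0 T) = (\int[P]_w limn (fun m => (L m w ^+ 2)%:E))%E.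
  apply: eq_integral => w _; apply/esym/cvg_lim => //.
  apply: cvg_EFin; first by near=> m.
  have -> : fine \o (fun m => (L m w ^+ 2)%:E) = (fun m => L m w ^+ 2) by [].
  under eq_fun do rewrite expr2.
  by rewrite expr2; apply: cvgM; exact: L_cvg.
rewrite E monotone_convergence//; last 2 first.
- by move=> m w _; rewrite lee_fin sqr_ge0.
- by move=> w _ m n mn; rewrite lee_fin ler_pXn2r ?nnegrE//; exact: L_nd.
have := m2_increment (lexx 0) T0; apply: le_lt_trans.
apply: lime_le.
  apply: ereal_nondecreasing_is_cvgn => m n mn; apply: ge0_le_integral => //.
  - by move=> w _; rewrite lee_fin sqr_ge0.
  - by move=> w _; rewrite lee_fin ler_pXn2r ?nnegrE//; exact: L_nd.
near=> m; have := bwd_max_second_moment (2 ^ m) (h0 m).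
by rewrite /h natrX mulrCA divff ?mulr1// expf_neq0.
Unshelve. all: by end_near. Qed.

(** Maximum minus minimum of the driftless path on [0, T]. *)
Definition osc (T : R) (w : Omega) : R :=
  seg_max (W ^~ w) 0 T + seg_max (fun u => - W u w) 0 T.

Lemma integrable_bwd_seg Z0 T : drifted_bm 0 Z0 -> 0 < T ->
  P.-integrable setT (EFin \o bwd_seg Z0 0 T).
Proof.
move=> hZ T0; have T0' := ltW T0.
have mb Z1 : drifted_bm 0 Z1 -> measurable_fun setT (bwd_seg Z1 0 T).
  by move=> h; exact: (adapted_measurable mB (adapted_bwd_seg h (lexx 0) T0')).
have E : m2 (bwd_seg Z0 0 T) = m2 (bwd_seg W 0 T).
  apply: (@pair_law_integral _ _ _ P (cst 0) (bwd_seg Z0 0 T) (bwd_seg W 0 T)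
    (fun q => (q.2 ^+ 2)%:E)) => //.
  - exact: mb.
  - exact: mb.
  - by apply/measurable_EFinP/measurable_funX; exact: measurable_snd.
  - by move=> q; rewrite lee_fin sqr_ge0.
  - move=> C C' mC mC'; rewrite preimage_cst; case: ifP => _; last by rewrite !set0I.
    have FT := @filtrationT _ _ _ X 0.
    have := bwd_seg_law mB hZ hW (lexx 0) T0 FT mC'.
    by rewrite subr0 pr_setT mul1r !setTI => ->.
have fin := bwd_seg_second_moment T0; rewrite -E in fin.
have msq : measurable_fun setT (fun w => (bwd_seg Z0 0 T w ^+ 2)%:E).
  by apply/measurable_EFinP/measurable_funX; exact: mb.
have I2 : P.-integrable setT (fun w => (1 + bwd_seg Z0 0 T w ^+ 2)%:E).
  apply: (@integrableD _ _ _ _ setT measurableT (cst 1%:E)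
    (fun w => (bwd_seg Z0 0 T w ^+ 2)%:E)).
    exact: finite_measure_integrable_cst.
  apply/integrableP; split => //.
  by under eq_integral do rewrite abse_EFin ger0_norm ?sqr_ge0//.
apply: le_integrable I2 => //; first by apply/measurable_EFinP; exact: mb.
move=> w _; rewrite /= lee_fin [leRHS]ger0_norm ?addr_ge0 ?sqr_ge0//.
by rewrite ler_norml; apply/andP; split; nra.
Qed.

Lemma integrable_osc T : 0 < T -> P.-integrable setT (EFin \o osc T).
Proof.
move=> T0; have hWN : drifted_bm 0 (fun t w => - W t w).
  by have := drifted_bmN hW; rewrite oppr0.
have := integrableD measurableT (integrable_bwd_seg hW T0) (integrable_bwd_seg hWN T0).
apply: eq_integrable => // w _ /=; rewrite -EFinD; congr EFin.
rewrite /bwd_seg /osc.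
have -> : (fun u => - - W u w) = W ^~ w by apply/funext => u; rewrite opprK.
ring.
Qed.

Lemma osc_ub T w u v : 0 <= u -> u <= T -> 0 <= v -> v <= T ->
  W u w - W v w <= osc T w.
Proof.
move=> u0 uT v0 vT.
have := seg_max_ub (bm_continuous hW w) (lexx 0) u0 uT.
have := seg_max_ub (cZN hW w) (lexx 0) v0 vT.
by rewrite /osc; lra.
Qed.

End brownian.

(** * Small-time estimates, strict positivity and tubes *)

Section brownian_events.
Context {R : realType} {d : measure_display} {Omega : measurableType d}.
Variable P : probability Omega R.
Variable B : R -> {RV P >-> R}.
Hypothesis HB : brownian_motion B.
Local Notation X := (fun t : R => (B t : Omega -> R)).
Local Notation F := (natural_filtration X).
Local Notation pr := (pr P).
Local Notation drifted_bm := (drifted_bm P X).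
Local Notation Z kappa := (drifted X kappa).
Local Notation mB := (measurable_B B).
Let hZ kappa : drifted_bm kappa (Z kappa) := drifted_bm_fwd HB kappa.

Let mle (f : Omega -> R) c : measurable_fun setT f -> measurable [set w | f w <= c].
Proof. by move=> mf; apply: (measurable_pre (C := `]-oo, c]%classic) mf). Qed.

Let mge (f : Omega -> R) c : measurable_fun setT f -> measurable [set w | c <= f w].
Proof.
move=> mf; have -> : [set w | c <= f w] = f @^-1` `[c, +oo[%classic.
  by apply/seteqP; split => w /=; rewrite in_itv/= andbT.
exact: measurable_pre.
Qed.

Definition bwd_cdf (kappa h c : R) : R := pr [set w | bwd_seg (Z kappa) 0 h w <= c].

Lemma mbwd kappa Z0 h : drifted_bm kappa Z0 -> 0 <= h ->
  measurable_fun setT (bwd_seg Z0 0 h).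
Proof. by move=> hZ0 h0; exact: (adapted_measurable mB (adapted_bwd_seg hZ0 (lexx 0) h0)). Qed.

Lemma mfwd kappa Z0 s t : drifted_bm kappa Z0 -> 0 <= s -> s <= t ->
  measurable_fun setT (fwd_seg Z0 s t).
Proof. by move=> hZ0 s0 st; exact: (adapted_measurable mB (adapted_fwd_seg hZ0 s0 st)). Qed.

Lemma pr_fwd_le kappa Z0 t h c A : drifted_bm kappa Z0 -> 0 <= t -> 0 < h -> F t A ->
  pr (A `&` [set w | fwd_seg Z0 t (t + h) w <= c]) = pr A * bwd_cdf kappa h c.
Proof.
move=> hZ0 t0 h0 FA; have th : t < t + h by lra.
have mC : measurable (`]-oo, c]%classic : set R) by exact: measurable_itv.
have := fwd_seg_law mB hZ0 (hZ kappa) t0 th FA mC.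
by have -> : t + h - t = h by lra.
Qed.

Lemma pr_fwd_le0 kappa Z0 t h c : drifted_bm kappa Z0 -> 0 <= t -> 0 < h ->
  pr [set w | fwd_seg Z0 t (t + h) w <= c] = bwd_cdf kappa h c.
Proof.
move=> hZ0 t0 h0; have := pr_fwd_le c hZ0 t0 h0 (@filtrationT _ _ _ X t).
by rewrite setTI pr_setT mul1r.
Qed.

Lemma fwd_seg_mono Z0 kappa s t t' w : drifted_bm kappa Z0 -> 0 <= s -> s <= t ->
  t <= t' -> fwd_seg Z0 s t w <= fwd_seg Z0 s t' w.
Proof.
move=> hZ0 s0 st tt; rewrite /fwd_seg lerD2r.
exact: (seg_max_le_sub (bm_continuous hZ0 w) s0 (lexx s) st tt).
Qed.

(** The backward functional is not monotone in the horizon along a path, but it has the law of the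
    forward one, which is. *)
Lemma bwd_cdf_mono kappa h h' c : 0 < h -> h <= h' -> bwd_cdf kappa h' c <= bwd_cdf kappa h c.
Proof.
move=> h0 hh; have h0' : 0 < h' by lra.
rewrite -(pr_fwd_le0 c (hZ kappa) (lexx 0) h0) -(pr_fwd_le0 c (hZ kappa) (lexx 0) h0').
apply: pr_mono.
- by apply: mle; apply: (mfwd (hZ kappa)); lra.
- by apply: mle; apply: (mfwd (hZ kappa)); lra.
- move=> w /=; apply: le_trans; apply: (fwd_seg_mono _ (hZ kappa)); lra.
Qed.

Lemma bwd_cdf_small (c e : R) : 0 < c -> 0 < e ->
  exists2 h0, 0 < h0 & forall h, 0 < h -> h <= h0 -> 1 - e < bwd_cdf 0 h c.
Proof.
move=> c0 e0; have i0 n : 0 < n.+1%:R^-1 :> R by rewrite invr_gt0.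
have [||m Hm] := @pr_eventually _ _ _ P setT
    (fun n => [set w | fwd_seg (Z 0) 0 (0 + n.+1%:R^-1) w <= c]) e measurableT _ _ e0.
- by move=> n; apply: mle; apply: (mfwd (hZ 0)) => //; rewrite add0r ltW.
- move=> w _; have [dl dl0 Hd] := seg_max_near (bm_continuous (hZ 0) w) (lexx 0) c0.
  exists (Num.trunc dl^-1).+1 => n mn /=.
  rewrite /fwd_seg add0r; have [||H _] := Hd n.+1%:R^-1.
  + exact: ltW.
  + rewrite add0r -[ltRHS]invrK ltf_pV2 ?posrE ?invr_gt0//.
    apply: lt_le_trans (truncnS_gt _) _.
    by rewrite ler_nat; apply: leq_trans mn _.
  + lra.
exists m.+1%:R^-1 => // h h0 hm; have := Hm m (leqnn m).
rewrite pr_setT (pr_fwd_le0 c (hZ 0))// => H; apply: lt_le_trans H _.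
exact: bwd_cdf_mono.
Qed.

Lemma pr_fwd_gt_small (c e : R) : 0 < c -> 0 < e ->
  exists2 h0, 0 < h0 & forall Z0 t h A, drifted_bm 0 Z0 -> 0 <= t -> 0 < h -> h <= h0 ->
    F t A -> pr (A `&` ~` [set w | fwd_seg Z0 t (t + h) w <= c]) <= e * pr A.
Proof.
move=> c0 e0; have [h0 h00 H] := bwd_cdf_small c0 e0; exists h0 => //.
move=> Z0 t h A hZ0 t0 h1 hh FA; have mA := filtration_measurable mB FA.
have mE : measurable [set w | fwd_seg Z0 t (t + h) w <= c].
  by apply: mle; apply: (mfwd hZ0); lra.
have := pr_setID P mA mE; rewrite (pr_fwd_le c hZ0 t0 h1 FA).
have := H h h1 hh; have := pr_ge0 P A; nra.
Qed.

(** The increment is nonnegative with probability at least 1/2 and lies in [0, r[ with probability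
    at most [r / Num.sqrt h]. *)
Lemma B_incr_ge (r : R) t h A : 0 <= r -> 0 <= t -> 0 < h -> F t A ->
  pr A * (2^-1 - r / Num.sqrt h) <= pr (A `&` [set w | r <= B (t + h) w - B t w]).
Proof.
move=> r0 t0 h0 FA; have s0 : 0 < Num.sqrt h by rewrite sqrtr_gt0.
have m1 : measurable (`[r, +oo[%classic : set R) by exact: measurable_itv.
have -> : [set w | r <= B (t + h) w - B t w] =
    (fun w => B (t + h) w - B t w) @^-1` `[r, +oo[%classic.
  by apply/seteqP; split => w /=; rewrite in_itv/= andbT.
rewrite (B_step HB t0 h0 FA m1) ler_wpM2l ?pr_ge0//.
set nu := normal_prob 0 (Num.sqrt h).
have f1 : nu `[r, +oo[%classic \is a fin_num by exact: fin_num_measure.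
have f2 : nu `[0, r[%classic \is a fin_num by exact: fin_num_measure.
have H1 := normal_prob_half s0; have H2 := normal_prob_near0 s0 r0.
have H3 : (nu `[0%R, +oo[%classic <= nu `[0%R, r[%classic + nu `[r, +oo[%classic)%E.
  apply: (@le_trans _ _ (nu (`[0%R, r[%classic `|` `[r, +oo[%classic))).
    apply: le_measure; rewrite ?inE; [exact: measurable_itv|exact: measurableU|].
    move=> x /=; rewrite !in_itv/= !andbT => x0.
    by have [rx|xr] := leP r x; [right|left; rewrite x0].
  by apply: measureU2.
have := le_trans H1 H3; move: H2; rewrite -/nu -(fineK f1) -(fineK f2) -EFinD !lee_fin/=.
lra.
Qed.

Lemma B_incr_le (r : R) t h A : 0 <= r -> 0 <= t -> 0 < h -> F t A ->
  pr A * (2^-1 - r / Num.sqrt h) <= pr (A `&` [set w | B (t + h) w - B t w <= - r]).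
Proof.
move=> r0 t0 h0 FA; have s0 : 0 < Num.sqrt h by rewrite sqrtr_gt0.
apply: le_trans (B_incr_ge r0 t0 h0 FA) _.
have m1 : measurable (`[r, +oo[%classic : set R) by exact: measurable_itv.
have m2 : measurable (`]-oo, - r]%classic : set R) by exact: measurable_itv.
have -> : [set w | r <= B (t + h) w - B t w] =
    (fun w => B (t + h) w - B t w) @^-1` `[r, +oo[%classic.
  by apply/seteqP; split => w /=; rewrite in_itv/= andbT.
have -> : [set w | B (t + h) w - B t w <= - r] =
    (fun w => B (t + h) w - B t w) @^-1` `]-oo, - r]%classic.
  by apply/seteqP; split => w /=; rewrite in_itv/=.
rewrite (B_step HB t0 h0 FA m1) (B_step HB t0 h0 FA m2).
rewrite -(normal_probN s0 m2).
have -> : -%R @^-1` `]-oo, - r]%classic = (`[r, +oo[%classic : set R).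
  by apply/seteqP; split => x /=; rewrite !in_itv/= andbT lerN2.
by [].
Qed.

(** A path that never exceeds its start up to [h] is not above it at a short time [ee], which has
    probability at most 3/4. Unless it has dropped by more than [c] by then, its later maximum is at
    most [c] above its value at [ee], an event independent of the past. Finally [c] tends to 0. *)
Lemma bwd_cdf0_half kappa h : 0 < h -> bwd_cdf kappa h 0 <= 3 / 4 * bwd_cdf kappa (h / 2) 0.
Proof.
move=> h0; have h20 : 0 < h / 2 by lra.
(* The version with slack gives the claim because a distribution function is right-continuous at
   0. *)
suff step c e : 0 < c -> 0 < e ->
    bwd_cdf kappa h 0 <= 3 / 4 * bwd_cdf kappa (h / 2) c + e.
  pose G n := [set w | bwd_seg (Z kappa) 0 (h / 2) w <= n.+1%:R^-1].
  have i0 n : 0 < n.+1%:R^-1 :> R by rewrite invr_gt0.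
  have mG n : measurable (G n) by apply: mle; apply: (mbwd (hZ kappa)); lra.
  have nG m n : (m <= n)%N -> G n `<=` G m.
    move=> mn w /= H; apply: le_trans H _.
    by rewrite lef_pV2 ?posrE// ler_nat.
  have := pr_decreasing (P := P) measurableT mG nG; rewrite setTI.
  have -> : \bigcap_n G n = [set w | bwd_seg (Z kappa) 0 (h / 2) w <= 0].
    apply/seteqP; split => [w H|w /= H n _]; last exact: le_trans H (ltW (i0 n)).
    apply/ler_addgt0Pr => e e0; rewrite add0r.
    apply: le_trans (H (Num.trunc e^-1) Logic.I) _.
    rewrite -[leRHS]invrK lef_pV2 ?posrE ?invr_gt0// ltW//; exact: truncnS_gt.
  move=> cv; apply/ler_addgt0Pr => e e0.
  have e20 : 0 < e / 2 by lra.
  move/cvgrPdist_lt : cv => /(_ _ e20)[m _ /(_ m (leqnn m))] /=.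
  have := step _ _ (i0 m) e20; rewrite /bwd_cdf setTI -/(G m).
  rewrite ltr_norml; lra.
move=> c0 e0.
pose k := `|kappa| + 1.
have k0 : 0 < k by rewrite ltr_wpDl.
(* The bound [h / 2] leaves a horizon of at least [h / 2]. The other bound keeps the drift over this
   time below a quarter of the standard deviation, so that a rise has probability at least 1/4. *)
pose eps n := Num.min (h / 2) ((4 * k)^-1 ^+ 2) / n.+1%:R.
have M0 : 0 < Num.min (h / 2) ((4 * k)^-1 ^+ 2).
  by rewrite lt_min h20 exprn_gt0// invr_gt0 mulr_gt0.
have eps0 n : 0 < eps n by rewrite divr_gt0.
have epsM n : eps n <= Num.min (h / 2) ((4 * k)^-1 ^+ 2).
  by rewrite ler_pdivrMr// ler_peMr ?ler1n// ltW.
have cZ := bm_continuous (hZ kappa).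
pose D n w := Z kappa (0 + eps n) w - Z kappa 0 w.
have mD n : measurable_fun setT (D n).
  apply: measurable_funB.
    apply: (adapted_measurable mB (bm_adapted (hZ kappa) _ (lexx _))).
    by rewrite add0r ltW.
  exact: (adapted_measurable mB (bm_adapted (hZ kappa) (lexx 0) (lexx _))).
have [||m Hm] := @pr_eventually _ _ _ P setT
    (fun n => [set w | - c <= D n w]) e measurableT _ _ e0.
- by move=> n; exact: mge.
- move=> w _; have [dl dl0 Hd] := path_continuous_eps (cZ w) (lexx 0) c0.
  exists (Num.trunc (Num.min (h / 2) ((4 * k)^-1 ^+ 2) / dl)).+1 => n mn /=.
  have H : eps n < dl.
    rewrite ltr_pdivrMr// [ltRHS]mulrC -ltr_pdivrMr//.
    apply: lt_le_trans (truncnS_gt _) _.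
    by rewrite ler_nat; apply: leq_trans mn _.
  have := Hd (eps n) (ltW (eps0 n)); rewrite subr0 gtr0_norm// => /(_ H).
  by rewrite ltr_norml /D add0r; lra.
have em := epsM m; rewrite le_min in em; case/andP : em => em1 em2.
set ee := eps m in em1 em2.
have ee0 : 0 < ee := eps0 m.
have A1 : pr [set w | D m w <= 0] <= 3 / 4.
  have fT := @filtrationT _ _ _ X 0.
  have r0 : 0 <= k * ee by rewrite mulr_ge0// ltW.
  have := B_incr_ge r0 (lexx 0) ee0 fT; rewrite setTI pr_setT mul1r.
  have -> : k * ee / Num.sqrt ee = k * Num.sqrt ee.
    rewrite -{1}(sqr_sqrtr (ltW ee0)) expr2 mulrA mulfK// gt_eqF// sqrtr_gt0//.
  have sq : k * Num.sqrt ee <= 1 / 4.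
    rewrite -ler_pdivlMl// (le_trans (ler_wsqrtr em2))// sqrtr_sqr ger0_norm.
      by rewrite invfM mulrC div1r.
    by rewrite invr_ge0 mulr_ge0// ltW.
  have mU : measurable [set w | k * ee <= B (0 + ee) w - B 0 w].
    by apply: mge; apply: measurable_funB; exact: mB.
  have mV : measurable [set w | D m w <= 0] by exact: mle.
  have : pr [set w | D m w <= 0] <= pr (~` [set w | k * ee <= B (0 + ee) w - B 0 w]).
    apply: pr_mono => //; first exact: measurableC.
    move=> w /=; rewrite /D /drifted -/ee => D0 H.
    have : - kappa <= `|kappa| by rewrite -normrN ler_norm.
    move: H; rewrite /k; nra.
  rewrite pr_setC//; lra.
have FD : F (0 + ee) [set w | D m w <= 0].
  have aD : adapted X (0 + ee) (D m).
    by apply: measurable_funB; apply: (bm_adapted (hZ kappa)); rewrite ?add0r -/ee; lra.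
  have mC : measurable (`]-oo, 0]%classic : set R) by exact: measurable_itv.
  exact: (adapted_preimage aD mC).
have he0 : 0 < h - ee by lra.
have A2 : pr ([set w | D m w <= 0] `&` [set w | fwd_seg (Z kappa) ee h w <= c]) <=
    3 / 4 * bwd_cdf kappa (h / 2) c.
  rewrite add0r in FD.
  have := pr_fwd_le c (hZ kappa) (ltW ee0) he0 FD.
  have -> : ee + (h - ee) = h by lra.
  move=> ->; apply: ler_pM => //; [exact: pr_ge0|exact: pr_ge0|].
  apply: bwd_cdf_mono => //; lra.
rewrite -(pr_fwd_le0 0 (hZ kappa) (lexx 0) h0).
have mE : measurable [set w | fwd_seg (Z kappa) ee h w <= c].
  by apply: mle; apply: (mfwd (hZ kappa)); lra.
have mG : measurable [set w | - c <= D m w] by exact: mge.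
apply: le_trans (_ : pr (([set w | D m w <= 0] `&` [set w | fwd_seg (Z kappa) ee h w <= c])
  `|` ~` [set w | - c <= D m w]) <= _).
  apply: pr_mono.
  - by apply: mle; apply: (mfwd (hZ kappa)); lra.
  - apply: measurableU; last exact: measurableC.
    by apply: measurableI => //; exact: mle.
  - move=> w; rewrite /= add0r /fwd_seg => H.
    have [Dc|Dc] := leP (- c) (D m w); last by right.
    left; split.
      rewrite /D add0r -/ee.
      have ? : Z kappa ee w <= seg_max (Z kappa ^~ w) 0 h.
        by apply: (seg_max_ub (cZ w)) => //; lra.
      by move: H; lra.
    have : seg_max (Z kappa ^~ w) ee h <= seg_max (Z kappa ^~ w) 0 h.
      by apply: (seg_max_le_sub (cZ w)) => //; lra.
    by move: Dc H; rewrite /D add0r -/ee; lra.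
apply: le_trans (pr_setU_le _ _ _) _.
- by apply: measurableI => //; exact: mle.
- exact: measurableC.
have := Hm m (leqnn m); rewrite pr_setT pr_setC//; lra.
Qed.

(** Iterating the halving bound gives at most [(3 / 4) ^+ n] for every [n]. *)
Lemma bwd_cdf0 kappa h : 0 < h -> bwd_cdf kappa h 0 = 0.
Proof.
move=> h0; have H n h' : 0 < h' -> bwd_cdf kappa h' 0 <= (3 / 4) ^+ n.
  elim: n h' => [|n IH] h' h'0.
    by apply: pr_le1; apply: mle; apply: (mbwd (hZ kappa)); exact: ltW.
  have h2 : 0 < h' / 2 by lra.
  by apply: le_trans (bwd_cdf0_half kappa h'0) _; rewrite exprS ler_wpM2l//; exact: IH.
apply/eqP; rewrite eq_le pr_ge0 andbT; apply/ler_addgt0Pr => e e0; rewrite add0r.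
have z1 : `|3 / 4| < 1 :> R by rewrite ger0_norm; lra.
have := cvg_geometric 1 z1; move/cvgrPdist_lt => /(_ _ e0)[m _ /(_ m (leqnn m))].
rewrite /= sub0r mul1r normrN => He.
apply: le_trans (H m _ h0) _; exact: le_trans (ler_norm _) (ltW He).
Qed.

Lemma pr_bwd_zero kappa Z0 h : drifted_bm kappa Z0 -> 0 < h ->
  pr [set w | bwd_seg Z0 0 h w <= 0] = 0.
Proof.
move=> hZ0 h0; have mC : measurable (`]-oo, 0]%classic : set R) by exact: measurable_itv.
have := bwd_seg_law mB hZ0 (hZ kappa) (lexx 0) h0 (@filtrationT _ _ _ X 0) mC.
rewrite subr0 pr_setT mul1r setTI => E.
exact: etrans E (bwd_cdf0 kappa h0).
Qed.

(** An increment of [B] in the wanted direction that outweighs the drift has conditional probability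
    at least 1/2 - 1/8. Excursions of [B] by more than [e / 2] above or below its start cost at most
    1/8 each, which leaves 1/8. *)
Lemma one_step kappa (e : R) : 0 < e ->
  exists2 h0, 0 < h0 & forall (up : bool) t h A, 0 <= t -> 0 < h -> h <= h0 -> F t A ->
    exists E, [/\ F (t + h) E, E `<=` A, 8^-1 * pr A <= pr E &
      forall w, E w ->
        (if up then Z kappa t w <= Z kappa (t + h) w
         else Z kappa (t + h) w <= Z kappa t w) /\
        forall u, t <= u -> u <= t + h -> `|Z kappa u w - Z kappa t w| <= e].
Proof.
move=> e0; have e20 : 0 < e / 2 by lra.
have e80 : 0 < 8^-1 :> R by lra.
have [h1 h10 H1] := pr_fwd_gt_small e20 e80.
pose k := `|kappa| + 1.
have k0 : 0 < k by rewrite ltr_wpDl.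
(* In this order: excursions are rare, the drift moves the path by at most [e / 2] in one step, and
   it is at most 1/8 of the standard deviation. *)
exists (Num.min h1 (Num.min (e / 2 / k) ((8 * k)^-1 ^+ 2))).
  by rewrite !lt_min h10 divr_gt0//= exprn_gt0// invr_gt0 mulr_gt0.
move=> up t h A t0 h0; rewrite !le_min => /and3P[hh1 hh2 hh3] FA.
have mA := filtration_measurable mB FA.
have hW := hZ 0.
have hWN : drifted_bm 0 (fun u w => - Z 0 u w).
  by have := drifted_bmN hW; rewrite oppr0.
have th : t <= t + h by lra.
pose r := `|kappa| * h.
have r0 : 0 <= r by rewrite mulr_ge0// ltW.
pose S := if up then [set w | r <= B (t + h) w - B t w]
          else [set w | B (t + h) w - B t w <= - r].
have aI : adapted X (t + h) (fun w => B (t + h) w - B t w).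
  by apply: measurable_funB; apply: adapted_coord; lra.
have FS : F (t + h) S.
  rewrite /S; case: (up).
    have mC : measurable (`[r, +oo[%classic : set R) by exact: measurable_itv.
    have := adapted_preimage aI mC; congr (F _ _); apply/seteqP.
    by split => w /=; rewrite in_itv/= andbT.
  have mC : measurable (`]-oo, - r]%classic : set R) by exact: measurable_itv.
  exact: (adapted_preimage aI mC).
have prS : 3 / 8 * pr A <= pr (A `&` S).
  have q : r / Num.sqrt h <= 8^-1.
    rewrite ler_pdivrMr ?sqrtr_gt0// /r -{1}(sqr_sqrtr (ltW h0)) expr2 mulrA.
    rewrite ler_wpM2r ?sqrtr_ge0//.
    apply: (@le_trans _ _ (k * Num.sqrt h)); first by rewrite ler_wpM2r ?sqrtr_ge0// /k lerDl.
    rewrite -ler_pdivlMl// (le_trans (ler_wsqrtr hh3))// sqrtr_sqr ger0_norm.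
      by rewrite invfM mulrC.
    by rewrite invr_ge0 mulr_ge0// ltW.
  have pA := pr_ge0 P A.
  rewrite /S; case: (up).
    by have := B_incr_ge r0 t0 h0 FA; nra.
  by have := B_incr_le r0 t0 h0 FA; nra.
pose C1 := [set w | fwd_seg (Z 0) t (t + h) w <= e / 2].
pose C2 := [set w | fwd_seg (fun u w => - Z 0 u w) t (t + h) w <= e / 2].
have mI : measurable (`]-oo, e / 2]%classic : set R) by exact: measurable_itv.
have F1 : F (t + h) C1 := adapted_preimage (adapted_fwd_seg hW t0 th) mI.
have F2 : F (t + h) C2 := adapted_preimage (adapted_fwd_seg hWN t0 th) mI.
have FAh : F (t + h) A by apply: filtration_mono FA.
exists (A `&` S `&` C1 `&` C2); split.
- by apply: filtrationI => //; apply: filtrationI => //; exact: filtrationI.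
- by move=> w [[[]]].
- have m1 := filtration_measurable mB F1; have m2 := filtration_measurable mB F2.
  have mS := filtration_measurable mB FS.
  have mAS : measurable (A `&` S) by exact: measurableI.
  have mAS1 : measurable (A `&` S `&` C1) by exact: measurableI.
  have E1 := pr_setID P mAS m1; have E2 := pr_setID P mAS1 m2.
  have B1 := H1 _ _ _ _ hW t0 h0 hh1 FA; have B2 := H1 _ _ _ _ hWN t0 h0 hh1 FA.
  have L1 : pr (A `&` S `&` ~` C1) <= pr (A `&` ~` C1).
    apply: pr_mono; [by apply: measurableI => //; exact: measurableC|
      by apply: measurableI => //; exact: measurableC|by move=> w [[]]].
  have L2 : pr (A `&` S `&` C1 `&` ~` C2) <= pr (A `&` ~` C2).
    apply: pr_mono; [by apply: measurableI => //; exact: measurableC|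
      by apply: measurableI => //; exact: measurableC|by move=> w [[[]]]].
  rewrite -/C1 in B1; rewrite -/C2 in B2.
  lra.
- move=> w [[[_ Sw] C1w] C2w]; split.
    move: Sw; rewrite /S /drifted /r; have := ler_norm kappa; have := ler_norm (- kappa).
    rewrite normrN; case: (up) => /= *; nra.
  move=> u tu uth.
  have u1 := seg_max_ub (bm_continuous hW w) t0 tu uth.
  have u2 := seg_max_ub (cZN hW w) t0 tu uth.
  move: C1w C2w; rewrite /C1 /C2 /fwd_seg /=.
  move: u1 u2; rewrite /drifted => u1 u2 c1 c2.
  have kh : `|kappa| * h <= e / 2.
    apply: (@le_trans _ _ (k * h)); first by rewrite ler_wpM2r ?ltW// /k; lra.
    by rewrite mulrC -ler_pdivlMr.
  have [ut0 ut1] : 0 <= u - t /\ u - t <= h by lra.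
  have ku : `|kappa * (u - t)| <= e / 2.
    by rewrite normrM (ger0_norm ut0); apply: le_trans kh; rewrite ler_wpM2l.
  have -> : X u w + kappa * u - (X t w + kappa * t) =
    (X u w - X t w) + kappa * (u - t) by ring.
  move: ku; rewrite !ler_norml; lra.
Qed.

(** [S] is the deviation from the axis at time [t]. A step of size at most [e / 2] towards the axis
    keeps the deviation within [e / 2] at grid times, hence within [e] in between. The parts of [A]
    below and above the axis are steered separately and reunited, so each step costs one factor
    1/8. *)
Lemma tube_steps kappa (e h : R) : 0 < e -> 0 < h ->
  (forall (up : bool) t A, 0 <= t -> F t A ->
    exists E, [/\ F (t + h) E, E `<=` A, 8^-1 * pr A <= pr E &
      forall w, E w ->
        (if up then Z kappa t w <= Z kappa (t + h) w
         else Z kappa (t + h) w <= Z kappa t w) /\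
        forall u, t <= u -> u <= t + h -> `|Z kappa u w - Z kappa t w| <= e / 2]) ->
  forall k t A S, 0 <= t -> F t A -> adapted X t S ->
    (forall w, A w -> `|S w| <= e / 2) ->
    exists E, [/\ measurable E, E `<=` A, 8^-1 ^+ k * pr A <= pr E &
      forall w, E w -> forall u, t <= u -> u <= t + k%:R * h ->
        `|S w + (Z kappa u w - Z kappa t w)| <= e].
Proof.
move=> e0 h0 step; elim => [|k IH] t A S t0 FA aS SA.
  exists A; rewrite expr0 mul1r; split => //; first exact: filtration_measurable mB _ _ FA.
  move=> w Aw u tu; rewrite mul0r addr0 => ut.
  have -> : u = t by lra.
  by rewrite subrr addr0 (le_trans (SA w Aw)); lra.
have mC : measurable (`]-oo, 0]%classic : set R) by exact: measurable_itv.
have FS : F t [set w | S w <= 0] := adapted_preimage aS mC.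
have FA1 := filtrationI FA FS.
have FA2 := filtrationI FA (filtrationC FS).
have [E1 [FE1 EA1 pE1 H1]] := step true _ _ t0 FA1.
have [E2 [FE2 EA2 pE2 H2]] := step false _ _ t0 FA2.
have th0 : 0 <= t + h by lra.
have aS' : adapted X (t + h) (fun w => S w + (Z kappa (t + h) w - Z kappa t w)).
  apply: measurable_funD; first by apply: adapted_mono aS; lra.
  by apply: measurable_funB; apply: (bm_adapted (hZ kappa)); lra.
have th : t <= t + h by lra.
have S1 w : E1 w -> `|S w + (Z kappa (t + h) w - Z kappa t w)| <= e / 2.
  move=> Ew; have [/= up /(_ _ th (lexx _))] := H1 w Ew.
  have [Aw Sw] := EA1 _ Ew; have := SA w Aw.
  by move: Sw; rewrite /= !ler_norml; lra.
have S2 w : E2 w -> `|S w + (Z kappa (t + h) w - Z kappa t w)| <= e / 2.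
  move=> Ew; have [/= up /(_ _ th (lexx _))] := H2 w Ew.
  have [Aw /negP] := EA2 _ Ew; rewrite -ltNge => Sw; have := SA w Aw.
  by rewrite !ler_norml; lra.
have [G1 [mG1 GE1 pG1 K1]] := IH _ _ _ th0 FE1 aS' S1.
have [G2 [mG2 GE2 pG2 K2]] := IH _ _ _ th0 FE2 aS' S2.
exists (G1 `|` G2); split.
- exact: measurableU.
- by move=> w [/GE1/EA1[]|/GE2/EA2[]].
- rewrite pr_setU//; last first.
    by apply/seteqP; split => // w [/GE1/EA1[_ ?] /GE2/EA2[_]]; apply.
  have mA := filtration_measurable mB FA; have mS := filtration_measurable mB FS.
  rewrite (pr_setID P mA mS) exprSr.
  have p0 : 0 <= 8^-1 ^+ k :> R by rewrite exprn_ge0.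
  have := ler_wpM2l p0 pE1; have := ler_wpM2l p0 pE2; lra.
- have E : t + k.+1%:R * h = t + h + k%:R * h by rewrite -natr1; ring.
  move=> w Gw u tu; rewrite E => ut.
  have [uh|hu] := leP u (t + h).
    have [Aw B2] : A w /\ `|Z kappa u w - Z kappa t w| <= e / 2.
      case: Gw => [/GE1 Ew|/GE2 Ew].
        by split; [by have [] := EA1 _ Ew|by have [_ ->] := H1 _ Ew].
      by split; [by have [] := EA2 _ Ew|by have [_ ->] := H2 _ Ew].
    by move: (SA w Aw) B2; rewrite !ler_norml; lra.
  have -> : S w + (Z kappa u w - Z kappa t w) =
    S w + (Z kappa (t + h) w - Z kappa t w) + (Z kappa u w - Z kappa (t + h) w) by ring.
  case: Gw => [Gw|Gw]; [apply: K1|apply: K2] => //; exact: ltW.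
Qed.

(* Steering up when below the axis and down when above it keeps the path in the
   tube with probability at least 1/8 per step. *)
Lemma tube kappa (e T : R) : 0 < e -> 0 < T ->
  exists2 p : R, 0 < p & forall t A, 0 <= t -> t <= T -> F t A ->
    exists E, [/\ measurable E, E `<=` A, p * pr A <= pr E &
      forall w, E w -> forall u, t <= u -> u <= T ->
        `|Z kappa u w - Z kappa t w| <= e].
Proof.
move=> e0 T0; have e20 : 0 < e / 2 by lra.
have [h0 h00 H] := one_step kappa e20.
pose n := (Num.trunc (T / h0)).+1.
pose h := T / n%:R.
have h_gt0 : 0 < h by rewrite divr_gt0.
have hh0 : h <= h0.
  by rewrite ler_pdivrMr// mulrC -ler_pdivrMr// ltW// truncnS_gt.
exists (8^-1 ^+ n) => [|t A t0 tT FA]; first by rewrite exprn_gt0.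
have [|||E [mE EA pE K]] := @tube_steps kappa e h e0 h_gt0 _ n t A (cst 0) t0 FA.
- by move=> up s A' s0 FA'; exact: H.
- exact: measurable_cst.
- by move=> w _; rewrite normr0; lra.
exists E; split => // w Ew u tu uT; have := K w Ew u tu; rewrite add0r; apply.
by rewrite /h mulrC divfK ?gt_eqF//; lra.
Qed.

End brownian_events.

(** * The exchange inequality at a fixed time *)

Section exchange.
Context {R : realType} {d : measure_display} {Omega : measurableType d}.
Variable P : probability Omega R.
Variable B : R -> {RV P >-> R}.
Hypothesis HB : brownian_motion B.
Variables (T mu lam : R) (g : R -> R).
Hypothesis T0 : 0 < T.
Hypothesis mu0 : 0 <= mu.
Hypothesis lam_mu : lam = mu \/ lam = - mu.
Hypothesis hg : convex_payoff g.
Local Notation X := (fun t : R => (B t : Omega -> R)).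
Local Notation F := (natural_filtration X).
Local Notation pr := (pr P).
Local Notation drifted_bm := (drifted_bm P X).
Local Notation Z kappa := (drifted X kappa).
Local Notation mB := (measurable_B B).
Let hZ kappa : drifted_bm kappa (Z kappa) := drifted_bm_fwd HB kappa.
Let cZ kappa w : path_continuous (Z kappa ^~ w) := bm_continuous (hZ kappa) w.

Definition lag (Y : R -> Omega -> R) (s t : R) (w : Omega) : R :=
  seg_max (Y ^~ w) s t - Y t w.

Lemma lagE (Y : R -> Omega -> R) s t : lag Y s t = bwd_seg (fun u w => - Y u w) s t.
Proof.
apply/funext => w; rewrite /lag /bwd_seg; congr (seg_max _ s t - _).
by apply/funext => u; rewrite opprK.
Qed.

Lemma adapted_lag kappa s t : 0 <= s -> s <= t -> adapted X t (lag (Z kappa) s t).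
Proof.
by move=> s0 st; rewrite lagE; exact: (adapted_bwd_seg (drifted_bmN (hZ kappa)) s0 st).
Qed.

Lemma measurable_lag kappa s t : 0 <= s -> s <= t ->
  measurable_fun setT (lag (Z kappa) s t).
Proof. by move=> s0 st; exact: (adapted_measurable mB (adapted_lag kappa s0 st)). Qed.

Lemma measurable_fwd kappa s t : 0 <= s -> s <= t ->
  measurable_fun setT (fwd_seg (Z kappa) s t).
Proof. exact: mfwd (hZ kappa). Qed.

Lemma measurable_Z kappa s : 0 <= s -> measurable_fun setT (Z kappa s).
Proof. by move=> s0; exact: (adapted_measurable mB (bm_adapted (hZ kappa) s0 (lexx s))). Qed.

(* Time reversal: the final lag of the path with drift [mu] has the law of the
   running maximum of the path with drift [- mu]. *)
Lemma lag_law t A C : 0 <= t -> t <= T -> F t A -> measurable C ->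
  pr (A `&` lag (Z mu) t T @^-1` C) = pr (A `&` fwd_seg (Z (- mu)) t T @^-1` C).
Proof.
move=> t0; rewrite le_eqVlt => /orP[/eqP->|tT] FA mC.
  congr (pr (A `&` _)); apply/seteqP.
  have E kappa w : seg_max (Z kappa ^~ w) T T = Z kappa T w.
    apply/eqP; rewrite eq_le (seg_max_ub (cZ kappa w) (ltW T0) (lexx T) (lexx T)) andbT.
    apply: (seg_max_le (cZ kappa w) (ltW T0) (lexx T)) => u u1 u2.
    by have -> : u = T by lra.
  by split => w; rewrite /= /lag /fwd_seg !E !subrr.
rewrite lagE (bwd_seg_law mB (drifted_bmN (hZ mu)) (hZ (- mu)) t0 tT FA mC).
by rewrite (fwd_seg_law mB (hZ (- mu)) (hZ (- mu)) t0 tT FA mC).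
Qed.

(** Dominates all increments on [0, T] for drifts of size at most [mu], hence lags and forward
    maxima. A continued gap adds a further increment, whence the factor 2 in later bounds. *)
Definition bound (w : Omega) : R := osc B T w + mu * T.

Let lam_bd : `|lam| <= mu.
Proof. by case: lam_mu => ->; rewrite ?normrN ger0_norm. Qed.

Lemma Z_incr_bound kappa w u v : `|kappa| <= mu -> 0 <= u -> u <= T -> 0 <= v -> v <= T ->
  Z kappa u w - Z kappa v w <= bound w.
Proof.
move=> km u0 uT v0 vT; have := osc_ub HB w u0 uT v0 vT; rewrite /bound /drifted.
suff : kappa * u - kappa * v <= mu * T by lra.
rewrite -mulrBr; apply: le_trans (ler_norm _) _; rewrite normrM.
apply: (@le_trans _ _ (mu * `|u - v|)); first by rewrite ler_wpM2r.
by rewrite ler_wpM2l// ler_norml; lra.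
Qed.

Lemma bound_ge0 w : 0 <= bound w.
Proof.
have := @Z_incr_bound lam w 0 0 lam_bd (lexx 0) (ltW T0) (lexx 0) (ltW T0).
by rewrite subrr.
Qed.

Lemma seg_incr_bound kappa w s t v : `|kappa| <= mu -> 0 <= s -> s <= t -> t <= T ->
  0 <= v -> v <= T -> seg_max (Z kappa ^~ w) s t - Z kappa v w <= bound w.
Proof.
move=> km s0 st tT v0 vT.
have [c [sc ct <- _]] := seg_max_attained (cZ kappa w) s0 st.
by apply: Z_incr_bound => //; lra.
Qed.

Lemma lag_bounds kappa w s t : `|kappa| <= mu -> 0 <= s -> s <= t -> t <= T ->
  0 <= lag (Z kappa) s t w <= bound w.
Proof.
move=> km s0 st tT; rewrite /lag subr_ge0 (seg_max_ub (cZ kappa w))//=.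
by apply: seg_incr_bound => //; lra.
Qed.

Lemma fwd_bounds kappa w s t : `|kappa| <= mu -> 0 <= s -> s <= t -> t <= T ->
  0 <= fwd_seg (Z kappa) s t w <= bound w.
Proof.
move=> km s0 st tT; rewrite /fwd_seg subr_ge0 (seg_max_ub (cZ kappa w))//=.
by apply: seg_incr_bound => //; lra.
Qed.

Lemma integrable_bound : P.-integrable setT (EFin \o bound).
Proof.
have := integrableD measurableT (integrable_osc HB T0)
  (finite_measure_integrable_cst P (mu * T) measurableT).
by apply: eq_integrable.
Qed.

Let dom : exists2 C : R, 0 < C & forall y w, 0 <= y -> y <= 2 * bound w ->
  `|g y| <= C * (1 + 2 * bound w).
Proof.
have [C C0 H] := payoff_linear_growth hg; exists C => // y w y0 yb.
by apply: le_trans (H y y0) _; rewrite ler_wpM2l ?(ltW C0)// lerD2l.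
Qed.

Let integrable_dom (C : R) :
  P.-integrable setT (EFin \o (fun w => C * (1 + 2 * bound w))).
Proof.
have I2 : P.-integrable setT (fun w => (1 + 2 * bound w)%:E).
  apply: (@integrableD _ _ _ _ setT measurableT (cst 1%:E) (fun w => (2 * bound w)%:E)).
    exact: finite_measure_integrable_cst.
  have := integrableZl measurableT 2 integrable_bound; exact: eq_integrable.
by have := integrableZl measurableT C I2; apply: eq_integrable.
Qed.

Lemma payoff_dominated : exists2 G : Omega -> R, P.-integrable setT (EFin \o G) &
  forall y w, 0 <= y -> y <= 2 * bound w -> `|g y| <= G w.
Proof.
by have [C C0 H] := dom; exists (fun w => C * (1 + 2 * bound w)).
Qed.

Lemma integrable_payoff (Y : Omega -> R) : measurable_fun setT Y ->
  (forall w, 0 <= Y w <= 2 * bound w) -> P.-integrable setT (EFin \o (g \o Y)).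
Proof.
move=> mY HY; have [C C0 H] := dom.
apply: le_integrable (integrable_dom C) => //.
  by apply/measurable_EFinP; apply: measurableT_comp => //; exact: measurable_payoff.
move=> w _; rewrite /= lee_fin; have /andP[y0 y1] := HY w.
by apply: le_trans (H _ _ y0 y1) _; exact: ler_norm.
Qed.

Section tangent_integral.
Variables (t : R) (A : set Omega).
Hypothesis t0 : 0 <= t.
Hypothesis tT : t <= T.
Hypothesis FA : F t A.
Let mA := filtration_measurable mB FA.
Let x := lag (Z lam) 0 t.
Let ax : adapted X t x := adapted_lag lam (lexx 0) t0.
Let x_ge0 w : 0 <= x w.
Proof. by have /andP[] := lag_bounds w lam_bd (lexx 0) t0 tT. Qed.
Let x_le w : x w <= bound w.
Proof. by have /andP[] := lag_bounds w lam_bd (lexx 0) t0 tT. Qed.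

Lemma integrable_tangent_ext (V : Omega -> R) : measurable_fun setT V ->
  (forall w, 0 <= V w <= bound w) ->
  P.-integrable setT (EFin \o (fun w => tangent_ext g (x w) (V w))).
Proof.
move=> mV HV.
have mx := adapted_measurable mB ax.
have I1 : P.-integrable setT (EFin \o (fun w => `|g 0| + `|g (Num.max (x w) (V w))|)).
  apply: (@integrableD _ _ _ _ setT measurableT (cst `|g 0|%:E)
    (fun w => `|g (Num.max (x w) (V w))|%:E)).
    exact: finite_measure_integrable_cst.
  apply: (@integrable_norm _ _ _ _ setT (fun w => g (Num.max (x w) (V w)))).
  apply: (@integrable_payoff (fun w => Num.max (x w) (V w))).
    exact: measurable_maxr.
  move=> w; have := HV w; have := x_le w; have := x_ge0 w; have := bound_ge0 w.
  by case: (leP (x w) (V w)); lra.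
apply: le_integrable I1 => //.
  apply/measurable_EFinP.
  apply: (measurableT_comp (measurable_tangent_ext hg) (measurable_fun_pair mx mV)).
move=> w _; rewrite /= lee_fin [leRHS]ger0_norm ?addr_ge0//.
have /andP[V0 _] := HV w.
have := tangent_ext_le0 hg (x_ge0 w) V0.
have := tangent_ext_ge hg (x w) (V w).
have := ler_norm (g 0); have := ler_norm (- g (Num.max (x w) (V w))).
rewrite normrN ler_norml.
have := normr_ge0 (g 0); have := normr_ge0 (g (Num.max (x w) (V w))).
lra.
Qed.

Let V1 := lag (Z mu) t T.
Let V2 := fwd_seg (Z (- mu)) t T.
Let mu_bd : `|mu| <= mu. Proof. by rewrite ger0_norm. Qed.
Let Nmu_bd : `|- mu| <= mu. Proof. by rewrite normrN ger0_norm. Qed.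

(* The post-[t] variables [V1] and [V2] have the same law and are independent of
   the past up to [t]. *)
Lemma integral_lag_fwd (Phi : R -> R -> R) (k : R) :
  measurable_fun setT (fun q : R * R => Phi q.1 q.2) ->
  (forall y v, 0 <= y -> 0 <= v -> Phi y v <= k) ->
  P.-integrable setT (EFin \o (fun w => Phi (x w) (V1 w))) ->
  P.-integrable setT (EFin \o (fun w => Phi (x w) (V2 w))) ->
  (\int[P]_(w in A) Phi (x w) (V1 w) = \int[P]_(w in A) Phi (x w) (V2 w))%R.
Proof.
move=> mPhi Phik I1 I2.
have b1 w := lag_bounds w mu_bd t0 tT (lexx T).
have b2 w := fwd_bounds w Nmu_bd t0 tT (lexx T).
have m1 : measurable_fun setT V1 := measurable_lag mu t0 tT.
have m2 : measurable_fun setT V2 := measurable_fwd (- mu) t0 tT.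
have IA1 := integrableS measurableT mA (@subsetT _ A) I1.
have IA2 := integrableS measurableT mA (@subsetT _ A) I2.
have Ic : P.-integrable A (EFin \o (fun=> k)).
  by apply: (integrableS measurableT mA (@subsetT _ A));
    exact: finite_measure_integrable_cst.
(* Subtracting from the upper bound [k] makes the integrands nonnegative, as [pair_law_integral]
   requires. *)
suff E : (\int[P]_(w in A) (k - Phi (x w) (V1 w)) =
          \int[P]_(w in A) (k - Phi (x w) (V2 w)))%R.
  by move: E; rewrite !RintegralB//; lra.
rewrite /Rintegral; congr fine.
(* [U] is measurable at time [t] and encodes both [A] and the lag: the value -1 marks the complement
   of [A], where [H] vanishes. *)
pose U w := if `[< A w >] then x w else -1.
pose H (q : R * R) : \bar R := if (0 <= q.1) && (0 <= q.2)
  then (k - Phi q.1 q.2)%:E else 0%E.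
have aU : adapted X t U.
  apply: measurable_fun_ifT; [|exact: ax|exact: measurable_cst].
  apply: (@measurable_fun_bool _ (g_sigma_algebraType (generators X t)) setT _ true).
  rewrite setTI; have -> : (fun w => `[< A w >]) @^-1` [set true] = A.
    by apply/seteqP; split => w /=; [move/asboolP|move=> ?; apply/asboolP].
  exact: FA.
have mH : measurable_fun setT H.
  apply: measurable_fun_ifT.
  - by apply: measurable_and; apply: measurable_fun_ler => //.
  - by apply/measurable_EFinP; apply: measurable_funB; first exact: measurable_cst.
  - exact: measurable_cst.
have H0 q : (0 <= H q)%E.
  rewrite /H; case: ifPn => // /andP[q1 q2]; rewrite lee_fin subr_ge0.
  exact: Phik.
have law C C' : measurable C -> measurable C' ->
    pr (U @^-1` C `&` V1 @^-1` C') = pr (U @^-1` C `&` V2 @^-1` C').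
  move=> mC mC'; apply: lag_law => //.
  exact: adapted_preimage aU mC.
have := pair_law_integral (adapted_measurable mB aU) m1 m2 mH H0 law.
have E (V : Omega -> R) : (forall w, 0 <= V w) ->
    (\int[P]_(w in A) (k - Phi (x w) (V w))%:E = \int[P]_w H (U w, V w))%E.
  move=> V0; rewrite integral_mkcond; apply: eq_integral => w _.
  rewrite patchE /H /U /=; case: ifPn => [|]; rewrite ?inE ?notin_setE => Aw.
    by rewrite asboolT// x_ge0 V0.
  by rewrite asboolF//= ler0N1.
rewrite -!E// => w; [by have /andP[] := b2 w|by have /andP[] := b1 w].
Qed.

Lemma tangent_integral_eq :
  (\int[P]_(w in A) tangent_ext g (x w) (V1 w) =
   \int[P]_(w in A) tangent_ext g (x w) (V2 w))%R.
Proof.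
have b1 w := lag_bounds w mu_bd t0 tT (lexx T).
have b2 w := fwd_bounds w Nmu_bd t0 tT (lexx T).
have m1 : measurable_fun setT V1 := measurable_lag mu t0 tT.
have m2 : measurable_fun setT V2 := measurable_fwd (- mu) t0 tT.
apply: (integral_lag_fwd (k := g 0)).
- exact: measurable_tangent_ext.
- exact: tangent_ext_le0.
- exact: integrable_tangent_ext m1 b1.
- exact: integrable_tangent_ext m2 b2.
Qed.

Lemma payoff_integral_eq :
  (\int[P]_(w in A) g (V1 w) = \int[P]_(w in A) g (V2 w))%R.
Proof.
have b1 w := lag_bounds w mu_bd t0 tT (lexx T).
have b2 w := fwd_bounds w Nmu_bd t0 tT (lexx T).
have m1 : measurable_fun setT V1 := measurable_lag mu t0 tT.
have m2 : measurable_fun setT V2 := measurable_fwd (- mu) t0 tT.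
apply: (integral_lag_fwd (Phi := fun=> g) (k := g 0)).
- by apply: (measurableT_comp (measurable_payoff hg)); exact: measurable_snd.
- by case: hg => _ ni _ y v _ v0; exact: ni.
- apply: (integrable_payoff m1) => w; have /andP[v0 vb] := b1 w.
  by apply/andP; split => //; have := bound_ge0 w; rewrite /V1; lra.
- apply: (integrable_payoff m2) => w; have /andP[v0 vb] := b2 w.
  by apply/andP; split => //; have := bound_ge0 w; rewrite /V2; lra.
Qed.

(* The gap between maximum and endpoint at time [T] of the path with drift [lam]
   before [t] and [mu] after [t]. *)
Let cont w := Num.max (x w) (fwd_seg (Z mu) t T w) - (Z mu T w - Z mu t w).
Definition stop_gap (s : R) (w : Omega) : R := seg_max (Z lam ^~ w) 0 T - Z lam s w.

Lemma stop_gapE w : stop_gap t w = Num.max (x w) (fwd_seg (Z lam) t T w).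
Proof.
rewrite /stop_gap (seg_max_split (cZ lam w) (lexx 0) t0 tT) /x /lag /fwd_seg.
set a := seg_max _ 0 t; set b := seg_max _ t T.
by case: (leP a b); case: (leP (a - Z lam t w)) => //; lra.
Qed.

Lemma measurable_stop_gap : measurable_fun setT (stop_gap t).
Proof.
apply: measurable_funB; last exact: measurable_Z.
exact: (adapted_measurable mB (adapted_seg_max (hZ lam) (lexx 0) (ltW T0))).
Qed.

Lemma stop_gap_bounds w : 0 <= stop_gap t w <= 2 * bound w.
Proof.
rewrite stop_gapE; have := fwd_bounds w lam_bd t0 tT (lexx T).
have := x_le w; have := x_ge0 w; have := bound_ge0 w.
by case: (leP (x w) (fwd_seg (Z lam) t T w)); lra.
Qed.

Lemma fwd_mono w : fwd_seg (Z (- mu)) t T w <= fwd_seg (Z mu) t T w.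
Proof.
rewrite /fwd_seg lerBlDr; apply: (seg_max_le (cZ _ w)) => // u tu uT.
have ut : 0 <= u - t by lra.
have := mulr_ge0 mu0 ut.
have /= := seg_max_ub (cZ mu w) t0 tu uT.
by set S := seg_max _ _ _; rewrite /drifted mulrBr; lra.
Qed.

(** [tangent_ext_exchange] with [a] and [b] the forward maxima for drift [mu] and [- mu]. If
    [lam = - mu], it yields the payoff of stopping exactly; if [lam = mu], the gap of stopping is
    larger still and its payoff smaller. *)
Lemma exchange_pointwise w :
  tangent_ext g (x w) (V1 w) - tangent_ext g (x w) (V2 w) <= g (cont w) - g (stop_gap t w).
Proof.
have b2 := fwd_bounds w Nmu_bd t0 tT (lexx T).
have b1 := lag_bounds w mu_bd t0 tT (lexx T).
have E : V1 w = fwd_seg (Z mu) t T w - (Z mu T w - Z mu t w).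
  by rewrite /V1 /lag /fwd_seg; ring.
have Da : Z mu T w - Z mu t w <= fwd_seg (Z mu) t T w.
  by rewrite /fwd_seg lerD2r (seg_max_ub (cZ mu w)).
have V20 : 0 <= V2 w by case/andP : b2.
have := tangent_ext_exchange hg (x_ge0 w) V20 (fwd_mono w) Da.
rewrite E -/(cont w) stop_gapE => H; apply: le_trans H _.
rewrite lerD2l lerN2; case: lam_mu => ->; last by [].
case: hg => _ ni _; apply: ni; apply: le_max2 => //; exact: fwd_mono.
Qed.

(** The two tangent terms have equal integrals over [A] and cancel; the surplus [eta] on [E]
    remains. Any [Q] below the continued gap is allowed because [g] is nonincreasing. *)
Lemma exchange_integral (Q : Omega -> R) (E : set Omega) (eta : R) :
  measurable_fun setT Q -> (forall w, 0 <= Q w <= 2 * bound w) ->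
  (forall w, A w -> Q w <= cont w) -> measurable E -> E `<=` A ->
  (forall w, E w -> tangent_ext g (x w) (V1 w) - tangent_ext g (x w) (V2 w) + eta <=
     g (cont w) - g (stop_gap t w)) ->
  eta * pr E <= (\int[P]_(w in A) (g (Q w) - g (stop_gap t w)))%R.
Proof.
move=> mQ bQ Qc mE EA HE.
have b1 w := lag_bounds w mu_bd t0 tT (lexx T).
have b2 w := fwd_bounds w Nmu_bd t0 tT (lexx T).
have m1 : measurable_fun setT V1 := measurable_lag mu t0 tT.
have m2 : measurable_fun setT V2 := measurable_fwd (- mu) t0 tT.
have sA := @subsetT _ A.
have I1 := integrableS measurableT mA sA (integrable_tangent_ext m1 b1).
have I2 := integrableS measurableT mA sA (integrable_tangent_ext m2 b2).
have I3 := integrableS measurableT mA sA (integrable_payoff mQ bQ).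
have I4 := integrableS measurableT mA sA (integrable_payoff measurable_stop_gap stop_gap_bounds).
have IE : P.-integrable A (EFin \o (fun w => eta * \1_E w)).
  apply: (integrableS measurableT mA sA).
  have := integrableZl measurableT eta (integrable_indic P mE).
  exact: eq_integrable.
have I12 : P.-integrable A (EFin \o
    (fun w => tangent_ext g (x w) (V1 w) - tangent_ext g (x w) (V2 w))).
  by have := integrableB mA I1 I2; exact: eq_integrable.
have I34 : P.-integrable A (EFin \o (fun w => g (Q w) - g (stop_gap t w))).
  by have := integrableB mA I3 I4; exact: eq_integrable.
have -> : eta * pr E = (\int[P]_(w in A) (tangent_ext g (x w) (V1 w) -
    tangent_ext g (x w) (V2 w) + eta * \1_E w))%R.
  rewrite RintegralD//= RintegralB// tangent_integral_eq subrr add0r.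
  rewrite RintegralZl//; last first.
    exact: (integrableS measurableT mA sA (integrable_indic P mE)).
  congr (eta * _); rewrite /Rintegral integral_indic// /pr.
  by congr (fine (P _)); apply/esym/setIidl.
apply: le_Rintegral => //.
  by have := integrableD mA I12 IE; exact: eq_integrable.
move=> w Aw.
have gQ : g (cont w) <= g (Q w) by case: hg => _ ni _; exact/ni/Qc.
rewrite indicE; case: (boolP (w \in E)) => [|_]; rewrite ?inE /= ?mulr1n ?mulr0n.
  move=> Ew.
  by rewrite mulr1; have := HE w Ew; lra.
by rewrite mulr0 addr0; have := exchange_pointwise w; lra.
Qed.

End tangent_integral.
End exchange.

(** * Uniform strict gains from continuing *)

Section strict_gain.
Context {R : realType} {d : measure_display} {Omega : measurableType d}.
Variable P : probability Omega R.
Variable B : R -> {RV P >-> R}.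
Hypothesis HB : brownian_motion B.
Variables (T mu lam : R) (g : R -> R).
Hypothesis T0 : 0 < T.
Hypothesis mu0 : 0 <= mu.
Hypothesis lam_mu : lam = mu \/ lam = - mu.
Hypothesis hg : convex_payoff g.
Local Notation X := (fun t : R => (B t : Omega -> R)).
Local Notation F := (natural_filtration X).
Local Notation pr := (pr P).
Local Notation Z kappa := (drifted X kappa).
Local Notation mB := (measurable_B B).
Local Notation c := (rslope g).
Local Notation bound := (bound B T mu).
Local Notation stop_gap := (stop_gap B T lam).
Local Notation x := (lag (Z lam) 0).
Let hZ kappa := drifted_bm_fwd HB kappa.
Let cZ kappa w : path_continuous (Z kappa ^~ w) := bm_continuous (hZ kappa) w.

Let lam_bd : `|lam| <= mu.
Proof. by case: lam_mu => ->; rewrite ?normrN ger0_norm. Qed.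

Definition continued (t : R) (w : Omega) : R :=
  Num.max (x t w) (fwd_seg (Z mu) t T w) - (Z mu T w - Z mu t w).

(** The rate [rho] depends neither on the time nor on the past event, so it survives summation over
    the values of a discretised rule and the refinement of grids. The margin [dl] leaves the path
    time to follow a tube; [J] collects the lags at which stopping is penalised. *)
Definition gain (dl : R) (J : set R) (rho : R) : Prop :=
  forall (t : R) (A : set Omega) (Q : Omega -> R),
  0 <= t -> t <= T - dl -> F t A -> (forall w, A w -> J (x t w)) ->
  measurable_fun setT Q -> (forall w, 0 <= Q w <= 2 * bound w) ->
  (forall w, A w -> Q w <= continued t w) ->
  rho * pr A <= (\int[P]_(w in A) (g (Q w) - g (stop_gap t w)))%R.

Lemma x_ge0 t w : 0 <= t -> t <= T -> 0 <= x t w.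
Proof.
by move=> t0 tT; have /andP[] := lag_bounds HB mu0 w lam_bd (lexx 0) t0 tT.
Qed.

Lemma gain0 : gain 0 setT 0.
Proof.
move=> t A Q t0 tT FA _ mQ bQ Qc; rewrite subr0 in tT.
have := @exchange_integral _ _ _ _ _ HB T mu lam g T0 mu0 lam_mu hg t A t0 tT FA Q set0 0
  mQ bQ Qc measurable0 (@sub0set _ A).
by rewrite !mul0r; apply => w [].
Qed.

Lemma gain_tube dl J kappa e eta : 0 <= dl -> 0 < e -> 0 < eta ->
  (forall t w, 0 <= t -> t <= T - dl -> J (x t w) ->
    (forall u, t <= u -> u <= T -> `|Z kappa u w - Z kappa t w| <= e) ->
    tangent_ext g (x t w) (lag (Z mu) t T w) -
    tangent_ext g (x t w) (fwd_seg (Z (- mu)) t T w) + eta <=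
    g (continued t w) - g (stop_gap t w)) ->
  exists2 rho, 0 < rho & gain dl J rho.
Proof.
move=> dl0 e0 eta0 H; have [p p0 Hp] := tube HB kappa e0 T0.
exists (eta * p); first exact: mulr_gt0.
move=> t A Q t0 tT FA JA mQ bQ Qc; have tT' : t <= T by lra.
have [E [mE EA pE HE]] := Hp t A t0 tT' FA.
apply: (@le_trans _ _ (eta * pr E)).
  by rewrite -mulrA ler_wpM2l// ltW.
apply: (@exchange_integral _ _ _ _ _ HB T mu lam g) => //.
move=> w Ew; apply: H => //; first exact/JA/EA.
exact: HE.
Qed.

Lemma gain_union dl J J1 J2 rho1 rho2 : 0 <= dl -> measurable J1 -> J `<=` J1 `|` J2 ->
  gain dl J1 rho1 -> gain dl J2 rho2 -> gain dl J (Num.min rho1 rho2).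
Proof.
move=> dl0 mJ1 JJ G1 G2 t A Q t0 tT FA JA mQ bQ Qc; have tT' : t <= T by lra.
have mA := filtration_measurable mB FA.
have FJ : F t (x t @^-1` J1) := adapted_preimage (adapted_lag HB lam (lexx 0) t0) mJ1.
have mJ := filtration_measurable mB FJ.
have FA1 := filtrationI FA FJ; have FA2 := filtrationI FA (filtrationC FJ).
have mA1 := filtration_measurable mB FA1; have mA2 := filtration_measurable mB FA2.
have AE : A = (A `&` x t @^-1` J1) `|` (A `&` ~` (x t @^-1` J1)).
  by rewrite -setIUr setUv setIT.
have L1 : rho1 * pr (A `&` x t @^-1` J1) <=
    (\int[P]_(w in A `&` x t @^-1` J1) (g (Q w) - g (stop_gap t w)))%R.
  by apply: G1 => // w [] // Aw _; exact: Qc.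
have L2 : rho2 * pr (A `&` ~` (x t @^-1` J1)) <=
    (\int[P]_(w in A `&` ~` (x t @^-1` J1)) (g (Q w) - g (stop_gap t w)))%R.
  apply: G2 => // w [] Aw; last by move=> _; exact: Qc.
  by case: (JJ _ (JA w Aw)).
rewrite [in leRHS]AE Rintegral_setU//; last 2 first.
- rewrite -AE; apply: (integrableS measurableT mA (@subsetT _ A)).
  have I3 := integrable_payoff HB T0 hg mQ bQ.
  have I4 := integrable_payoff HB T0 hg (measurable_stop_gap HB lam T0 t0)
    (stop_gap_bounds HB T0 mu0 lam_mu t0 tT').
  by have := integrableB measurableT I3 I4; exact: eq_integrable.
- by apply/disj_setPS => w [[_ ?] [_]].
apply: le_trans _ (lerD L1 L2); rewrite (pr_setID P mA mJ).
have p1 := pr_ge0 P (A `&` x t @^-1` J1).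
have p2 := pr_ge0 P (A `&` ~` (x t @^-1` J1)).
have r1 : Num.min rho1 rho2 <= rho1 by rewrite ge_min lexx.
have r2 : Num.min rho1 rho2 <= rho2 by rewrite ge_min lexx orbT.
nra.
Qed.

Let stop_gap_le t w : 0 <= t -> t <= T ->
  g (stop_gap t w) <= g (Num.max (x t w) (fwd_seg (Z (- mu)) t T w)).
Proof.
move=> t0 tT; rewrite (stop_gapE HB lam t0 tT); case: hg => _ ni _; apply: ni.
case: lam_mu => ->; last by [].
by apply: le_max2 => //; exact: (fwd_mono HB mu0).
Qed.

Let lag_fwd t w : lag (Z mu) t T w = fwd_seg (Z mu) t T w - (Z mu T w - Z mu t w).
Proof. by rewrite /lag /fwd_seg; ring. Qed.

Let incr_tube kappa mu' w u v : Z mu' u w - Z mu' v w =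
  (Z kappa u w - Z kappa v w) + (mu' - kappa) * (u - v).
Proof. by rewrite /drifted; ring. Qed.

Let seg_le kappa (y : R) s t v w : 0 <= s -> s <= t ->
  (forall u, s <= u -> u <= t -> Z kappa u w - Z kappa v w <= y) ->
  seg_max (Z kappa ^~ w) s t - Z kappa v w <= y.
Proof.
by move=> s0 st H; have [u [su ut <- _]] := seg_max_attained (cZ kappa w) s0 st; exact: H.
Qed.

(** While [Z (- k)] stays in its tube, [Z mu] climbs at rate [mu + k]. It climbs past a lag of at
    most [K] and ends near its maximum, as [tangent_ext_exchange_convex_left] demands. *)
Lemma gain_left dl p m K : 0 < dl -> 0 < p -> c p < m ->
  exists2 rho, 0 < rho & gain dl [set y | [/\ p < y, y <= K & m <= c y]] rho.
Proof.
move=> dl0 p0 cp.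
(* Steep enough to rise by [K] in time [dl]; the extra 1 absorbs the tube width. *)
pose k := (`|K| + 1) / dl.
have k0 : 0 <= k by rewrite divr_ge0 ?addr_ge0// ltW.
pose e := Num.min 1 (p / 4).
have e0 : 0 < e by rewrite lt_min ltr01; lra.
have e1 : e <= 1 by rewrite ge_min lexx.
have ep : e <= p / 4 by rewrite ge_min lexx orbT.
have eta0 : 0 < (m - c p) * (p / 2) by rewrite mulr_gt0//; lra.
apply: (gain_tube (ltW dl0) e0 eta0 (kappa := - k)) => t w t0 tT [px xK mc] H.
have tT' : t <= T by lra.
have T00 := ltW T0.
have sg := stop_gap_le w t0 tT'.
have D1 : K <= Z mu T w - Z mu t w.
  rewrite (incr_tube (- k)).
  have := H T tT' (lexx T); rewrite ler_norml => /andP[h1 _].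
  have kd : k * dl = `|K| + 1 by rewrite /k divfK// gt_eqF.
  have : (mu - - k) * (T - t) >= k * dl.
    by rewrite opprK mulrDl; have := mulr_ge0 mu0 (_ : 0 <= T - t); nra.
  by have := ler_norm K; lra.
have D2 : Z mu T w - Z mu t w <= fwd_seg (Z mu) t T w.
  by rewrite /fwd_seg lerD2r (seg_max_ub (cZ mu w)).
have L : lag (Z mu) t T w <= p / 2.
  rewrite /lag; apply: seg_le => // u tu uT; rewrite (incr_tube (- k)).
  have := H T tT' (lexx T); have := H u tu uT; rewrite !ler_norml => h1 h2.
  have q : (mu - - k) * (u - T) <= 0 by apply: mulr_ge0_le0; [rewrite opprK addr_ge0|rewrite subr_le0].
  by lra.
rewrite lag_fwd in L *; apply: le_trans (_ : _ <= g (continued t w) -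
  g (Num.max (x t w) (fwd_seg (Z (- mu)) t T w))) _; last by lra.
apply: tangent_ext_exchange_convex_left => //; lra.
Qed.

(** Here the tube makes the driftless path fall at rate [k]. Its forward maximum is at most
    [dl / 2], so a lag of at least [dl] exceeds it by [dl / 2], and the total fall is at least the
    lag and at least [q]. *)
Lemma gain_right dl K m q : mu = 0 -> 0 < dl -> 0 < q -> m < c q ->
  exists2 rho, 0 < rho & gain dl [set y | [/\ dl <= y, y <= K & c y <= m]] rho.
Proof.
move=> mu00 dl0 q0 mq.
pose k := (`|K| + q + 1) / dl.
have k0 : 0 <= k by rewrite divr_ge0 ?addr_ge0// ltW.
pose e := Num.min 1 (dl / 2).
have e0 : 0 < e by rewrite lt_min ltr01; lra.
have e1 : e <= 1 by rewrite ge_min lexx.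
have ep : e <= dl / 2 by rewrite ge_min lexx orbT.
have eta0 : 0 < (c q - m) * (dl / 2) by rewrite mulr_gt0//; lra.
apply: (gain_tube (ltW dl0) e0 eta0 (kappa := k)) => t w t0 tT [px xK mc] H.
have tT' : t <= T by lra.
have lam0 : lam = 0 by case: lam_mu => ->; rewrite mu00 ?oppr0.
have D1 : Z mu T w - Z mu t w <= - (`|K| + q).
  rewrite (incr_tube k) mu00.
  have := H T tT' (lexx T); rewrite ler_norml => /andP[_ h1].
  have kd : k * dl = `|K| + q + 1 by rewrite /k divfK// gt_eqF.
  have : k * dl <= k * (T - t) by rewrite ler_wpM2l//; lra.
  by rewrite sub0r mulNr; lra.
have A1 : fwd_seg (Z mu) t T w <= e.
  rewrite /fwd_seg; apply: seg_le => // u tu uT; rewrite (incr_tube k) mu00.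
  have := H u tu uT; rewrite ler_norml => /andP[_ h1].
  have : 0 <= k * (u - t) by rewrite mulr_ge0//; lra.
  by rewrite sub0r mulNr; lra.
have A0 : 0 <= fwd_seg (Z mu) t T w.
  by rewrite subr_ge0 (seg_max_ub (cZ mu w)).
have -> : - mu = mu by rewrite mu00 oppr0.
rewrite lag_fwd /continued (stop_gapE HB lam t0 tT') (_ : fwd_seg (Z lam) = fwd_seg (Z mu)).
  have := ler_norm K => ?.
  apply: tangent_ext_exchange_convex_right => //; lra.
by rewrite lam0 mu00.
Qed.

(** With positive drift the forward maxima for [mu] and [- mu] differ, so strictness comes from a
    negative slope of the payoff and needs no curvature. *)
Lemma gain_drift dl p : lam = mu -> 0 < mu -> 0 < dl -> 0 < p -> c p < 0 ->
  exists2 rho, 0 < rho & gain dl [set y | y <= p \/ c y <= c p / 2] rho.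
Proof.
move=> lm mup dl0 p0 cp.
(* While the driftless path stays within [e], the forward maximum is at most [e] for [- mu] and at
   least [mu * dl - e >= 3 * e] for [mu]; the difference [2 * e] times [- c p / 2] is the
   surplus. *)
pose e := Num.min p (mu * dl) / 4.
have M0 : 0 < Num.min p (mu * dl) by rewrite lt_min p0 mulr_gt0.
have e0 : 0 < e by rewrite /e; lra.
have e1 : 4 * e <= p.
  have : Num.min p (mu * dl) <= p by rewrite ge_min lexx.
  by rewrite /e; lra.
have e2 : 4 * e <= mu * dl.
  have : Num.min p (mu * dl) <= mu * dl by rewrite ge_min lexx orbT.
  by rewrite /e; lra.
have eta0 : 0 < - c p * e by rewrite mulr_gt0//; lra.
apply: (gain_tube (ltW dl0) e0 eta0 (kappa := 0)) => t w t0 tT Jx H.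
have tT' : t <= T by lra.
have x0 := x_ge0 w t0 tT'.
have b1 : fwd_seg (Z (- mu)) t T w <= e.
  rewrite /fwd_seg; apply: seg_le => // u tu uT; rewrite (incr_tube 0).
  have := H u tu uT; rewrite ler_norml => /andP[_ h1].
  have : 0 <= mu * (u - t) by rewrite mulr_ge0//; lra.
  by rewrite subr0 mulNr; lra.
have b0 : 0 <= fwd_seg (Z (- mu)) t T w.
  by rewrite subr_ge0 (seg_max_ub (cZ (- mu) w)).
have D2 : Z mu T w - Z mu t w <= fwd_seg (Z mu) t T w.
  by rewrite /fwd_seg lerD2r (seg_max_ub (cZ mu w)).
have a1 : 3 * e <= fwd_seg (Z mu) t T w.
  apply: le_trans D2; rewrite (incr_tube 0) subr0.
  have := H T tT' (lexx T); rewrite ler_norml => /andP[h1 _].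
  have : mu * dl <= mu * (T - t) by rewrite ler_wpM2l//; lra.
  lra.
have gap : - c p * e <= tangent_ext g (x t w) (fwd_seg (Z (- mu)) t T w) -
    tangent_ext g (x t w) (fwd_seg (Z mu) t T w).
  apply: (le_trans _ (@tangent_ext_gap _ _ hg _ _ _ (3 * e) p x0 p0 Jx b0 _ _ a1)); [nra|lra|lra].
have a0 : 0 <= fwd_seg (Z mu) t T w by lra.
have := tangent_ext_exchange hg x0 a0 (lexx _) D2.
rewrite lag_fwd /continued (stop_gapE HB lam t0 tT').
have -> : fwd_seg (Z lam) = fwd_seg (Z mu) by rewrite lm.
lra.
Qed.

Let mc m : measurable [set y | c y <= m].
Proof.
have mI : measurable (`]-oo, m]%classic : set R) by exact: measurable_itv.
by have := measurable_rslope hg measurableT mI; rewrite setTI.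
Qed.

(** A nonlinear payoff has two distinct slopes. With [m] their midpoint, lags of slope at most [m]
    gain from a fall, and those of larger slope, necessarily beyond [p], from a rise. *)
Lemma gain_convex dl K : mu = 0 -> ~ linear_on `]0, +oo[ g -> 0 < dl ->
  exists2 rho, 0 < rho & gain dl [set y | dl <= y /\ y <= K] rho.
Proof.
move=> mu00 nl dl0; have [p [q [p0 pq cpq]]] := rslope_lt_exists hg nl.
pose m := (c p + c q) / 2.
have [|rho1 r1 G1] := @gain_left dl p m K dl0 p0; first by rewrite /m; lra.
have q0 : 0 < q by lra.
have [|rho2 r2 G2] := @gain_right dl K m q mu00 dl0 q0; first by rewrite /m; lra.
exists (Num.min rho2 rho1); first by rewrite lt_min r2.
apply: gain_union G2 G1 => //; first exact: ltW.
  have -> : [set y | [/\ dl <= y, y <= K & c y <= m]] = `[dl, K] `&` [set y | c y <= m].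
    by apply/seteqP; split => y /=; rewrite in_itv/=; [case=> -> -> ->|case=> /andP[]].
  exact: measurableI.
move=> y [dy yK]; have [cm|mc'] := leP (c y) m; [left; split => //|right; split => //=].
  rewrite ltNge; apply/negP => yp.
  have y0 : 0 < y by lra.
  by have := rslope_nondecreasing hg y0 yp; move: mc'; rewrite /m; lra.
exact: ltW.
Qed.

(** Lags not covered by [gain_drift] lie beyond [p] and have slope above [c p / 2], which exceeds
    the negative [c p]; there [gain_left] applies. *)
Lemma gain_nonconstant dl K : lam = mu -> 0 < mu -> nonconstant_on `]0, +oo[ g ->
  0 < dl -> exists2 rho, 0 < rho & gain dl [set y | y <= K] rho.
Proof.
move=> lm mup nc dl0; have [p p0 cp] := rslope_lt0_exists hg nc.
have [rho1 r1 G1] := @gain_drift dl p lm mup dl0 p0 cp.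
have [|rho2 r2 G2] := @gain_left dl p (c p / 2) K dl0 p0; first by lra.
exists (Num.min rho1 rho2); first by rewrite lt_min r1.
apply: gain_union G1 G2 => //; first exact: ltW.
  have -> : [set y | y <= p \/ c y <= c p / 2] = `]-oo, p] `|` [set y | c y <= c p / 2].
    by apply/seteqP; split => y /=; rewrite in_itv/=.
  exact: measurableU.
move=> y /= yK; have [yp|py] := leP y p; first by left; left.
by have [cm|mc'] := leP (c y) (c p / 2); [left; right|right; split => //; exact: ltW].
Qed.

End strict_gain.

(** * Dominated convergence for real integrals *)

Section rintegral_limit.
Context {R : realType} {d : measure_display} {Omega : measurableType d}.
Variable P : probability Omega R.

Lemma cvg_Rintegral (f_ : nat -> Omega -> R) (f G : Omega -> R) :
  (forall n, measurable_fun setT (f_ n)) -> measurable_fun setT f ->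
  (forall w, f_ n w @[n --> \oo] --> f w) ->
  P.-integrable setT (EFin \o G) -> (forall n w, `|f_ n w| <= G w) ->
  (\int[P]_w f_ n w)%R @[n --> \oo] --> (\int[P]_w f w)%R.
Proof.
move=> mf_ mf cf iG bG.
have [] := @dominated_convergence _ _ _ P setT measurableT
  (fun n => EFin \o f_ n) (EFin \o f) (EFin \o G).
- by move=> n; exact/measurable_EFinP.
- exact/measurable_EFinP.
- by apply: aeW => w _; apply: cvg_EFin; [near=> n|exact: cf].
- exact: iG.
- by apply: aeW => w n _; rewrite lee_fin.
move=> If _ H.
rewrite /Rintegral; apply: fine_cvg.
rewrite fineK; first exact: H.
exact: integrable_fin_num.
Unshelve. all: by end_near. Qed.

End rintegral_limit.

(** * Discretisation of stopping rules from above *)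

Section discretisation.
Context {R : realType} {d : measure_display} {Omega : measurableType d}.
Variable P : probability Omega R.
Variable X : R -> Omega -> R.
Hypothesis mX : forall t, measurable_fun setT (X t).
Local Notation F := (natural_filtration X).
Variables (T : R) (tau : Omega -> R).
Hypothesis T0 : 0 < T.
Hypothesis tauP : stopping_time F tau.
Hypothesis tauT : forall w, tau w <= T.

Definition pt (n k : nat) : R := T * k%:R / n.+1%:R.

Lemma pt_ge0 n k : 0 <= pt n k.
Proof. by rewrite divr_ge0// mulr_ge0// ltW. Qed.

Lemma pt_last n : pt n n.+1 = T.
Proof. by rewrite /pt mulfK. Qed.

Lemma pt_le n k : (k <= n.+1)%N -> pt n k <= T.
Proof. by move=> kn; rewrite -[leRHS](pt_last n) /pt ler_pM2r// ler_pM2l// ler_nat. Qed.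

Lemma ptS n k : pt n k.+1 = pt n k + T / n.+1%:R.
Proof. by rewrite /pt -(addn1 k) natrD mulrDr mulr1 mulrDl. Qed.

Lemma idx_ex n w : exists k, tau w <= pt n k.
Proof. by exists n.+1; rewrite pt_last. Qed.

(** Rounding up, not down: that [tau] is rounded to a given grid point is known at that point. *)
Definition idx n w : nat := ex_minn (idx_ex n w).

Definition tau_n n w : R := pt n (idx n w).

Lemma idx_le n w : (idx n w <= n.+1)%N.
Proof. by rewrite /idx; case: ex_minnP => m _; apply; rewrite pt_last. Qed.

Lemma tau_n_ge n w : tau w <= tau_n n w.
Proof. by rewrite /tau_n /idx; case: ex_minnP. Qed.

Lemma tau_n_le n w : tau_n n w <= T.
Proof. exact/pt_le/idx_le. Qed.

Lemma tau_n_near n w : tau_n n w <= tau w + T / n.+1%:R.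
Proof.
rewrite /tau_n /idx; case: ex_minnP => -[|m] Hm min.
  rewrite /pt mulr0 mul0r addr_ge0//; first by case: tauP.
  by rewrite divr_ge0// ltW.
rewrite ptS lerD2r leNgt; apply/negP => H.
by have := min m (ltW H); rewrite ltnn.
Qed.

Lemma tau_n_cvg w : tau_n n w @[n --> \oo] --> tau w.
Proof.
apply/cvgrPdist_lt => e e0; exists (Num.trunc (T / e)).+1 => // n /= mn.
have H : T / n.+1%:R < e.
  rewrite ltr_pdivrMr// [ltRHS]mulrC -ltr_pdivrMr//.
  apply: lt_le_trans (truncnS_gt _) _.
  by rewrite ler_nat; apply: leq_trans mn _.
have h2 : tau_n n w < tau w + e.
  by apply: le_lt_trans (tau_n_near n w) _; rewrite ltrD2l.
by have h1 := tau_n_ge n w; rewrite distrC ger0_norm; lra.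
Qed.

Lemma idx_filtration n k : F (pt n k) [set w | idx n w = k].
Proof.
have [tau0 tauF] := tauP.
case: k => [|k].
  have -> : [set w | idx n w = 0%N] = [set w | tau w <= pt n 0].
    apply/seteqP; split => w /=; rewrite /idx; case: ex_minnP => m Hm min.
      by move=> m0; rewrite m0 in Hm.
    by move=> /min; rewrite leqn0 => /eqP.
  exact: (tauF _ (pt_ge0 n 0)).
have -> : [set w | idx n w = k.+1] =
    [set w | tau w <= pt n k.+1] `&` ~` [set w | tau w <= pt n k].
  apply/seteqP; split => w /=; rewrite /idx; case: ex_minnP => m Hm min.
    by move=> mk; rewrite mk in Hm; split => // /min; rewrite mk ltnn.
  move=> [H1 H2]; apply/eqP; rewrite eqn_leq min//= ltnNge; apply/negP => mk.
  apply: H2; apply: le_trans Hm _.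
  by rewrite /pt ler_pM2r// ler_pM2l// ler_nat.
apply: filtrationI; first exact: (tauF _ (pt_ge0 n k.+1)).
have le : pt n k <= pt n k.+1 by rewrite ptS lerDl divr_ge0// ltW.
exact: (filtrationC (filtration_mono le (tauF _ (pt_ge0 n k)))).
Qed.

Lemma measurable_idx n k : measurable [set w | idx n w = k].
Proof. exact: (filtration_measurable mX (@idx_filtration n k)). Qed.

Lemma bigcup_idx n : \bigcup_k [set w | idx n w = k] = setT.
Proof. by apply/seteqP; split => // w _; exists (idx n w). Qed.

Lemma measurable_at_tau_n (phi : R -> Omega -> R) n :
  (forall t, 0 <= t -> t <= T -> measurable_fun setT (phi t)) ->
  measurable_fun setT (fun w => phi (tau_n n w) w).
Proof.
move=> mphi; rewrite -(bigcup_idx n); apply/measurable_fun_bigcup => k.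
  exact: measurable_idx.
have [kn|nk] := leqP k n.+1.
  apply: (@eq_measurable_fun _ _ _ _ _ (phi (pt n k))).
    by move=> w; rewrite inE /= /tau_n => ->.
  by apply: measurable_funTS; apply: mphi; [exact: pt_ge0|exact: pt_le].
have -> : [set w | idx n w = k] = set0; last exact: measurable_fun_set0.
by apply/seteqP; split => // w /= E; have := idx_le n w; rewrite E leqNgt nk.
Qed.

Lemma measurable_at_tau (phi : R -> Omega -> R) :
  (forall t, 0 <= t -> t <= T -> measurable_fun setT (phi t)) ->
  (forall w, phi (tau_n n w) w @[n --> \oo] --> phi (tau w) w) ->
  measurable_fun setT (fun w => phi (tau w) w).
Proof.
move=> mphi cphi.
apply: (@measurable_fun_cvg _ _ _ setT (fun n w => phi (tau_n n w) w)).
  by move=> n; exact: measurable_at_tau_n.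
by move=> w _; exact: cphi.
Qed.

Lemma Rintegral_idx (f : Omega -> R) n : P.-integrable setT (EFin \o f) ->
  (\int[P]_w f w = \sum_(k <- iota 0 n.+2) \int[P]_(w in [set w | idx n w = k]) f w)%R.
Proof.
move=> If.
have E : setT = \big[setU/set0]_(k <- iota 0 n.+2) [set w | idx n w = k].
  apply/seteqP; split => // w _; rewrite -bigcup_seq; exists (idx n w); last by [].
  have : idx n w \in iota 0 n.+2 by rewrite mem_iota add0n ltnS idx_le.
  by [].
rewrite {1}/Rintegral {1}E.
rewrite integral_bigsetU_EFin//.
- have fin k : (\int[P]_(w in [set w | idx n w = k]) (f w)%:E)%E \is a fin_num.
    apply: integrable_fin_num; first exact: measurable_idx.
    exact: (integrableS measurableT (measurable_idx n k) (@subsetT _ _) If).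
  by rewrite -sum_fine// => *; exact: fin.
- by move=> k; exact: measurable_idx.
- exact: iota_uniq.
- by apply/trivIsetP => i j _ _ ij; apply/seteqP; split => // w [/= -> /eqP]; rewrite (negbTE ij).
- by rewrite -E; exact: (measurable_int _ If).
Qed.

End discretisation.

(** * The bound for arbitrary stopping rules *)

Section stopping.
Context {R : realType} {d : measure_display} {Omega : measurableType d}.
Variable P : probability Omega R.
Variable B : R -> {RV P >-> R}.
Hypothesis HB : brownian_motion B.
Variables (T mu lam : R) (g : R -> R).
Hypothesis T0 : 0 < T.
Hypothesis mu0 : 0 <= mu.
Hypothesis lam_mu : lam = mu \/ lam = - mu.
Hypothesis hg : convex_payoff g.
Variable tau : Omega -> R.
Hypothesis tauP : stopping_rule B T tau.
Local Notation X := (fun t : R => (B t : Omega -> R)).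
Local Notation F := (natural_filtration X).
Local Notation pr := (pr P).
Local Notation Z kappa := (drifted X kappa).
Local Notation mB := (measurable_B B).
Local Notation bound := (bound B T mu).
Local Notation stop_gap := (stop_gap B T lam).
Local Notation x := (lag (Z lam) 0).
Local Notation continued := (continued B T mu lam).
Local Notation gain := (gain B T mu lam g).
Let cZ kappa w : path_continuous (Z kappa ^~ w) :=
  bm_continuous (drifted_bm_fwd HB kappa) w.

Let tauS : stopping_time F tau. Proof. by case: tauP. Qed.
Let tauT w : tau w <= T. Proof. by case: tauP. Qed.
Let tau0 w : 0 <= tau w. Proof. by case: tauS. Qed.
Let tn := tau_n tauT.
Let tn_ge n w : tau w <= tn n w. Proof. exact: tau_n_ge. Qed.
Let tn_le n w : tn n w <= T. Proof. exact: tau_n_le. Qed.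
Let tn_cvg w : tn n w @[n --> \oo] --> tau w. Proof. exact: (tau_n_cvg T0 tauS). Qed.
Let tn0 n w : 0 <= tn n w. Proof. exact: le_trans (tau0 w) (tn_ge n w). Qed.

Lemma cvg_Z_tau kappa w : Z kappa (tn n w) w @[n --> \oo] --> Z kappa (tau w) w.
Proof. exact: (@cvg_path _ (Z kappa ^~ w) (tau w) (tn ^~ w)). Qed.

Lemma cvg_stop_gap w : stop_gap (tn n w) w @[n --> \oo] --> stop_gap (tau w) w.
Proof. by apply: cvgB; [exact: cvg_cst|exact: cvg_Z_tau]. Qed.

Lemma cvg_lag w : x (tn n w) w @[n --> \oo] --> x (tau w) w.
Proof.
apply: cvgB; last exact: cvg_Z_tau.
exact: (@cvg_seg_maxl _ (Z lam ^~ w) (tau w) (tn ^~ w)).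
Qed.

Lemma measurable_stop_gap_tau : measurable_fun setT (fun w => stop_gap (tau w) w).
Proof.
apply: (measurable_at_tau mB T0 tauS (tauT := tauT) (phi := stop_gap)); last exact: cvg_stop_gap.
by move=> t t0 tT; exact: measurable_stop_gap.
Qed.

Lemma measurable_lag_tau : measurable_fun setT (fun w => x (tau w) w).
Proof.
apply: (measurable_at_tau mB T0 tauS (tauT := tauT) (phi := x)); last exact: cvg_lag.
by move=> t t0 tT; exact: measurable_lag.
Qed.

Lemma measurable_tau : measurable_fun setT tau.
Proof.
by apply: (measurable_at_tau mB T0 tauS (tauT := tauT) (phi := fun t _ => t)) => // t _ _;
  exact: measurable_cst.
Qed.

Lemma stop_gap_tau_bounds w : 0 <= stop_gap (tau w) w <= 2 * bound w.
Proof. exact: stop_gap_bounds. Qed.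

Lemma measurable_continuous (h : R -> R) (Y : Omega -> R) : convex_payoff h ->
  measurable_fun setT Y -> measurable_fun setT (fun w => h (Y w)).
Proof. by move=> hh mY; apply: measurableT_comp => //; exact: measurable_payoff. Qed.

Section bound.
Variable Q : Omega -> R.
Hypothesis mQ : measurable_fun setT Q.
Hypothesis bQ : forall w, 0 <= Q w <= 2 * bound w.
Hypothesis Q_le : forall w u, tau w <= u -> u <= T -> Q w <= continued u w.

Let gap_n n w := g (Q w) - g (stop_gap (tn n w) w).
Let gap w := g (Q w) - g (stop_gap (tau w) w).

Let m_stop n : measurable_fun setT (fun w => stop_gap (tn n w) w).
Proof.
apply: (measurable_at_tau_n mB T0 tauS tauT (phi := stop_gap)).
by move=> t t0 tT; exact: measurable_stop_gap.
Qed.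

Let b_stop n w : 0 <= stop_gap (tn n w) w <= 2 * bound w.
Proof. exact: stop_gap_bounds. Qed.

Let I_Q := integrable_payoff HB T0 hg mQ bQ.
Let I_stop n := integrable_payoff HB T0 hg (m_stop n) (b_stop n).
Let I_tau := integrable_payoff HB T0 hg measurable_stop_gap_tau stop_gap_tau_bounds.

Let I_gap_n n : P.-integrable setT (EFin \o gap_n n).
Proof. by have := integrableB measurableT I_Q (I_stop n); exact: eq_integrable. Qed.

(** Where the lag is in [J] and enough time remains, the rate [rho] applies; elsewhere [gain0] makes
    the contribution nonnegative. *)
Lemma gain_part dl J rho t A : gain dl J rho -> measurable J -> 0 <= dl -> 0 <= t ->
  t <= T -> F t A -> (forall w, A w -> tau w <= t) ->
  rho * pr (A `&` [set w | t <= T - dl /\ J (x t w)]) <=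
  (\int[P]_(w in A) (g (Q w) - g (stop_gap t w)))%R.
Proof.
move=> G mJ dl0 t0 tT FA At.
have Qc w : A w -> Q w <= continued t w by move=> /At tw; exact: Q_le.
have G0 A' : F t A' -> A' `<=` A ->
    0 <= (\int[P]_(w in A') (g (Q w) - g (stop_gap t w)))%R.
  move=> FA' A'A; have := @gain0 _ _ _ _ _ HB T mu lam g T0 mu0 lam_mu hg t A' Q t0.
  rewrite subr0 mul0r; apply => // w /A'A; exact: Qc.
have [td|dt] := leP t (T - dl); last first.
  have -> : [set w | false /\ J (x t w)] = set0 by apply/seteqP; split => // w [].
  by rewrite setI0 /pr measure0 /= mulr0; exact: G0.
have -> : [set w | true /\ J (x t w)] = x t @^-1` J.
  by apply/seteqP; split => w /=; [case|].
have mA := filtration_measurable mB FA.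
have FJ : F t (x t @^-1` J) := adapted_preimage (adapted_lag HB lam (lexx 0) t0) mJ.
have FA1 := filtrationI FA FJ; have FA2 := filtrationI FA (filtrationC FJ).
have mA1 := filtration_measurable mB FA1; have mA2 := filtration_measurable mB FA2.
have AE : A = (A `&` x t @^-1` J) `|` (A `&` ~` (x t @^-1` J)).
  by rewrite -setIUr setUv setIT.
rewrite [in leRHS]AE Rintegral_setU//; last 2 first.
- rewrite -AE; apply: (integrableS measurableT mA (@subsetT _ A)).
  have I4 := integrable_payoff HB T0 hg (measurable_stop_gap HB lam T0 t0)
    (stop_gap_bounds HB T0 mu0 lam_mu t0 tT).
  by have := integrableB measurableT I_Q I4; exact: eq_integrable.
- by apply/disj_setPS => w [[_ ?] [_]].
have L1 : rho * pr (A `&` x t @^-1` J) <=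
    (\int[P]_(w in A `&` x t @^-1` J) (g (Q w) - g (stop_gap t w)))%R.
  by apply: G => // w [] // Aw _; exact: Qc.
have L2 := G0 _ FA2 (@subIsetl _ _ _).
lra.
Qed.

Let S n dl J := [set w | tn n w <= T - dl /\ J (x (tn n w) w)].

Let mS n dl J : measurable J -> measurable (S n dl J).
Proof.
move=> mJ.
have mt : measurable_fun setT (tn n).
  apply: (measurable_at_tau_n mB T0 tauS tauT (phi := fun t _ => t)) => t _ _.
  exact: measurable_cst.
have mx : measurable_fun setT (fun w => x (tn n w) w).
  apply: (measurable_at_tau_n mB T0 tauS tauT (phi := x)) => t t0 tT.
  exact: measurable_lag.
have -> : S n dl J = (tn n @^-1` `]-oo, T - dl]%classic) `&` ((fun w => x (tn n w) w) @^-1` J).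
  by apply/seteqP; split => w /=; rewrite in_itv.
by apply: measurableI; exact: measurable_pre.
Qed.

(** Each value of the rounded rule is taken on an event of the past at that grid point, so
    [gain_part] applies value by value with the same [rho]. *)
Lemma gain_discrete n dl J rho : gain dl J rho -> measurable J -> 0 <= dl ->
  rho * pr (S n dl J) <= (\int[P]_w gap_n n w)%R.
Proof.
move=> G mJ dl0; have mSn := mS n dl mJ.
pose f w := gap_n n w - rho * \1_(S n dl J) w.
have I1 : P.-integrable setT (EFin \o (fun w => rho * \1_(S n dl J) w)).
  by have := integrableZl measurableT rho (integrable_indic P mSn); exact: eq_integrable.
have If : P.-integrable setT (EFin \o f).
  by have := integrableB measurableT (I_gap_n n) I1; exact: eq_integrable.
have E : (\int[P]_w f w)%R = (\int[P]_w gap_n n w)%R - rho * pr (S n dl J).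
  rewrite /f RintegralB// RintegralZl//; last exact: integrable_indic.
  by congr (_ - _ * _); rewrite /Rintegral integral_indic// setIT.
suff : 0 <= (\int[P]_w f w)%R by rewrite E; lra.
rewrite (Rintegral_idx mB T0 tauS tauT n If) big_seq; apply: sumr_ge0 => k.
rewrite mem_iota add0n ltnS => /andP[_ kn].
set A := [set w | _ = k].
have FA : F (pt T n k) A := @idx_filtration _ _ _ _ _ _ T0 tauS tauT n k.
have mA := filtration_measurable mB FA.
have At w : A w -> tau w <= pt T n k by move=> /= <-; exact: tn_ge.
have := gain_part G mJ dl0 (pt_ge0 T0 n k) (pt_le T0 kn) FA At.
have IA := integrableS measurableT mA (@subsetT _ A) (I_gap_n n).
have IA1 := integrableS measurableT mA (@subsetT _ A) I1.
have -> : (\int[P]_(w in A) f w = \int[P]_(w in A) gap_n n w -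
    rho * \int[P]_(w in A) \1_(S n dl J) w)%R.
  rewrite /f RintegralB//; congr (_ - _); apply: RintegralZl => //.
  exact: (integrableS measurableT mA (@subsetT _ A) (integrable_indic P mSn)).
have -> : (\int[P]_(w in A) gap_n n w =
    \int[P]_(w in A) (g (Q w) - g (stop_gap (pt T n k) w)))%R.
  by apply: eq_Rintegral => w; rewrite inE /= /gap_n /tn /tau_n => ->.
suff -> : (\int[P]_(w in A) \1_(S n dl J) w)%R =
    pr (A `&` [set w | pt T n k <= T - dl /\ J (x (pt T n k) w)]) by lra.
rewrite /Rintegral integral_indic// /pr setIC; congr (fine (P _)).
apply/seteqP; split => w [Aw]; rewrite /S /tn /tau_n /=.
  by have -> : idx tauT n w = k by exact: Aw.
by have -> : idx tauT n w = k by exact: Aw.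
Qed.

Let cvg_gap : (\int[P]_w gap_n n w)%R @[n --> \oo] --> (\int[P]_w gap w)%R.
Proof.
have [G IG HG] := payoff_dominated HB mu T0 hg.
have IG2 : P.-integrable setT (EFin \o (fun w => G w + G w)).
  by have := integrableD measurableT IG IG; exact: eq_integrable.
apply: (cvg_Rintegral _ _ _ IG2).
- move=> n; apply: measurable_funB; apply: measurable_continuous => //.
- by apply: measurable_funB; apply: measurable_continuous => //; exact: measurable_stop_gap_tau.
- move=> w; have H : g (stop_gap (tn n w) w) @[n --> \oo] --> g (stop_gap (tau w) w).
    by apply: continuous_cvg (@cvg_stop_gap w); case: hg => + _ _; exact.
  by apply: cvgB; [exact: cvg_cst|exact: H].
- move=> n w; have /andP[q0 q1] := bQ w; have /andP[s0 s1] := b_stop n w.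
  by apply: le_trans (ler_normB _ _) _; apply: lerD; exact: HG.
Qed.

Let Rintegral_gap : (\int[P]_w gap w)%R =
  (\int[P]_w g (Q w))%R - (\int[P]_w g (stop_gap (tau w) w))%R.
Proof. exact: RintegralB. Qed.

Lemma stopping_bound :
  (\int[P]_w g (stop_gap (tau w) w) <= \int[P]_w g (Q w))%R.
Proof.
rewrite -subr_ge0 -Rintegral_gap.
apply: (cvgr_to_ge (@cvg_gap)); near=> n.
have G := @gain0 _ _ _ _ _ HB T mu lam g T0 mu0 lam_mu hg.
by have := gain_discrete n G measurableT (lexx 0); rewrite mul0r.
Unshelve. all: by end_near. Qed.

(** Strict inequalities at [tau], weak ones in the gain: the open conditions pass to the rounded
    rules for large [n], which keeps more than half of the probability and hence a gain that does
    not vanish in the limit. *)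
Lemma stopping_bound_strict dl a K rho : 0 <= dl -> 0 < rho ->
  gain dl [set y | a <= y /\ y <= K] rho ->
  0 < pr [set w | tau w < T - dl /\ (a < x (tau w) w /\ x (tau w) w < K)] ->
  (\int[P]_w g (stop_gap (tau w) w) < \int[P]_w g (Q w))%R.
Proof.
move=> dl0 rho0 G; set V := [set w | _] => V0.
have mJ : measurable ([set y | a <= y /\ y <= K] : set R).
  have -> : [set y | a <= y /\ y <= K] = `[a, K]%classic.
    by apply/seteqP; split => y /=; rewrite in_itv/=; [case=> -> ->|case/andP].
  exact: measurable_itv.
have mV : measurable V.
  have -> : V = (tau @^-1` `]-oo, T - dl[%classic) `&`
      ((fun w => x (tau w) w) @^-1` `]a, K[%classic).
    apply/seteqP; split => w /=; rewrite !in_itv/=; first by case=> -> [-> ->].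
    by move=> [h1 /andP[h2 h3]].
  apply: measurableI; first by apply: measurable_pre => //; exact: measurable_tau.
  by apply: (measurable_pre measurable_lag_tau); exact: measurable_itv.
have e0 : 0 < pr V / 2 by lra.
have [||m Hm] := @pr_eventually _ _ _ P V
  (fun n => S n dl [set y | a <= y /\ y <= K]) _ mV _ _ e0.
- by move=> n; exact: mS.
- move=> w [tw [xa xK]].
  have c1 := @tn_cvg w; have c2 := @cvg_lag w.
  have [m1 _ H1] : \forall n \near \oo, tn n w < T - dl.
    by move/cvgr_lt: c1 => /(_ _ tw).
  have [m2 _ H2] : \forall n \near \oo, a < x (tn n w) w by move/cvgr_gt: c2 => /(_ _ xa).
  have [m3 _ H3] : \forall n \near \oo, x (tn n w) w < K by move/cvgr_lt: c2 => /(_ _ xK).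
  exists (maxn m1 (maxn m2 m3)) => n; rewrite !geq_max => /and3P[n1 n2 n3].
  split; first by apply: ltW; exact: (H1 n n1).
  by split; apply: ltW; [exact: (H2 n n2)|exact: (H3 n n3)].
rewrite -subr_gt0 -Rintegral_gap.
apply: (@lt_le_trans _ _ (rho * (pr V / 2))); first exact: mulr_gt0.
apply: (cvgr_to_ge (@cvg_gap)).
exists m => // n /= mn.
apply: le_trans (gain_discrete n G mJ dl0); rewrite ler_wpM2l ?(ltW rho0)//.
by have := Hm n mn; lra.
Qed.

End bound.

Lemma cvg_lag_after kappa w :
  lag (Z kappa) (tn n w) T w @[n --> \oo] --> lag (Z kappa) (tau w) T w.
Proof.
apply: cvgB; last exact: cvg_cst.
exact: (@cvg_seg_maxr _ (Z kappa ^~ w) (tau w) T (tn ^~ w)).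
Qed.

Lemma cvg_fwd_after kappa w :
  fwd_seg (Z kappa) (tn n w) T w @[n --> \oo] --> fwd_seg (Z kappa) (tau w) T w.
Proof.
apply: cvgB; last exact: cvg_Z_tau.
exact: (@cvg_seg_maxr _ (Z kappa ^~ w) (tau w) T (tn ^~ w)).
Qed.

Lemma measurable_lag_after kappa : measurable_fun setT (fun w => lag (Z kappa) (tau w) T w).
Proof.
apply: (measurable_at_tau mB T0 tauS (tauT := tauT) (phi := fun t => lag (Z kappa) t T)).
  by move=> t t0 tT; exact: measurable_lag.
exact: cvg_lag_after.
Qed.

Lemma measurable_fwd_after kappa : measurable_fun setT (fun w => fwd_seg (Z kappa) (tau w) T w).
Proof.
apply: (measurable_at_tau mB T0 tauS (tauT := tauT) (phi := fun t => fwd_seg (Z kappa) t T)).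
  by move=> t t0 tT; exact: measurable_fwd.
exact: cvg_fwd_after.
Qed.

(** [payoff_integral_eq] on each value of the rounded rule, then the limit. Being an equality, it
    shows that without drift rules stopping at the maximum are optimal. *)
Lemma seg_exchange :
  (\int[P]_w g (lag (Z mu) (tau w) T w) = \int[P]_w g (fwd_seg (Z (- mu)) (tau w) T w))%R.
Proof.
have mu_bd : `|mu| <= mu by rewrite ger0_norm.
have Nmu_bd : `|- mu| <= mu by rewrite normrN ger0_norm.
pose V1 t := lag (Z mu) t T; pose V2 t := fwd_seg (Z (- mu)) t T.
have b1 t w : 0 <= t -> t <= T -> 0 <= V1 t w <= 2 * bound w.
  move=> t0 tT; have /andP[v0 v1] := lag_bounds HB mu0 w mu_bd t0 tT (lexx T).
  by apply/andP; split => //; have := bound_ge0 HB T0 mu0 lam_mu w; rewrite /V1; lra.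
have b2 t w : 0 <= t -> t <= T -> 0 <= V2 t w <= 2 * bound w.
  move=> t0 tT; have /andP[v0 v1] := fwd_bounds HB mu0 w Nmu_bd t0 tT (lexx T).
  by apply/andP; split => //; have := bound_ge0 HB T0 mu0 lam_mu w; rewrite /V2; lra.
have m1 t : 0 <= t -> t <= T -> measurable_fun setT (V1 t) by exact: measurable_lag.
have m2 t : 0 <= t -> t <= T -> measurable_fun setT (V2 t) by exact: measurable_fwd.
have c1 w : V1 (tn n w) w @[n --> \oo] --> V1 (tau w) w by exact: cvg_lag_after.
have c2 w : V2 (tn n w) w @[n --> \oo] --> V2 (tau w) w by exact: cvg_fwd_after.
have [G IG HG] := payoff_dominated HB mu T0 hg.
have lim (V : R -> Omega -> R) :
    (forall t, 0 <= t -> t <= T -> measurable_fun setT (V t)) ->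
    (forall t w, 0 <= t -> t <= T -> 0 <= V t w <= 2 * bound w) ->
    (forall w, V (tn n w) w @[n --> \oo] --> V (tau w) w) ->
    (\int[P]_w g (V (tn n w) w))%R @[n --> \oo] --> (\int[P]_w g (V (tau w) w))%R.
  move=> mV bV cV; apply: (cvg_Rintegral _ _ _ IG).
  - move=> n; apply: measurable_continuous => //.
    exact: (measurable_at_tau_n mB T0 tauS tauT).
  - by apply: measurable_continuous => //; exact: (measurable_at_tau mB T0 tauS (tauT := tauT)).
  - by move=> w; apply: continuous_cvg (cV w); case: hg => + _ _; exact.
  - by move=> n w; have /andP[? ?] := bV _ w (tn0 n w) (tn_le n w); exact: HG.
have L1 := lim V1 m1 b1 c1; have L2 := lim V2 m2 b2 c2.
have E : (fun n => (\int[P]_w g (V1 (tn n w) w))%R) =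
         (fun n => (\int[P]_w g (V2 (tn n w) w))%R).
  apply/funext => n.
  have I (V : R -> Omega -> R) :
      (forall t, 0 <= t -> t <= T -> measurable_fun setT (V t)) ->
      (forall t w, 0 <= t -> t <= T -> 0 <= V t w <= 2 * bound w) ->
      P.-integrable setT (EFin \o (fun w => g (V (tn n w) w))).
    move=> mV bV; apply: (@integrable_payoff _ _ _ _ _ HB T mu g T0 hg (fun w => V (tn n w) w)).
      exact: (measurable_at_tau_n mB T0 tauS tauT).
    by move=> w; exact: bV.
  rewrite (Rintegral_idx mB T0 tauS tauT n (I V1 m1 b1)).
  rewrite (Rintegral_idx mB T0 tauS tauT n (I V2 m2 b2)).
  rewrite big_seq [RHS]big_seq; apply: eq_bigr => k.
  rewrite mem_iota add0n ltnS => /andP[_ kn].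
  set A := [set w | _ = k].
  have FA : F (pt T n k) A := @idx_filtration _ _ _ _ _ _ T0 tauS tauT n k.
  transitivity (\int[P]_(w in A) g (V1 (pt T n k) w))%R.
    by apply: eq_Rintegral => w; rewrite inE /= /tn /tau_n => ->.
  transitivity (\int[P]_(w in A) g (V2 (pt T n k) w))%R.
    exact: (payoff_integral_eq HB T0 mu0 lam_mu hg (pt_ge0 T0 n k) (pt_le T0 kn) FA).
  by apply: eq_Rintegral => w; rewrite inE /= /tn /tau_n => ->.
rewrite E in L1.
exact: (cvg_unique _ L1 L2).
Qed.

End stopping.

Lemma invS_le (R : realType) (m n : nat) : (m <= n)%N -> n.+1%:R^-1 <= m.+1%:R^-1 :> R.
Proof. by move=> mn; rewrite lef_pV2 ?posrE ?ltr0n// ler_nat. Qed.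

Lemma invS_lt (R : realType) (y : R) : 0 < y ->
  exists m, forall n, (m <= n)%N -> n.+1%:R^-1 < y.
Proof.
move=> y0; have [m] := ltr_add_invr (y := 0) y0; rewrite add0r => H.
by exists m => n mn; apply: le_lt_trans H; exact: invS_le.
Qed.

(** * The final lag as benchmark; stopping exactly at the overall maximum *)

Section value.
Context {R : realType} {d : measure_display} {Omega : measurableType d}.
Variable P : probability Omega R.
Variable B : R -> {RV P >-> R}.
Hypothesis HB : brownian_motion B.
Variables (T mu lam : R).
Hypothesis T0 : 0 < T.
Hypothesis mu0 : 0 <= mu.
Hypothesis lam_mu : lam = mu \/ lam = - mu.
Local Notation X := (fun t : R => (B t : Omega -> R)).
Local Notation pr := (pr P).
Local Notation Z kappa := (drifted X kappa).
Local Notation bound := (bound B T mu).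
Local Notation stop_gap := (stop_gap B T lam).
Local Notation x := (lag (Z lam) 0).
Local Notation continued := (continued B T mu lam).
Let cZ kappa w : path_continuous (Z kappa ^~ w) := bm_continuous (drifted_bm_fwd HB kappa) w.
Let T0' : 0 <= T. Proof. exact: ltW. Qed.
Let mu_bd : `|mu| <= mu. Proof. by rewrite ger0_norm. Qed.
Let lam_le : lam <= mu. Proof. by case: lam_mu => -> //; move: mu0; lra. Qed.

Lemma Rintegral_indic E : measurable E -> (\int[P]_w (\1_E w : R))%R = pr E.
Proof.
by move=> mE; rewrite /Rintegral integral_indic// setIT.
Qed.

Lemma lag_shift t w : 0 <= t ->
  exists u, [/\ 0 <= u, u <= t, lag (Z mu) 0 t w = Z mu u w - Z mu t w &
    lag (Z mu) 0 t w + (mu - lam) * (t - u) <= x t w].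
Proof.
move=> t0; have [u [u0 ut E _]] := seg_max_attained (cZ mu w) (lexx 0) t0.
exists u; split => //; first by rewrite /lag -E.
have := seg_max_ub (cZ lam w) (lexx 0) u0 ut.
by rewrite /lag -E /=; set S := seg_max _ _ _; rewrite /drifted; lra.
Qed.

Lemma lag_le t w : 0 <= t -> lag (Z mu) 0 t w <= x t w.
Proof.
move=> t0; have [u [u0 ut _]] := lag_shift w t0.
by apply: le_trans; rewrite lerDl mulr_ge0 ?subr_ge0.
Qed.

(** A positive lag puts the maximiser [u] of [lag_shift] strictly before [t], so the correction is
    positive. *)
Lemma lag_gap t w : lam < mu -> 0 <= t -> 0 < lag (Z mu) 0 t w -> lag (Z mu) 0 t w < x t w.
Proof.
move=> lm t0; have [u [u0 ut E H]] := lag_shift w t0.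
move: ut; rewrite le_eqVlt => /orP[/eqP ut|ut _].
  by rewrite E ut subrr ltxx.
by apply: lt_le_trans H; rewrite ltrDl mulr_gt0 ?subr_gt0.
Qed.

Definition late_gap (w : Omega) : R := lag (Z mu) 0 T w.

Lemma measurable_late_gap : measurable_fun setT late_gap.
Proof. exact: (measurable_lag HB). Qed.

Lemma late_gap_bounds w : 0 <= late_gap w <= 2 * bound w.
Proof.
have /andP[a b] := lag_bounds HB mu0 w mu_bd (lexx 0) T0' (lexx T).
by apply/andP; split => //; have := bound_ge0 HB T0 mu0 lam_mu w; rewrite /late_gap; lra.
Qed.

Lemma late_gap_split u w : 0 <= u -> u <= T -> late_gap w =
  Num.max (lag (Z mu) 0 u w) (fwd_seg (Z mu) u T w) - (Z mu T w - Z mu u w).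
Proof.
move=> u0 uT; rewrite /late_gap /lag /fwd_seg (seg_max_split (cZ mu w) (lexx 0) u0 uT).
by rewrite -addr_maxl; set S := Num.max _ _; lra.
Qed.

(** The two paths have the same increments after [u], and at [u] the one with drift [lam] has the
    larger lag. So [late_gap] is a competitor for every rule. *)
Lemma late_gap_le u w : 0 <= u -> u <= T -> late_gap w <= continued u w.
Proof.
move=> u0 uT; rewrite (late_gap_split w u0 uT) /continued lerD2r.
by apply: le_max2 => //; exact: lag_le.
Qed.

Lemma pr_lag_zero kappa t : 0 < t -> pr [set w | lag (Z kappa) 0 t w <= 0] = 0.
Proof.
by move=> t0; rewrite lagE; exact: (pr_bwd_zero HB (drifted_bmN (drifted_bm_fwd HB kappa)) t0).
Qed.

Section rule.
Variable tau : Omega -> R.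
Hypothesis tauP : stopping_rule B T tau.
Let tau0 w : 0 <= tau w. Proof. by case: tauP => -[]. Qed.
Let m_tau := measurable_stop_gap_tau HB lam T0 tauP.
Let b_tau := stop_gap_tau_bounds HB T0 mu0 lam_mu tauP.

Let late_le w u : tau w <= u -> u <= T -> late_gap w <= continued u w.
Proof. by move=> u1 u2; apply: late_gap_le => //; exact: le_trans u1. Qed.

Lemma pr_stop_gap_zero : pr [set w | stop_gap (tau w) w <= 0] = 0.
Proof.
have mS : measurable [set w | stop_gap (tau w) w <= 0].
  by have := @measurable_pre _ _ _ _ _ m_tau (@measurable_itv _ `]-oo, 0]); rewrite set_itvNyc.
pose G n := [set w | late_gap w <= n.+1%:R^-1].
have mG n : measurable (G n).
  have := @measurable_pre _ _ _ _ _ measurable_late_gap (@measurable_itv _ `]-oo, n.+1%:R^-1]).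
  by rewrite set_itvNyc.
(* The cutoff payoff is 1 at gap 0 and vanishes beyond its width, so the bound for it compares these
   two probabilities. *)
have step n : pr [set w | stop_gap (tau w) w <= 0] <= pr (G n).
  have e0 : 0 < n.+1%:R^-1 :> R by rewrite invr_gt0.
  have hc := convex_payoff_cutoff e0.
  apply: le_trans (_ : _ <= \int[P]_w cutoff n.+1%:R^-1 (stop_gap (tau w) w))%R _.
    rewrite -Rintegral_indic//; apply: le_Rintegral => //.
    - exact: integrable_indic.
    - exact: (integrable_payoff HB T0 hc m_tau b_tau).
    - move=> w _; rewrite indicE; case: (boolP (_ \in _)) => [|_]; last exact: cutoff_ge0.
      rewrite inE /= => H; rewrite (_ : stop_gap _ _ = 0) ?cutoff0//.
      by apply/eqP; rewrite eq_le H; have /andP[] := b_tau w.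
  apply: le_trans (stopping_bound HB T0 mu0 lam_mu hc tauP measurable_late_gap
    late_gap_bounds late_le) _.
  rewrite -Rintegral_indic//; apply: le_Rintegral => //.
  - exact: (integrable_payoff HB T0 hc measurable_late_gap late_gap_bounds).
  - exact: integrable_indic.
  - move=> w _; have /andP[l0 _] := late_gap_bounds w; rewrite indicE.
    case: (boolP (_ \in _)) => [_|]; first exact: cutoff_le1.
    by rewrite notin_setE /G /= => /negP; rewrite -ltNge => /ltW H; rewrite cutoff_out.
have G_dec m n : (m <= n)%N -> G n `<=` G m.
  by move=> mn w; rewrite /G/= => /le_trans; apply; exact: invS_le.
have L := pr_decreasing (P := P) measurableT mG G_dec.
have G0 : pr (setT `&` \bigcap_n G n) = 0.
  rewrite setTI -[RHS](pr_lag_zero mu T0); congr (pr _); apply/seteqP; split => w /=.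
    move=> H; rewrite leNgt; apply/negP => l0.
    have [n /(_ n (leqnn n)) Hn] := invS_lt l0.
    by have := le_lt_trans (H n I) Hn; rewrite ltxx.
  by move=> H n _ /=; apply: le_trans H _; rewrite invr_ge0.
rewrite G0 in L; apply/eqP; rewrite eq_le pr_ge0 andbT.
apply: (ler_cvg_to (cvg_cst _) L).
by apply: nearW => n; rewrite setTI; exact (step n).
Qed.
End rule.
End value.

(** * The value of the problem *)

Section optimality.
Context {R : realType} {d : measure_display} {Omega : measurableType d}.
Variable P : probability Omega R.
Variable B : R -> {RV P >-> R}.
Hypothesis HB : brownian_motion B.
Variables (T mu lam : R).
Hypothesis T0 : 0 < T.
Hypothesis mu0 : 0 <= mu.
Hypothesis lam_mu : lam = mu \/ lam = - mu.
Variable f : R -> R.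
Hypothesis f_noninc : {in `[0, +oo[ &, nonincreasing_fun f}.
Hypothesis f_convex : convex_function (`[0, +oo[ : set R^o) f.
Local Notation X := (fun t : R => (B t : Omega -> R)).
Local Notation pr := (pr P).
Local Notation bound := (bound B T mu).
Local Notation stop_gap := (stop_gap B T lam).
Local Notation continued := (continued B T mu lam).
Local Notation g := (regularize f).
Local Notation late_gap := (late_gap B T mu).
Let hg : convex_payoff g := convex_payoff_regularize f_noninc f_convex.
Let T0' : 0 <= T. Proof. exact: ltW. Qed.
Let late_le u w : 0 <= u -> u <= T -> late_gap w <= continued u w.
Proof. exact: late_gap_le. Qed.
Local Notation reward tau := (\int[P]_w g (stop_gap (tau w) w))%R.
Local Notation v := (\int[P]_w g (late_gap w))%R.

Lemma ae_pr0 (S : set Omega) : measurable S -> pr S = 0 -> {ae P, forall w, ~ S w}.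
Proof.
move=> mS S0; exists S; split => //; first by rewrite (prE P mS) S0.
by move=> w /=; apply: contrapT.
Qed.

Lemma measurable_nonincreasing (h : R -> R) (Y : Omega -> R) :
  {in `[0, +oo[ &, nonincreasing_fun h} -> measurable_fun setT Y ->
  (forall w, 0 <= Y w) -> measurable_fun setT (fun w => h (Y w)).
Proof.
move=> hni mY Y0; pose h1 y := h (Num.max 0 y).
have -> : (fun w => h (Y w)) = h1 \o Y.
  by apply/funext => w /=; rewrite /h1 max_r.
apply: measurableT_comp => //.
apply: nonincreasing_measurable => //= a b ab.
by apply: hni; rewrite ?in_itv/= ?andbT; [rewrite le_max lexx.. | exact: le_max2].
Qed.

(** The gap is almost surely positive, so [f] and its continuous version have the same
    expectation. *)
Lemma payoffE tau : stopping_rule B T tau -> payoff B lam T f tau = (reward tau)%:E.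
Proof.
move=> tauP; have m_tau := measurable_stop_gap_tau HB lam T0 tauP.
have b_tau := stop_gap_tau_bounds HB T0 mu0 lam_mu tauP.
have mg := measurable_continuous hg m_tau.
have Ig := integrable_payoff HB T0 hg m_tau b_tau.
have mf : measurable_fun setT (fun w => f (stop_gap (tau w) w)).
  by apply: measurable_nonincreasing => // w; have /andP[] := b_tau w.
rewrite /Rintegral fineK; last exact: integrable_fin_num Ig.
rewrite /payoff unlock; apply: ae_eq_integral => //.
- by apply/measurable_EFinP.
- by apply/measurable_EFinP.
have mS : measurable [set w | stop_gap (tau w) w <= 0].
  by have := @measurable_pre _ _ _ _ _ m_tau (@measurable_itv _ `]-oo, 0]); rewrite set_itvNyc.
have := ae_pr0 mS (pr_stop_gap_zero HB T0 mu0 lam_mu tauP).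
apply: filterS => w /= /negP; rewrite -ltNge => H _ /=.
by rewrite regularize_pos.
Qed.

Lemma stopping_rule_cst c : 0 <= c -> c <= T -> stopping_rule B T (cst c).
Proof.
move=> c0 cT; split => //; split => // t t0.
have [ct|ct] := leP c t.
  rewrite (_ : [set _ | _] = setT); last by apply/seteqP; split.
  exact: (@filtrationT _ _ _ X t).
rewrite (_ : [set _ | _] = set0); last first.
  by apply/seteqP; split => // w /=; rewrite leNgt ct.
by rewrite -setCT; apply: filtrationC; exact: (@filtrationT _ _ _ X t).
Qed.

Lemma reward_le tau : stopping_rule B T tau -> reward tau <= v.
Proof.
move=> tauP; apply: (stopping_bound HB T0 mu0 lam_mu hg tauP).
- exact: measurable_late_gap.
- exact: (late_gap_bounds HB T0 mu0 lam_mu).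
- by move=> w u u1 u2; apply: late_le => //; apply: le_trans u1; case: tauP => -[? _] _.
Qed.

Lemma reward_end : lam = mu -> reward (cst T) = v.
Proof.
by move=> lm; apply: eq_Rintegral => w _; rewrite /late_gap -lm.
Qed.

Lemma reward_start : lam = - mu -> reward (cst 0) = v.
Proof.
move=> lm.
have := payoff_integral_eq HB T0 mu0 lam_mu hg (lexx 0) T0' (@filtrationT _ _ _ X 0).
by move=> ->; apply: eq_Rintegral => w _; rewrite -lm.
Qed.

Lemma optimal_ruleE tau : optimal_rule B lam T f tau <->
  stopping_rule B T tau /\ reward tau = v.
Proof.
have sup_v : ereal_sup (payoff B lam T f @` stopping_rule B T) = v%:E.
  have [s sP sv] : exists2 s, stopping_rule B T s & reward s = v.
    case: lam_mu => H; last by exists (cst 0); [exact: stopping_rule_cst|exact: reward_start].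
    by exists (cst T); [exact: stopping_rule_cst|exact: reward_end].
  apply/eqP; rewrite eq_le; apply/andP; split.
    apply: ge_ereal_sup => _ [t tP <-].
    by rewrite payoffE// lee_fin reward_le.
  by apply: ereal_sup_ubound; exists s => //; rewrite payoffE// sv.
split=> -[tauP H]; split => //.
  by move: H; rewrite payoffE// sup_v => -[].
by rewrite sup_v payoffE// H.
Qed.

End optimality.

(** * Rules that miss the value and rules that reach it *)

Section comparison.
Context {R : realType} {d : measure_display} {Omega : measurableType d}.
Variable P : probability Omega R.
Variable B : R -> {RV P >-> R}.
Hypothesis HB : brownian_motion B.
Variables (T mu lam : R) (g : R -> R).
Hypothesis T0 : 0 < T.
Hypothesis mu0 : 0 <= mu.
Hypothesis lam_mu : lam = mu \/ lam = - mu.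
Hypothesis hg : convex_payoff g.
Variable tau : Omega -> R.
Hypothesis tauP : stopping_rule B T tau.
Local Notation X := (fun t : R => (B t : Omega -> R)).
Local Notation F := (natural_filtration X).
Local Notation pr := (pr P).
Local Notation Z kappa := (drifted X kappa).
Local Notation bound := (bound B T mu).
Local Notation stop_gap := (stop_gap B T lam).
Local Notation x := (lag (Z lam) 0).
Local Notation continued := (continued B T mu lam).
Local Notation late_gap := (late_gap B T mu).
Local Notation reward := (\int[P]_w g (stop_gap (tau w) w))%R.
Local Notation v := (\int[P]_w g (late_gap w))%R.
Let cZ kappa w : path_continuous (Z kappa ^~ w) := bm_continuous (drifted_bm_fwd HB kappa) w.
Let lam_bd : `|lam| <= mu.
Proof. by case: lam_mu => ->; rewrite ?normrN ger0_norm. Qed.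
Let tauS : stopping_time F tau. Proof. by case: tauP. Qed.
Let tau0 w : 0 <= tau w. Proof. by case: tauS. Qed.
Let tauT w : tau w <= T. Proof. by case: tauP. Qed.
Let m_tau := measurable_tau T0 tauP.
Let m_x := measurable_lag_tau HB lam T0 tauP.
Let m_late : measurable_fun setT late_gap := measurable_late_gap HB mu T0.
Let b_late := late_gap_bounds HB T0 mu0 lam_mu.

(** Exhaustion: every [w] in [N] eventually satisfies the restrictions on remaining time, small lags
    and large lags in [G n], so some [G n] has positive probability, and a single gain decides. *)
Lemma reward_lt (a : nat -> R) (N : set Omega) : measurable N ->
  (forall w, N w -> tau w < T /\ exists m, forall n, (m <= n)%N -> a n < x (tau w) w) ->
  (forall n, exists2 rho, 0 < rho &
    gain B T mu lam g n.+1%:R^-1 [set y | a n <= y /\ y <= n.+1%:R] rho) ->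
  0 < pr N -> reward < v.
Proof.
move=> mN HN Hg prN.
pose G n := [set w | tau w < T - n.+1%:R^-1 /\ (a n < x (tau w) w /\ x (tau w) w < n.+1%:R)].
have mG n : measurable (G n).
  have -> : G n = tau @^-1` `]-oo, T - n.+1%:R^-1[ `&` (fun w => x (tau w) w) @^-1` `]a n, n.+1%:R[.
    by apply/seteqP; split => w /=; rewrite !in_itv/= => -[? /andP].
  by apply: measurableI; apply: measurable_pre.
have [||||m Hm] := @pr_eventually _ _ _ P N G (pr N); rewrite //.
  move=> w /HN[tT [m Hm]].
  have sT : 0 < T - tau w by rewrite subr_gt0.
  have [m1 H1] := invS_lt sT.
  pose m2 := Num.truncn `|x (tau w) w|.
  exists (maxn m (maxn m1 m2)) => n; rewrite !geq_max => /and3P[mn m1n m2n]; split.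
    by rewrite ltrBrDr -ltrBrDl; exact: H1.
  split; first exact: Hm.
  apply: le_lt_trans (ler_norm _) _; apply: lt_le_trans (truncnS_gt _) _.
  by rewrite ler_nat ltnS.
have := Hm m (leqnn m); rewrite subrr => prG.
have [rho rho0 Hrho] := Hg m.
apply: (stopping_bound_strict HB T0 mu0 lam_mu hg tauP m_late b_late _ _ rho0 Hrho prG).
- by move=> w u u1 u2; apply: late_gap_le => //; exact: le_trans u1.
- by rewrite invr_ge0.
Qed.

(** Relative to the endpoint at [T], keeping the smaller drift on [t, u] does not lower any point
    before [u] and leaves later points alone, so the maximum can only rise. *)
Lemma continued_mono t u w : 0 <= t -> t <= u -> u <= T -> continued t w <= continued u w.
Proof.
move=> t0 tu uT; have u0 := le_trans t0 tu; have tT := le_trans tu uT.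
have lm : lam <= mu by case: lam_mu => -> //; move: mu0; lra.
have H s : 0 <= s -> s <= u -> Z mu s w - Z mu u w <= x u w.
  move=> s0 su; have := seg_max_ub (cZ lam w) (lexx 0) s0 su.
  rewrite /lag; set S := seg_max _ _ _.
  have : (mu - lam) * s <= (mu - lam) * u by rewrite ler_wpM2l// subr_ge0.
  by rewrite /drifted; lra.
have c1 : x u w - (Z mu T w - Z mu u w) <= continued u w by rewrite lerD2r le_max lexx.
have c2 : fwd_seg (Z mu) u T w - (Z mu T w - Z mu u w) <= continued u w.
  by rewrite lerD2r le_max lexx orbT.
rewrite {1}/continued lerBlDr ge_max; apply/andP; split.
  apply: (@le_trans _ _ (x u w + Z mu u w - Z mu t w)); last by lra.
  have [s [s0 st E _]] := seg_max_attained (cZ lam w) (lexx 0) t0.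
  have := seg_max_ub (cZ lam w) (lexx 0) s0 (le_trans st tu).
  rewrite /lag -E; set S := seg_max _ _ _.
  have : (mu - lam) * t <= (mu - lam) * u by rewrite ler_wpM2l// subr_ge0.
  by rewrite /drifted; lra.
suff : seg_max (Z mu ^~ w) t T <= continued u w + Z mu T w by rewrite /fwd_seg; lra.
apply: seg_max_le => // s ts sT; have [su|us] := leP s u.
  by have := H s (le_trans t0 ts) su; lra.
have := seg_max_ub (cZ mu w) u0 (ltW us) sT.
by move: c2; rewrite {1}/fwd_seg; lra.
Qed.

Lemma x_tau_ge0 w : 0 <= x (tau w) w.
Proof. by have /andP[] := lag_bounds HB mu0 w lam_bd (lexx 0) (tau0 w) (tauT w). Qed.

Definition early : set Omega := [set w | 0 < x (tau w) w /\ tau w < T].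

Lemma measurable_early : measurable early.
Proof.
have -> : early = (fun w => x (tau w) w) @^-1` `]0, +oo[ `&` tau @^-1` `]-oo, T[.
  by apply/seteqP; split => w /=; rewrite !in_itv/= andbT.
by apply: measurableI; apply: measurable_pre.
Qed.

Lemma stops_at_max_or_endE : stops_at_max_or_end B lam T tau <-> pr early = 0.
Proof.
have E : [set w | Z lam (tau w) w = running_max (Z lam) (tau w) w \/ tau w = T] = ~` early.
  apply/seteqP; split => w /=.
    by case=> H [x0 tT]; [move: x0; rewrite /lag H subrr ltxx|move: tT; rewrite H ltxx].
  move=> /not_andP[/negP|/negP]; rewrite -leNgt => H; [left|right].
    have : x (tau w) w = 0 by apply/eqP; rewrite eq_le H x_tau_ge0.
    by rewrite /lag => /eqP; rewrite subr_eq0 => /eqP.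
  by apply/eqP; rewrite eq_le H tauT.
have me := measurable_early.
rewrite /stops_at_max_or_end E prE ?pr_setC//; last exact: measurableC.
by split => [[]|->]; [lra|rewrite subr0].
Qed.

(** Outside [early] either the current value is the past maximum or no time is left. In both cases
    the payoffs of the final lag and of stopping differ exactly as those of lag and forward maximum
    after [tau], whose expectations agree by [seg_exchange]. *)
Lemma reward_max_or_end : lam = mu -> - mu = lam -> pr early = 0 -> reward = v.
Proof.
move=> lm ml early0.
have lm' : lam = - mu by [].
pose V1 w := lag (Z lam) (tau w) T w; pose V2 w := fwd_seg (Z lam) (tau w) T w.
have pad (Y : Omega -> R) : (forall w, 0 <= Y w <= bound w) -> forall w, 0 <= Y w <= 2 * bound w.
  move=> H w; have /andP[a b] := H w; apply/andP; split => //.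
  by have := bound_ge0 HB T0 mu0 lam_mu w; lra.
have I1 : P.-integrable setT (EFin \o (g \o V1)).
  apply: (@integrable_payoff _ _ _ _ _ HB T mu); rewrite //; first exact: measurable_lag_after.
  by apply: pad => w; exact: lag_bounds.
have I2 : P.-integrable setT (EFin \o (g \o V2)).
  apply: (@integrable_payoff _ _ _ _ _ HB T mu); rewrite //; first exact: measurable_fwd_after.
  by apply: pad => w; exact: fwd_bounds.
have I3 := integrable_payoff HB T0 hg m_late b_late.
have m_gap := measurable_stop_gap_tau HB lam T0 tauP.
have I4 := integrable_payoff HB T0 hg m_gap (stop_gap_tau_bounds HB T0 mu0 lam_mu tauP).
have mg (Y : Omega -> R) : measurable_fun setT Y -> measurable_fun setT (fun w => g (Y w)).
  by move=> mY; apply: measurable_continuous hg mY.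
suff : v - reward = (\int[P]_w g (V1 w) - \int[P]_w g (V2 w))%R.
  have -> : (\int[P]_w g (V1 w))%R = (\int[P]_w g (V2 w))%R.
    have := seg_exchange HB T0 mu0 lam_mu hg tauP; rewrite ml.
    by rewrite -[X in Z X]lm.
  by rewrite subrr => /eqP; rewrite subr_eq0 => /eqP.
rewrite -!RintegralB//; congr fine; apply: ae_eq_integral => //.
- by apply/measurable_EFinP; apply: measurable_funB; exact: mg.
- apply/measurable_EFinP; apply: measurable_funB; apply: mg.
    exact: measurable_lag_after.
  exact: measurable_fwd_after.
apply: filterS (ae_pr0 measurable_early early0) => w ne _ /=; congr (_%:E).
have lE : late_gap w = lag (Z lam) 0 T w by rewrite /late_gap lm.
rewrite lE; have [tT|nT] := eqVneq (tau w) T.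
  by rewrite /V1 /V2 tT /stop_gap /lag /fwd_seg !subrr.
have ltT : tau w < T by rewrite lt_neqAle nT tauT.
have x0 : x (tau w) w <= 0 by rewrite leNgt; apply/negP => H; exact: ne.
have -> : stop_gap (tau w) w = V2 w.
  rewrite stop_gapE// max_r//; apply: le_trans x0 _.
  by have /andP[] := fwd_bounds HB mu0 w lam_bd (tau0 w) (tauT w) (lexx T).
suff -> : lag (Z lam) 0 T w = V1 w by [].
rewrite /V1 /lag (seg_max_split (cZ lam w) (lexx 0) (tau0 w) (tauT w)) max_r//.
apply: le_trans (seg_max_ub (cZ lam w) (tau0 w) (lexx _) (tauT w)).
by move: x0; rewrite /lag subr_le0.
Qed.

End comparison.

(** * Negative drift: the improved bound *)

Section late_start.
Context {R : realType} {d : measure_display} {Omega : measurableType d}.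
Variable P : probability Omega R.
Variable B : R -> {RV P >-> R}.
Hypothesis HB : brownian_motion B.
Variables (T mu lam : R) (g : R -> R).
Hypothesis T0 : 0 < T.
Hypothesis mu0 : 0 <= mu.
Hypothesis lam_mu : lam = mu \/ lam = - mu.
Hypothesis hg : convex_payoff g.
Variable tau : Omega -> R.
Hypothesis tauP : stopping_rule B T tau.
Hypothesis lam_lt : lam < mu.
Local Notation X := (fun t : R => (B t : Omega -> R)).
Local Notation F := (natural_filtration X).
Local Notation pr := (pr P).
Local Notation Z kappa := (drifted X kappa).
Local Notation mB := (measurable_B B).
Local Notation bound := (bound B T mu).
Local Notation stop_gap := (stop_gap B T lam).
Local Notation x := (lag (Z lam) 0).
Local Notation x' := (lag (Z mu) 0).
Local Notation continued := (continued B T mu lam).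
Local Notation late_gap := (late_gap B T mu).
Local Notation reward := (\int[P]_w g (stop_gap (tau w) w))%R.
Local Notation v := (\int[P]_w g (late_gap w))%R.
Let cZ kappa w : path_continuous (Z kappa ^~ w) := bm_continuous (drifted_bm_fwd HB kappa) w.
Let T0' : 0 <= T. Proof. exact: ltW. Qed.
Let mu_bd : `|mu| <= mu. Proof. by rewrite ger0_norm. Qed.
Let lam_bd : `|lam| <= mu.
Proof. by case: lam_mu => ->; rewrite ?normrN ger0_norm. Qed.
Let tauS : stopping_time F tau. Proof. by case: tauP. Qed.
Let tau0 w : 0 <= tau w. Proof. by case: tauS. Qed.
Let m_late : measurable_fun setT late_gap := measurable_late_gap HB mu T0.
Let b_late := late_gap_bounds HB T0 mu0 lam_mu.
Let after t : set Omega := [set w | t < tau w].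

Let F_after t : 0 <= t -> F t (after t).
Proof.
move=> t0; have -> : after t = ~` [set w | tau w <= t].
  by apply/seteqP; split => w /=; rewrite /after/= ltNge => /negP.
by apply: filtrationC; case: tauS => _; exact.
Qed.

Let m_after t : 0 <= t -> measurable (after t).
Proof. by move=> t0; exact: (filtration_measurable mB (F_after t0)). Qed.

Lemma cvg_lag0 w (un : nat -> R) : (forall n, 0 <= un n) -> un n @[n --> \oo] --> 0 ->
  x (un n) w @[n --> \oo] --> 0.
Proof.
move=> u0 uc; have c1 := @cvg_path _ (Z lam ^~ w) 0 un (cZ lam w) (lexx 0) u0 uc.
have c2 := @cvg_seg_maxl _ (Z lam ^~ w) 0 un (cZ lam w) (lexx 0) u0 uc.
have := cvgB c2 c1; suff -> : seg_max (Z lam ^~ w) 0 0 = Z lam 0 w by rewrite subrr; apply.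
have [u [u0' u1 E _]] := seg_max_attained (cZ lam w) (lexx 0) (lexx 0).
by rewrite -E (_ : u = 0)//; apply/eqP; rewrite eq_le u0' u1.
Qed.

(* [x - x'] is positive a.s. at every time [t > 0] because the process with the larger drift
   a.s. does not attain its maximum over [0, t] at time t. *)
Lemma late_start_event p : 0 < p -> 0 < pr (after 0) ->
  exists t theta, [/\ 0 <= t, t <= T, 0 < theta &
    0 < pr (after t `&` [set w | x t w < p /\ theta <= x t w - x' t w])].
Proof.
move=> p0 pr0.
pose tn n := T * n.+1%:R^-1.
have tn0 n : 0 < tn n by rewrite mulr_gt0// invr_gt0.
have tn0' n : 0 <= tn n by exact: ltW.
have tnT n : tn n <= T by rewrite ler_piMr// invf_le1// ler1n.
have tnc : tn n @[n --> \oo] --> 0.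
  rewrite -(mulr0 T); apply: cvgM; first exact: cvg_cst.
  exact: cvg_harmonic.
have mlt kappa t c : 0 <= t -> measurable [set w | lag (Z kappa) 0 t w < c].
  move=> t0; have -> : [set w | lag (Z kappa) 0 t w < c] = lag (Z kappa) 0 t @^-1` `]-oo, c[.
    by apply/seteqP; split => w /=; rewrite in_itv.
  by apply: measurable_pre => //; exact: measurable_lag.
pose G1 n := after (tn n) `&` [set w | x (tn n) w < p].
have mG1 n : measurable (G1 n) by apply: measurableI; [exact: m_after|exact: mlt].
have [||||m Hm] := @pr_eventually _ _ _ P (after 0) G1 (pr (after 0)); rewrite //.
- exact: m_after.
- move=> w; rewrite /after/= => tw.
  have xc := @cvg_lag0 w tn tn0' tnc.
  have : \forall n \near \oo, tn n < tau w /\ x (tn n) w < p.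
    have c1 : \forall n \near \oo, tn n < tau w by exact: (cvgr_lt _ tnc).
    have c2 : \forall n \near \oo, x (tn n) w < p by exact: (cvgr_lt _ xc).
    by near=> n; split; near: n.
  by case=> m _ Hm; exists m => n mn; exact: Hm.
set t := tn m; have t0 : 0 < t by exact: tn0.
have := Hm m (leqnn m); rewrite subrr => prG.
pose G2 n := after t `&` [set w | x t w < p /\ n.+1%:R^-1 <= x t w - x' t w].
have mG2 n : measurable (G2 n).
  have -> : G2 n = G1 m `&` (fun w => x t w - x' t w) @^-1` `[n.+1%:R^-1, +oo[.
    by apply/seteqP; split => w /=; rewrite in_itv/= andbT; rewrite /G2/G1/=; tauto.
  apply: measurableI => //; apply: measurable_pre => //.
  by apply: measurable_funB; exact: measurable_lag (lexx 0) (ltW t0).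
pose N := [set w | x' t w <= 0].
have mN : measurable N.
  have -> : N = x' t @^-1` `]-oo, 0] by apply/seteqP; split => w /=; rewrite in_itv.
  by apply: measurable_pre => //; exact: measurable_lag (lexx 0) (ltW t0).
have prN : pr N = 0 by exact: pr_lag_zero.
have prG' : 0 < pr (G1 m `&` ~` N).
  have := pr_setID P (mG1 m) mN.
  have : pr (G1 m `&` N) <= pr N.
    by apply: pr_mono => //; exact: measurableI.
  by rewrite prN; have := pr_ge0 P (G1 m `&` N); lra.
have [|||k Hk] := @pr_eventually _ _ _ P (G1 m `&` ~` N) G2 _ _ _ _ prG'; rewrite //.
- by apply: measurableI => //; exact: measurableC.
- move=> w [[aw xw]]; rewrite /N /= => /negP; rewrite -ltNge => x'0.
  have : 0 < x t w - x' t w by rewrite subr_gt0; apply: lag_gap => //; exact: ltW.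
  by move=> /invS_lt[k Hk]; exists k => n kn; split => //; split => //; apply/ltW/Hk.
exists t, k.+1%:R^-1; split => //; [exact: ltW|exact: tnT|].
by have := Hk k (leqnn k); rewrite subrr.
Unshelve. all: by end_near. Qed.

(** The competitor [Q] switches to drift [mu] at [t] on [A], where the rule is still running, and at
    0 elsewhere; [continued_mono] makes it admissible. On a tube after [t] it exceeds [late_gap] by
    at least [th / 2] while staying at most [p], where the slope of the payoff is at most
    [rslope g p]. *)
Lemma reward_lt_start : nonconstant_on `]0, +oo[ g -> 0 < pr [set w | 0 < tau w] ->
  reward < v.
Proof.
move=> gN pr0; have [p p0 cp] := rslope_lt0_exists hg gN.
have p2 : 0 < p / 2 by lra.
have [t [th [t0 tT th0 prA]]] := late_start_event p2 pr0.
set A := _ `&` _ in prA.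
have mx k : measurable_fun setT (lag (Z k) 0 t) := measurable_lag HB k (lexx 0) t0.
have ax k : adapted X t (lag (Z k) 0 t) := adapted_lag HB k (lexx 0) t0.
have FA : F t A.
  apply: filtrationI; first exact: F_after.
  have -> : [set w | x t w < p / 2 /\ th <= x t w - x' t w] =
      x t @^-1` `]-oo, p / 2[ `&` (fun w => x t w - x' t w) @^-1` `[th, +oo[.
    by apply/seteqP; split => w /=; rewrite !in_itv/= andbT.
  apply: filtrationI; apply: adapted_preimage; rewrite //.
  exact: (@measurable_funB _ _ _ _ (x t : g_sigma_algebraType (generators X t) -> R)
    (x' t : g_sigma_algebraType (generators X t) -> R) (ax lam) (ax mu)).
have mA := filtration_measurable mB FA.
(* The first bound keeps the forward maximum below [x - th / 2], since [x >= th]; the second, with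
   [x < p / 2], keeps the continued gap below [p]. *)
pose e := Num.min (th / 2) (p / 4).
have e0 : 0 < e by rewrite lt_min; apply/andP; split; lra.
have [q q0 Hq] := tube HB mu e0 T0.
have [E [mE EA prE' HE]] := Hq t A t0 tT FA.
pose Q w := \1_A w * continued t w + (1 - \1_A w) * late_gap w.
have QA w : A w -> Q w = continued t w.
  by move=> Aw; rewrite /Q indicE mem_set//= mulr1n; lra.
have QnA w : ~ A w -> Q w = late_gap w.
  by move=> Aw; rewrite /Q indicE memNset//= mulr0n; lra.
have mcont : measurable_fun setT (continued t).
  apply: measurable_funB.
    by apply: measurable_maxr; [exact: mx|exact: (measurable_fwd HB)].
  by apply: measurable_funB; exact: (@measurable_Z _ _ _ _ B).
have mQ : measurable_fun setT Q.
  have mI : measurable_fun setT (\1_A : Omega -> R) by exact: measurable_indic.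
  apply: measurable_funD; apply: measurable_funM => //.
  by apply: measurable_funB => //; exact: measurable_cst.
have late_le u w : 0 <= u -> u <= T -> late_gap w <= continued u w by exact: late_gap_le.
have bQ w : 0 <= Q w <= 2 * bound w.
  have [Aw|nAw] := pselect (A w); last by rewrite QnA.
  rewrite QA//; apply/andP; split.
    by apply: le_trans (late_le _ _ t0 tT); have /andP[] := b_late w.
  have /andP[_ b1] := lag_bounds HB mu0 w lam_bd (lexx 0) t0 tT.
  have /andP[_ b2] := fwd_bounds HB mu0 w mu_bd t0 tT (lexx T).
  have b3 : Z mu t w - Z mu T w <= bound w by apply: Z_incr_bound => //; apply: mu_bd.
  have b4 : Num.max (x t w) (fwd_seg (Z mu) t T w) <= bound w by rewrite ge_max b1 b2.
  by rewrite /continued; lra.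
have QC w u : tau w <= u -> u <= T -> Q w <= continued u w.
  move=> tu uT; have [Aw|nAw] := pselect (A w).
    rewrite QA//; apply: continued_mono => //.
    by apply: ltW; apply: lt_le_trans tu; case: Aw.
  by rewrite QnA//; apply: late_le => //; exact: le_trans tu.
apply: le_lt_trans (stopping_bound HB T0 mu0 lam_mu hg tauP mQ bQ QC) _.
have IQ := integrable_payoff HB T0 hg mQ bQ.
have IL := integrable_payoff HB T0 hg m_late b_late.
pose eta := - rslope g p * (th / 2).
have eta0 : 0 < eta by rewrite mulr_gt0//; lra.
rewrite -subr_gt0 -RintegralB//.
apply: (@lt_le_trans _ _ (eta * pr E)).
  by rewrite mulr_gt0//; apply: lt_le_trans prE'; rewrite mulr_gt0.
rewrite -(Rintegral_indic P mE) -RintegralZl//; last exact: integrable_indic.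
apply: le_Rintegral => //.
- by have := integrableZl measurableT eta (integrable_indic P mE); exact: eq_integrable.
- by have := integrableB measurableT IL IQ; exact: eq_integrable.
move=> w _; have g_ni : nonincreasing_fun g by case: hg.
have [Ew|nEw] := pselect (E w); last first.
  rewrite indicE memNset//= mulr0n mulr0 subr_ge0; apply: g_ni.
  have [Aw|nAw] := pselect (A w); last by rewrite QnA.
  by rewrite QA//; exact: late_le.
rewrite indicE mem_set//= mulr1n mulr1.
have Aw := EA _ Ew; rewrite QA//; case: (Aw) => _ [xp xth].
have [eth ep] : e <= th / 2 /\ e <= p / 4 by rewrite /e !ge_min !lexx orbT.
have N_le : fwd_seg (Z mu) t T w <= e.
  suff : seg_max (Z mu ^~ w) t T <= Z mu t w + e by rewrite /fwd_seg; lra.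
  apply: seg_max_le => // u tu uT; have := HE w Ew u tu uT.
  by rewrite ler_norml => /andP[_]; lra.
have := HE w Ew T tT (lexx T); rewrite ler_norml => /andP[D1 D2].
have /andP[x'0 _] := lag_bounds HB mu0 w mu_bd (lexx 0) t0 tT.
have l0 : 0 <= late_gap w by have /andP[] := b_late w.
have M1 : x t w <= Num.max (x t w) (fwd_seg (Z mu) t T w) by rewrite le_max lexx.
have M2 : Num.max (x t w) (fwd_seg (Z mu) t T w) <= p / 2.
  by rewrite ge_max; apply/andP; split; lra.
have M3 : Num.max (x' t w) (fwd_seg (Z mu) t T w) <= x t w - th / 2.
  by rewrite ge_max; apply/andP; split; lra.
have C1 : continued t w <= p by rewrite /continued; lra.
have C2 : late_gap w <= continued t w - th / 2.
  by rewrite (late_gap_split HB mu w t0 tT) /continued; lra.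
have c0 : 0 < continued t w by lra.
have := tangent_le hg c0 l0; have := rslope_nondecreasing hg c0 C1.
have := rslope_le0 hg (continued t w).
set c := rslope g (continued t w) => c1 c2 H.
by rewrite /eta; nra.
Qed.

End late_start.

(** * The three signs of the drift *)

Theorem theorem1p3 (R : realType) (d : measure_display)
    (Omega : measurableType d) (P : probability Omega R)
    (B : R -> {RV P >-> R}) (T lam : R) (f : R -> R)
    (HB : brownian_motion B) (T0 : 0 < T)
    (f_nonconstant : nonconstant_on `[0, +oo[ f)
    (f_nonincreasing : {in `[0, +oo[ &, nonincreasing_fun f})
    (f_convex : convex_function (`[0, +oo[ : set R^o) f) :
  [/\ lam < 0 -> nonconstant_on `]0, +oo[ f ->
        unique_optimal_rule B lam T f (cst 0),
      0 < lam -> nonconstant_on `]0, +oo[ f ->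
        unique_optimal_rule B lam T f (cst T) &
      lam = 0 ->
        [/\ forall tau : Omega -> R, stopping_rule B T tau ->
              stops_at_max_or_end B lam T tau -> optimal_rule B lam T f tau,
            optimal_rule B lam T f (cst 0),
            optimal_rule B lam T f (cst T) &
            ~ linear_on `]0, +oo[ f ->
              forall tau : Omega -> R, optimal_rule B lam T f tau ->
                stops_at_max_or_end B lam T tau]].
Proof.
set mu := `|lam|; have mu0 : 0 <= mu by exact: normr_ge0.
have lam_mu : lam = mu \/ lam = - mu.
  by rewrite /mu; case: (ger0P lam) => _; [left|right; rewrite opprK].
have T0' : 0 <= T by exact: ltW.
set g := regularize f; have hg : convex_payoff g by exact: convex_payoff_regularize.
have opt tau := optimal_ruleE HB T0 mu0 lam_mu f_nonincreasing f_convex tau.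
have ruleC c := @stopping_rule_cst _ _ _ P B T c.
have end_v := @reward_end _ _ _ P B T mu lam f.
have start_v := reward_start HB T0 mu0 lam_mu f_nonincreasing f_convex.
split.
- move=> lam0 /nonconstant_regularize gN.
  have lm : lam = - mu by rewrite /mu ltr0_norm ?opprK.
  have lam_lt : lam < mu by rewrite /mu; apply: lt_le_trans lam0 _.
  split; first by apply/opt; split; [exact: ruleC|exact: start_v].
  move=> sigma /opt[sP sv].
  have ms := measurable_tau T0 sP.
  have mN : measurable [set w | 0 < sigma w].
    rewrite (_ : [set _ | _] = sigma @^-1` `]0, +oo[); first exact: measurable_pre.
    by apply/seteqP; split => w /=; rewrite in_itv/= andbT.
  have N0 : pr P [set w | 0 < sigma w] = 0.
    apply/eqP; rewrite eq_le pr_ge0 andbT leNgt; apply/negP => prN.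
    by have := reward_lt_start HB T0 mu0 lam_mu hg sP lam_lt gN prN; rewrite sv ltxx.
  apply: filterS (ae_pr0 mN N0) => w /= /negP; rewrite -leNgt => s0.
  by apply/eqP; rewrite eq_le s0; case: sP => -[+ _] _; apply.
- move=> lam0 /nonconstant_regularize gN.
  have lm : lam = mu by rewrite /mu gtr0_norm.
  have mu_gt0 : 0 < mu by rewrite -lm.
  split; first by apply/opt; split; [exact: ruleC|exact: end_v].
  move=> sigma /opt[sP sv].
  have ms := measurable_tau T0 sP.
  have mN : measurable [set w | sigma w < T].
    rewrite (_ : [set _ | _] = sigma @^-1` `]-oo, T[); first exact: measurable_pre.
    by apply/seteqP; split => w /=; rewrite in_itv.
  have N0 : pr P [set w | sigma w < T] = 0.
    apply/eqP; rewrite eq_le pr_ge0 andbT leNgt; apply/negP => prN.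
    suff : (\int[P]_w g (stop_gap B T lam (sigma w) w) < \int[P]_w g (late_gap B T mu w))%R.
      by rewrite sv ltxx.
    (* Lags are nonnegative, so -1 is no restriction: with positive drift even stopping at the
       current maximum is penalised. *)
    apply: (reward_lt HB T0 mu0 lam_mu hg sP (a := fun=> -1) mN _ _ prN).
      move=> w sT; split => //; exists 0%N => n _.
      by apply: lt_le_trans (x_tau_ge0 HB mu0 lam_mu sP w); rewrite ltrN10.
    move=> n; have dl0 : 0 < n.+1%:R^-1 :> R by rewrite invr_gt0.
    have [rho rho0 H] := gain_nonconstant HB T0 mu0 lam_mu hg n.+1%:R lm mu_gt0 gN dl0.
    exists rho => // t A Q t0 tT FA JA; apply: H => // w /JA[].
    by [].
  apply: filterS (ae_pr0 mN N0) => w /= /negP; rewrite -leNgt => s0.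
  by apply/eqP; rewrite eq_le s0 andbT; case: sP => _; apply.
- move=> lam0; have m0 : mu = 0 by rewrite /mu lam0 normr0.
  have lm : lam = mu by rewrite m0.
  have ml : - mu = lam by rewrite m0 lam0 oppr0.
  split.
  + move=> tau tP /(stops_at_max_or_endE HB T0 mu0 lam_mu tP) early0.
    by apply/opt; split => //; exact: reward_max_or_end.
  + by apply/opt; split; [exact: ruleC|exact: start_v].
  + by apply/opt; split; [exact: ruleC|exact: end_v].
  move=> f_nonlin tau /opt[tP tv].
  have gnl : ~ linear_on `]0, +oo[ g by move=> /linear_regularize.
  apply/(stops_at_max_or_endE HB T0 mu0 lam_mu tP).
  apply/eqP; rewrite eq_le pr_ge0 andbT leNgt; apply/negP => prN.
  suff : (\int[P]_w g (stop_gap B T lam (tau w) w) < \int[P]_w g (late_gap B T mu w))%R.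
    by rewrite tv ltxx.
  (* Without drift only positive lags are penalised, hence a lower bound that tends to 0. *)
  apply: (reward_lt HB T0 mu0 lam_mu hg tP (a := fun n => n.+1%:R^-1)
    (measurable_early HB lam T0 tP) _ _ prN).
    move=> w [x0 tT]; split => //.
    exact: invS_lt.
  by move=> n; apply: gain_convex => //; rewrite invr_gt0.
Qed.
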